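(* Let $(\Omega,\mathcal F,P)$ be a standard probability space carrying a one-dimensional Brownian motion $(B_t)_{t\in[0,1]}$, and for $\omega\in\Omega$ let $$M_\omega=\{s\in(0,1):\exists \varepsilon>0\ \forall t\in(s-\varepsilon,s)\cup(s,s+\varepsilon)\quad B_s(\omega)<B_t(\omega)\}$$ be the set of local minimizers of the path on $(0,1)$. Then the $\mathrm{DCS}(0,1)$-valued random variable $\omega\mapsto M_\omega$ is distributed like an unordered uniform infinite sample. That is, there exists a probability measure $J$ on $\Omega\times(0,1)^\infty$ whose marginals are $P$ and $\mathrm{mes}^\infty$ (the product of countably many copies of Lebesgue measure on $(0,1)$) such that $$M_\omega=S_u\quad\text{for } J\text{-almost all pairs }(\omega,u),$$ where $S_u=\{u_1,u_2,\dots\}$ for $u=(u_1,u_2,\dots)\in(0,1)^\infty$.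
   Context: $\mathrm{DCS}(0,1)$ is the set of all dense countable subsets of $(0,1)$. It is viewed as the quotient of the standard Borel space of sequences $u=(u_1,u_2,\dots)$ of pairwise different points of $(0,1)$ (with dense range) by the equivalence relation $S_u=S_v$, where $S_u=\{u_1,u_2,\dots\}$. A $\mathrm{DCS}(0,1)$-valued random variable on a probability space $\Omega$ is a map (defined up to null sets) of the form $\omega\mapsto S_{Y(\omega)}$ with $Y$ a measurable map from $\Omega$ to that sequence space. Two such random variables $f$ on $(\Omega_1,P_1)$ and $g$ on $(\Omega_2,P_2)$ are identically distributed if there is a joining $J$, i.e. a probability measure on $\Omega_1\times\Omega_2$ with marginals $P_1,P_2$, such that $f(\omega_1)=g(\omega_2)$ for $J$-almost all $(\omega_1,\omega_2)$. An unordered uniform infinite sample is the random set $\{U_1,U_2,\dots\}$ where $U_1,U_2,\dots$ are i.i.d. uniform on $(0,1)$. It is well known that $M_\omega$ is a dense countable set for almost all $\omega$. A standard probability space is a Lebesgue–Rokhlin space (isomorphic mod 0 to an interval with Lebesgue measure, a finite or countable collection of atoms, or a combination of both). *)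

(* Defs.v *)
From HB Require Import structures.
From mathcomp Require Import all_boot all_order all_algebra.
From mathcomp Require Import all_classical all_reals all_analysis.
Set Implicit Arguments.
Unset Strict Implicit.
Unset Printing Implicit Defensive.
Import Order.TTheory GRing.Theory Num.Theory.
Import numFieldNormedType.Exports.
Local Open Scope classical_set_scope.
Local Open Scope ring_scope.

Record I01 (R : realType) := MkI01 { I01val : R ; _ : 0 < I01val < 1 }.
Arguments I01val {R} _.

HB.instance Definition _ (R : realType) := [isSub of I01 R for @I01val R].
HB.instance Definition _ (R : realType) := [Choice of I01 R by <:].

Lemma half_in_I01 (R : realType) : 0 < (2^-1 : R) < 1.
Proof. by rewrite invr_gt0 ltr0n invf_lt1 ?ltr1n ?ltr0n. Qed.

HB.instance Definition _ (R : realType) :=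
  isPointed.Build (I01 R) (MkI01 (half_in_I01 R)).

(* (0,1) with the trace of the Borel sigma-algebra of R *)
Notation mI01 R := (g_sigma_algebra_preimageType (@I01val R)).

Definition mes01 {R : realType} (A : set (mI01 R)) : \bar R :=
  lebesgue_measure (I01val @` A).

Definition cylinders (R : realType) : set_system (nat -> mI01 R) :=
  \bigcup_i preimage_set_system setT (fun u : nat -> mI01 R => u i) measurable.

(* (0,1)^oo with the product sigma-algebra *)
Notation I01seq R := (g_sigma_algebraType (@cylinders R)).

(* [mes^oo] is characterised as the (unique) measure on the product
   sigma-algebra with these values on the finite-dimensional boxes. *)
Definition is_mes_infty {R : realType} (Q : set (I01seq R) -> \bar R) : Prop :=
  forall (n : nat) (A : 'I_n -> set (mI01 R)),
    (forall i, measurable (A i)) ->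
    Q [set u : I01seq R | forall i : 'I_n, A i (u i)] = (\prod_(i < n) mes01 (A i))%E.

Definition seq_set {R : realType} (u : I01seq R) : set R :=
  range (fun i => I01val (u i)).

Definition DCS_sequences {R : realType} : set (I01seq R) :=
  [set u | injective u /\ `]0, 1[ `<=` closure (seq_set u)].

Definition DCS_random_variable {R : realType} {d} {T : measurableType d}
    (P : probability T R) (f : T -> set R) : Prop :=
  exists Y : T -> I01seq R,
    [/\ measurable_fun setT Y, (forall w, DCS_sequences (Y w))
      & {ae P, forall w, f w = seq_set (Y w)}].

Definition iso_mod0 {R : realType} {d1 d2} {T1 : measurableType d1}
    {T2 : measurableType d2} (m1 : set T1 -> \bar R) (m2 : set T2 -> \bar R) :
    Prop :=
  exists (X1 : set T1) (X2 : set T2) (phi : T1 -> T2),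
    [/\ measurable X1 /\ m1 (~` X1) = 0%E,
        measurable X2 /\ m2 (~` X2) = 0%E,
        set_bij X1 X2 phi,
        (forall A, A `<=` X2 ->
           (measurable A <-> measurable (X1 `&` phi @^-1` A)))
      & (forall A, A `<=` X2 -> measurable A ->
           m1 (X1 `&` phi @^-1` A) = m2 A)].

(* the real line with the sigma-algebra of Lebesgue measurable sets *)
Notation lebesgueR R :=
  (caratheodory_type (mu_ext (wlength (@idfun (R : realType))))).

(* The model "interval + atoms": Lebesgue measure on [0, a] plus an atom of
   mass [p n] at the point -(n + 1), outside the interval. Every set of such
   points is Lebesgue measurable, so the sigma-algebra is discrete on atoms.
   Either part may vanish ([a = 0], or [p n = 0] for some or all n). *)
Definition interval_atoms {R : realType} (a : R) (p : nat -> R)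
    (A : set (lebesgueR R)) : \bar R :=
  (completed_lebesgue_measure (A `&` [set x : R | (0 <= x <= a)%R])
   + \sum_(0 <= n <oo) (p n)%:E * \d_(- n.+1%:R : R)%R (A : set R))%E.

Definition standard_probability_space {R : realType} {d}
    {T : measurableType d} (P : probability T R) : Prop :=
  measure_is_complete P /\
  exists (a : R) (p : nat -> R),
    [/\ 0 <= a, (forall n, 0 <= p n) & iso_mod0 P (interval_atoms a p)].

Definition mutually_independent {R : realType} {d} {T : measurableType d}
    (P : probability T R) (n : nat) (X : 'I_n -> T -> R) : Prop :=
  forall A : 'I_n -> set R, (forall i, measurable (A i)) ->
    P [set w | forall i, A i (X i w)] = (\prod_(i < n) P (X i @^-1` A i))%E.

(* Only the values [B t] with t in [0, 1] matter. The second argument of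
   [normal_prob] is the standard deviation. *)
Record Brownian_motion {R : realType} {d} {T : measurableType d}
    (P : probability T R) (B : R -> T -> R) : Prop := {
  BM_measurable : forall t, 0 <= t <= 1 -> measurable_fun setT (B t) ;
  BM_start : {ae P, forall w, B 0 w = 0} ;
  BM_independent : forall (n : nat) (t : nat -> R),
    0 <= t 0%N -> t n <= 1 -> (forall i, (i < n)%N -> t i < t i.+1) ->
    mutually_independent P (fun (i : 'I_n) w => B (t i.+1) w - B (t i) w) ;
  BM_gaussian : forall s t, 0 <= s -> s < t -> t <= 1 ->
    forall A : set R, measurable A ->
    P [set w | A (B t w - B s w)] = normal_prob 0 (Num.sqrt (t - s)) A ;
  BM_continuous :
    {ae P, forall w, {within `[0, 1], continuous (fun t => B t w)}} }.

(* As s lies in the open interval (0, 1), e can always be decreased so that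
   only values of b on (0, 1) are compared. *)
Definition local_minimizers {R : realType} (b : R -> R) : set R :=
  [set s | 0 < s < 1 /\
    exists2 e, 0 < e &
      forall t, (`]s - e, s[ `|` `]s, s + e[) t -> b s < b t].

(* Main.v *)
(** Let [u] be an independent uniform sequence. Step by step, its coordinates are replaced
    by local minimizers of the path, in such a way that the law of the sequence changes by
    arbitrarily little. A coordinate [u j] is replaced by the minimizer of the path on a short
    interval starting at [u j]: after resampling the increments of the path on that interval,
    the new point is [u j] shifted by an independent small amount, and the minimizers chosen
    before are not disturbed. To exhaust all minimizers, the first one not yet used has to be
    inserted as well; inserted at a random place among many coordinates it hardly changes
    the law (law of large numbers), because its law given the others has a density. Indeed
    resampling also shows that [(s_0, ..., s_(m-1), u m, u m.+1, ...)] almost surely avoids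
    a given null set, for all distinct minimizers [s_0, ..., s_(m-1)] simultaneously.

    The limit enumerates the minimizers and its law is absolutely continuous with respect to
    the law of [u]. By the Hewitt-Savage zero-one law the mass of its density can be
    transported, by permuting coordinates, to the constant density 1, which turns the limit
    into an i.i.d. enumeration of the same set. *)

Require Import Defs.
From HB Require Import structures.
From mathcomp Require Import all_boot all_order all_algebra.
From mathcomp Require Import all_classical all_reals all_analysis.
From mathcomp Require Import measurable_realfun lra.
Set Implicit Arguments.
Unset Strict Implicit.
Unset Printing Implicit Defensive.
Import Order.TTheory GRing.Theory Num.Theory.
Import numFieldNormedType.Exports.
Local Open Scope classical_set_scope.
Local Open Scope ring_scope.

(** * Measurability of events and of functions defined by cases *)

Section real_events.
Context d (T : measurableType d) (R : realType).
Implicit Types f g : T -> R.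

(** Laws are compared through one-sided bounds [law C <= law' C + e], uniform in the measurable set
    [C]. Such bounds tolerate the mass lost at the right end of (0,1), where a shifted point would
    leave the interval, and complements make them two-sided. The obstacle is that all choices depend
    on one path: a point chosen near [u j] must not disturb earlier points. Hence every choice has
    to be stable under resampling on short intervals at later [u j]; this holds eventually, as the
    length tends to 0, for almost every path and sequence. Paths enter through their values at the
    rationals, so that path space is a sequence space and the minimizers form a countable family
    [pt l], one for each rational interval. Stage [k] changes the law by at most [2^-k]; the limit
    law is then close to the i.i.d. law but need not equal it. Absolute continuity survives the
    limit because every stage gives mass 0 to a given null set, while the distance from stage [k] to
    the limit is at most [2 * 2^-k]. The final transport needs one more independent uniform
    variable, to split the mass at a point among several permutations. *)

Lemma measurable_set_forall (F : nat -> set T) :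
  (forall n, measurable (F n)) -> measurable [set x | forall n, F n x].
Proof.
move=> mF; rewrite (_ : [set _ | _] = \bigcap_n F n).
  exact: bigcapT_measurable.
by apply/seteqP; split => x; [move=> h n _; exact: h|move=> h n; exact: h].
Qed.

Lemma measurable_set_exists (F : nat -> set T) :
  (forall n, measurable (F n)) -> measurable [set x | exists n, F n x].
Proof.
move=> mF; rewrite (_ : [set _ | _] = \bigcup_n F n).
  exact: bigcupT_measurable.
by apply/seteqP; split => x; [move=> [n h]; exists n|move=> [n _ h]; exists n].
Qed.

Lemma measurable_set_and (A B : set T) :
  measurable A -> measurable B -> measurable [set x | A x /\ B x].
Proof. exact: measurableI. Qed.

Lemma measurable_set_not (A : set T) :
  measurable A -> measurable [set x | ~ A x].
Proof. exact: measurableC. Qed.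

Lemma measurable_set_imp (A B : set T) :
  measurable A -> measurable B -> measurable [set x | A x -> B x].
Proof.
move=> mA mB; rewrite (_ : [set _ | _] = ~` A `|` B); last first.
  apply/seteqP; split => x /=; first by have [|] := pselect (A x); tauto.
  by case.
by apply: measurableU => //; exact: measurableC.
Qed.

Lemma measurable_set_const (p : Prop) : measurable [set x : T | p].
Proof.
have [hp|hp] := pselect p.
  by rewrite (_ : [set _ | _] = setT)//; apply/seteqP; split.
by rewrite (_ : [set _ | _] = set0)//; apply/seteqP; split.
Qed.

Lemma measurable_preimageT d' (U : measurableType d') (f : T -> U) (A : set U) :
  measurable_fun setT f -> measurable A -> measurable [set x | A (f x)].
Proof. by move=> mf mA; rewrite -[X in measurable X]setTI; exact: mf. Qed.

Lemma measurable_set_lt f g : measurable_fun setT f -> measurable_fun setT g ->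
  measurable [set x | f x < g x].
Proof.
move=> mf mg.
have /(_ measurableT [set true] I) := measurable_fun_ltr mf mg.
by rewrite setTI; congr (measurable _); apply/seteqP; split => x /=.
Qed.

Lemma measurable_set_le f g : measurable_fun setT f -> measurable_fun setT g ->
  measurable [set x | f x <= g x].
Proof.
move=> mf mg; rewrite (_ : [set _ | _] = ~` [set x | g x < f x]).
  by apply: measurableC; exact: measurable_set_lt.
by apply/seteqP; split => x /=; rewrite leNgt => /negP.
Qed.

Lemma measurable_set_eq f g : measurable_fun setT f -> measurable_fun setT g ->
  measurable [set x | f x = g x].
Proof.
move=> mf mg.
rewrite (_ : [set _ | _] = [set x | f x <= g x] `&` [set x | g x <= f x]).
  by apply: measurableI; exact: measurable_set_le.
apply/seteqP; split => x /=; first by move=> ->.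
by move=> [? ?]; apply/le_anti/andP.
Qed.

Lemma measurable_fun_of_lt f :
  (forall r, measurable [set x | f x < r]) -> measurable_fun setT f.
Proof.
move=> h; apply: (measurability _ (RGenInftyO.measurableE R)) => //.
move=> _ [_ [r ->] <-]; rewrite setTI.
rewrite (_ : _ @^-1` _ = [set x | f x < r])//.
Qed.

End real_events.

Lemma measurable_fun_glue d d' (T : measurableType d) (U : measurableType d')
    (D : set T) (f g h : T -> U) : measurable D ->
  measurable_fun setT f -> measurable_fun setT g ->
  (forall x, D x -> h x = f x) -> (forall x, ~ D x -> h x = g x) ->
  measurable_fun setT h.
Proof.
move=> mD mf mg hf hg _ A mA; rewrite setTI.
rewrite (_ : _ @^-1` _ = (D `&` f @^-1` A) `|` (~` D `&` g @^-1` A)).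
  apply: measurableU; apply: measurableI => //.
  - exact: measurable_preimageT.
  - exact: measurableC.
  - exact: measurable_preimageT.
apply/seteqP; split => x /=.
  by have [/[dup] /hf ->|/[dup] /hg ->] := pselect (D x); tauto.
by case=> -[Dx ?]; rewrite ?(hf _ Dx) ?(hg _ Dx).
Qed.

(** The sets [D n] may overlap: since [h] agrees with [f n] on all of [D n], the preimage of [A] is
    the union of the parts of [D n] that [f n] sends to [A]. This serves for functions that select
    an index among countably many. *)
Lemma measurable_fun_case_nat d d' (T : measurableType d) (U : measurableType d')
    (D : nat -> set T) (f : nat -> T -> U) (h : T -> U) :
  (forall n, measurable (D n)) -> (forall n, measurable_fun setT (f n)) ->
  (forall x, exists n, D n x) -> (forall n x, D n x -> h x = f n x) ->
  measurable_fun setT h.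
Proof.
move=> mD mf cD hf _ A mA; rewrite setTI.
rewrite (_ : _ @^-1` _ = \bigcup_n (D n `&` f n @^-1` A)).
  apply: bigcupT_measurable => n; apply: measurableI => //.
  exact: measurable_preimageT.
apply/seteqP; split => x /=.
  by move=> Ahx; have [n Dn] := cD x; exists n => //; split; rewrite //= -hf.
by move=> [n _ [Dn /=]]; rewrite (hf n).
Qed.

(** * Sequence spaces *)

(** For [E := mI01 R] this is convertible with [cylinders R], so that [seqsp (mI01 R)] and the
    [I01seq R] of the theorem are one space; [E := R] gives the space of sampled paths. *)
Definition seq_cylinders d (E : measurableType d) : set_system (nat -> E) :=
  \bigcup_i preimage_set_system setT (fun u : nat -> E => u i) measurable.

Notation seqsp E := (g_sigma_algebraType (@seq_cylinders _ E)).

Section sequence_space.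
Context d (E : measurableType d).

Lemma measurable_coord i : measurable_fun setT (fun u : seqsp E => u i).
Proof.
move=> _ A mA; apply: sub_sigma_algebra.
by exists i => //; exists A.
Qed.

Lemma measurable_fun_seqP d' (T : measurableType d') (f : T -> seqsp E) :
  (forall i, measurable_fun setT (fun x => f x i)) -> measurable_fun setT f.
Proof.
move=> mf; apply: (@measurability _ _ T (seqsp E) _ _ (@seq_cylinders _ E) erefl).
move=> _ [_ [i _ [A mA <-]] <-]; rewrite setTI.
have := mf i measurableT A mA.
by rewrite !setTI.
Qed.

Definition box n (A : nat -> set E) : set (seqsp E) :=
  [set u | forall i, (i < n)%N -> A i (u i)].

Lemma measurable_box n A : (forall i, measurable (A i)) -> measurable (box n A).
Proof.
move=> mA.
rewrite (_ : box n A = [set u | forall i, ((i < n)%N -> A i (u i))])//.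
apply: measurable_set_forall => i.
apply: measurable_set_imp; first exact: measurable_set_const.
by apply: measurable_preimageT => //; exact: measurable_coord.
Qed.

(** Boxes form a generating pi-system: two boxes of different lengths intersect in a box once both
    are padded with [setT] to a common length. *)
Lemma seqsp_measure_unique (R : realType) (m1 m2 : {measure set (seqsp E) -> \bar R}) :
  (m1 setT < +oo)%E ->
  (forall n A, (forall i, measurable (A i)) -> m1 (box n A) = m2 (box n A)) ->
  forall A, measurable A -> m1 A = m2 A.
Proof.
move=> m1oo m12 A mA.
pose G : set (set (seqsp E)) := [set B | exists n A,
   (forall i, measurable (A i)) /\ B = box n A].
have boxT : G setT.
  exists 0%N, (fun=> setT); split => //.
  by apply/seteqP; split.
apply: (g_sigma_algebra_measure_unique G _ (fun=> setT)) => //.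
- by move=> _ [n [B [mB ->]]]; exact: measurable_box.
- by apply/seteqP; split => // x _; exists 0%N.
- move=> _ _ [n [B [mB ->]]] [m [C [mC ->]]].
  exists (maxn n m), (fun i => (if (i < n)%N then B i else setT) `&`
    (if (i < m)%N then C i else setT)); split.
    by move=> i; apply: measurableI; case: ifP.
  apply/seteqP; split => u /=.
    by move=> [hB hC] i _; split; case: ifP => // ?; [exact: hB|exact: hC].
  move=> h; split=> i ilt.
    have := h i; rewrite leq_max ilt => /(_ isT)[].
    by [].
  by have := h i; rewrite leq_max ilt orbT => /(_ isT)[].
- by move=> B [n [C [mC ->]]]; exact: m12.
- move: A mA; apply: sub_sigma_algebra2 => _ [i _ [A mA <-]].
  exists i.+1, (fun j => if j == i then A else setT); split.
    by move=> j; case: ifP.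
  apply/seteqP; split => u /=.
    by move=> [_ Au] j _; case: eqP => // ->.
  by move=> /(_ i (ltnSn i)); rewrite eqxx; split.
Qed.

(** Dependence on the first [n] coordinates is expressed as invariance rather than as a preimage,
    which makes complements, unions and larger [n] immediate. *)
Definition cylinder n (D : set (seqsp E)) := measurable D /\
  forall u v : seqsp E, (forall i, (i < n)%N -> u i = v i) -> D u -> D v.

Lemma cylinderC n D : cylinder n D -> cylinder n (~` D).
Proof.
move=> [mD hD]; split; first exact: measurableC.
by move=> u v uv Du Dv; apply: Du; apply: hD Dv => i /uv.
Qed.

Lemma cylinderW n m D : (n <= m)%N -> cylinder n D -> cylinder m D.
Proof.
move=> nm [mD hD]; split=> // u v uv; apply: hD => i ilt.
by apply: uv; exact: leq_trans nm.
Qed.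

Lemma cylinderU n D D' : cylinder n D -> cylinder n D' -> cylinder n (D `|` D').
Proof.
move=> [mD hD] [mD' hD']; split; first exact: measurableU.
by move=> u v uv [/(hD _ _ uv)|/(hD' _ _ uv)]; [left|right].
Qed.

(** The sets that can be approximated form a sigma-algebra containing the generators. Only countable
    unions need care: they are truncated to finite ones before approximating. *)
Lemma cylinder_approx (R : realType) (mu : {measure set (seqsp E) -> \bar R})
    (A : set (seqsp E)) (e : R) : (mu setT < +oo)%E -> measurable A -> 0 < e ->
  exists n D, cylinder n D /\ (mu ((A `\` D) `|` (D `\` A)) < e%:E)%E.
Proof.
move=> muoo mA e0.
pose S : set (set (seqsp E)) := [set A | measurable A /\ forall e : R, 0 < e ->
  exists n D, cylinder n D /\ (mu ((A `\` D) `|` (D `\` A)) < e%:E)%E].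
suff : S A by move=> [_]; apply.
move: A mA; apply: smallest_sub; last first.
  move=> _ [i _ [A mA <-]].
  have mA' : measurable ([set: seqsp E] `&` (fun u : nat -> E => u i) @^-1` A).
    by apply: (@measurable_coord i measurableT A mA).
  split=> // e' e'0; exists i.+1, ([set: seqsp E] `&` (fun u : nat -> E => u i) @^-1` A).
  split; last by rewrite setDv setU0 measure0 lte_fin.
  by split => // u v uv [_ /=]; rewrite /preimage/= uv.
have fin (D : set (seqsp E)) : measurable D -> mu D \is a fin_num.
  move=> mD; rewrite ge0_fin_numE//; apply: le_lt_trans muoo.
  by apply: le_measure => //; rewrite inE.
have S0 : S set0.
  split=> // e' e'0; exists 0%N, set0; split.
    by split => // u v _ [].
  by rewrite setDv setU0 measure0 lte_fin.
have SC B : S B -> S (~` B).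
  move=> [mB hB]; split; first exact: measurableC.
  move=> e' /hB[n [D [cD hD]]]; exists n, (~` D); split; first exact: cylinderC.
  rewrite (_ : _ `|` _ = (B `\` D) `|` (D `\` B))//.
  by apply/seteqP; split => u; rewrite /setD/setU/setC/=;
    case: (pselect (B u)); case: (pselect (D u)); tauto.
have SU B C : S B -> S C -> S (B `|` C).
  move=> [mB hB] [mC hC]; split; first exact: measurableU.
  move=> e' e'0.
  have e'20 : 0 < e' / 2 by rewrite divr_gt0.
  have [n [D [cD hD]]] := hB _ e'20.
  have [m [D' [cD' hD']]] := hC _ e'20.
  exists (maxn n m), (D `|` D'); split.
    apply: cylinderU; first by apply: cylinderW cD; rewrite leq_maxl.
    by apply: cylinderW cD'; rewrite leq_maxr.
  have mD := cD.1; have mD' := cD'.1.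
  apply: (@le_lt_trans _ _ (mu (((B `\` D) `|` (D `\` B)) `|`
    ((C `\` D') `|` (D' `\` C))))).
    apply: le_measure; rewrite ?inE.
    - by apply: measurableU; apply: measurableD; exact: measurableU.
    - by apply: measurableU; apply: measurableU; apply: measurableD.
    - by move=> u; rewrite /setD/setU/setC/=; tauto.
  apply: (le_lt_trans (measureU2 _ _ _)).
  - by apply: measurableU; apply: measurableD.
  - by apply: measurableU; apply: measurableD.
  - by rewrite [e']splitr EFinD lteD.
split => //.
- by move=> B SB; rewrite setTD; exact: SC.
- move=> F0 SF; pose F : (set (seqsp E))^nat := F0; rewrite -/F; rewrite -/F in SF.
  have mF n : measurable (F n) by case: (SF n).
  split; first exact: bigcupT_measurable.
  move=> e' e'0.
  pose G n := \big[setU/set0]_(i < n) F i.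
  have SG n : S (G n).
    rewrite /G; elim: n => [|n ih]; first by rewrite big_ord0.
    by rewrite big_ord_recr/=; exact: SU.
  have mG n : measurable (G n) by case: (SG n).
  (* [H n] is what the first [n] sets miss of the union. It decreases to the empty set, so some
     [H N] has measure below [e' / 2]; approximating the finite union [G N] takes the other half. *)
  pose H n := (\bigcup_k F k) `\` G n.
  have mH n : measurable (H n).
    by apply: measurableD => //; exact: bigcupT_measurable.
  have : mu (H n) @[n --> \oo] --> mu (\bigcap_n H n).
    apply: nonincreasing_cvg_mu => //.
    - by rewrite -ge0_fin_numE//; exact: fin.
    - exact: bigcapT_measurable.
    - move=> n m nm; apply/subsetPset => u [Fu Gu]; split => //; apply: contra_not Gu.
      by rewrite /G -!bigcup_mkord => -[i /= ilt Fi]; exists i => //=; exact: leq_trans nm.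
  rewrite (_ : \bigcap_n H n = set0); last first.
    apply/seteqP; split => // u Hu.
    have [[k _ Fk] _] := Hu 0%N I.
    have [_] := Hu k.+1 I; apply.
    by rewrite /G -bigcup_mkord; exists k => //=.
  rewrite measure0 => /fine_cvgP[_] /cvgrPdist_lt/(_ (e' / 2)).
  rewrite divr_gt0// => /(_ isT)[N _ /(_ N (leqnn N))]/=.
  rewrite sub0r normrN ger0_norm ?fine_ge0// => HN.
  have [n [D [cD hD]]] := (SG N).2 (e' / 2) ltac:(by rewrite divr_gt0).
  exists n, D; split=> //.
  have mD := cD.1.
  apply: (@le_lt_trans _ _ (mu (H N `|` ((G N `\` D) `|` (D `\` G N))))).
    apply: le_measure; rewrite ?inE.
    - by apply: measurableU; apply: measurableD => //; exact: bigcupT_measurable.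
    - by apply: measurableU => //; apply: measurableU; apply: measurableD.
    - have GF u : G N u -> (\bigcup_k F k) u.
        by rewrite /G -bigcup_mkord => -[i _ Fi]; exists i.
      move=> u; rewrite /H /setD/setU/setC/=; have := GF u.
      by case: (pselect (G N u)); tauto.
  apply: (le_lt_trans (measureU2 _ _ _)) => //.
    by apply: measurableU; apply: measurableD.
  rewrite [e']splitr EFinD lteD//.
by move: HN; rewrite -lte_fin fineK//; exact: fin.
Qed.

End sequence_space.

(** * Change of variables and sections of product measures *)

Lemma measure_probability_setT d (T : measurableType d) (R : realType)
  (P : probability T R) : (P : {measure set T -> \bar R}) setT = 1%E.
Proof. exact: probability_setT. Qed.

Section laws.
Context d1 d2 (S : measurableType d1) (U : measurableType d2) (R : realType).

Lemma ge0_integral_law (mu : {measure set S -> \bar R})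
    (nu : {measure set U -> \bar R}) (F : S -> U) (f : U -> \bar R) :
  measurable_fun setT F -> (forall A, measurable A -> nu A = mu (F @^-1` A)) ->
  measurable_fun setT f -> (forall x, (0 <= f x)%E) ->
  (\int[nu]_x f x = \int[mu]_x f (F x))%E.
Proof.
move=> mF nuE mf f0.
rewrite (@eq_measure_integral _ _ _ setT (pushforward mu F)); last first.
  by move=> A mA _; exact: nuE.
by rewrite (ge0_integral_pushforward mF)// preimage_setT.
Qed.

End laws.

Lemma product_measure_integral_l d1 d2 (S : measurableType d1)
    (U : measurableType d2) (R : realType) (m1 : probability S R)
    (m2 : probability U R) (A : set (S * U)) : measurable A ->
  ((m1 \x m2) A = \int[m1]_x m2 [set y | A (x, y)])%E.
Proof.
move=> mA; apply: eq_integral => x _ /=; congr (m2 _).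
by apply/seteqP; split => y /=; rewrite /xsection/= inE.
Qed.

Lemma product_measure_integral_r d1 d2 (S : measurableType d1)
    (U : measurableType d2) (R : realType) (m1 : probability S R)
    (m2 : probability U R) (A : set (S * U)) : measurable A ->
  ((m1 \x m2) A = \int[m2]_y m1 [set x | A (x, y)])%E.
Proof.
move=> mA; transitivity ((m1 \x^ m2)%E A).
  by apply: product_measure_unique => //= B C mB mC; rewrite product_measure2E.
apply: eq_integral => x _ /=; congr (m1 _).
by apply/seteqP; split => y /=; rewrite /ysection/= inE.
Qed.

Lemma measurable_section_l d1 d2 (S : measurableType d1)
    (U : measurableType d2) (A : set (S * U)) x : measurable A ->
  measurable [set y | A (x, y)].
Proof.
move=> mA; rewrite (_ : [set _ | _] = xsection A x); first exact: measurable_xsection.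
by apply/seteqP; split => y /=; rewrite /xsection/= inE.
Qed.

Lemma measurable_section_r d1 d2 (S : measurableType d1)
    (U : measurableType d2) (A : set (S * U)) y : measurable A ->
  measurable [set x | A (x, y)].
Proof.
move=> mA; rewrite (_ : [set _ | _] = ysection A y); first exact: measurable_ysection.
by apply/seteqP; split => x /=; rewrite /ysection/= inE.
Qed.

(** * Independent identically distributed sequences *)

Section iid.
Context d (E : measurableType d) (R : realType) (la : probability E R)
  (Q : probability (seqsp E) R).
Hypothesis hQ : forall n A, (forall i, measurable (A i)) ->
  Q (box n A) = (\prod_(i < n) la (A i))%E.

(** Every invariance of the i.i.d. law below is checked on boxes through this lemma, where it
    becomes an identity between finite products. *)
Lemma iid_law d' (S : measurableType d') (mu : probability S R)
    (F : S -> seqsp E) : measurable_fun setT F ->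
  (forall n A, (forall i, measurable (A i)) ->
     mu (F @^-1` box n A) = (\prod_(i < n) la (A i))%E) ->
  forall A, measurable A -> Q A = mu (F @^-1` A).
Proof.
move=> mF h A mA.
rewrite -[RHS]/(pushforward mu F A).
have mF_mixin := isMeasurableFun.Build _ _ _ _ _ mF.
pose mF_pack : {mfun _ >-> _} := HB.pack F mF_mixin.
have Qoo : (Q setT < +oo)%E by rewrite probability_setT ltry.
apply: (@seqsp_measure_unique _ E R Q (pushforward mu mF_pack) Qoo) => //.
by move=> n B mB; exact: etrans (hQ n mB) (esym (h n B mB)).
Qed.

Definition setc j (t : E) (u : seqsp E) : seqsp E :=
  fun i => if i == j then t else u i.

Lemma measurable_setc j : measurable_fun setT (fun z : E * seqsp E => setc j z.1 z.2).
Proof.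
apply: measurable_fun_seqP => i; rewrite /setc; case: eqP => _.
  exact: measurable_fst.
exact: (measurableT_comp (@measurable_coord _ E i) measurable_snd).
Qed.

(** Independence of the coordinate [j] from the others in a form ready for Fubini: the coordinate
    becomes an integration variable of its own, the others being frozen. *)
Lemma iid_setc j A : measurable A ->
  (Q A = (la \x Q) [set z | A (setc j z.1 z.2)])%E.
Proof.
apply: (@iid_law _ _ (la \x Q)%E); first exact: measurable_setc.
move=> n B mB.
pose B1 := if (j < n)%N then B j else setT.
pose B2 i := if i == j then setT else B i.
have -> : (fun z : E * seqsp E => setc j z.1 z.2) @^-1` (box n B) = B1 `*` box n B2.
  apply/seteqP; split => -[t u]; rewrite /box/B1/B2/setc/=.
    move=> h; split; last by move=> i /h; case: eqP.
    by case: ifP => // /h; rewrite eqxx.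
  by move=> [ht hu] i ilt; have := hu _ ilt; case: eqP => // ij; rewrite -ij ilt in ht *.
have mB2 i : measurable (B2 i) by rewrite /B2; case: ifP.
rewrite [LHS]product_measure1E//; last 2 first.
- by rewrite /B1; case: ifP.
- exact: measurable_box.
rewrite [X in (_ * X)%E]hQ// /B1; case: ifP => jn.
  rewrite (bigD1 (Ordinal jn))//= [RHS](bigD1 (Ordinal jn))//= /B2 eqxx.
  rewrite probability_setT mul1e; congr (_ * _)%E; apply: eq_bigr => i /negbTE ij.
  by rewrite (_ : (i == j :> nat) = false)// -ij.
rewrite measure_probability_setT mul1e; apply: eq_bigr => i _; rewrite /B2.
by case: eqP => // ij; move: (ltn_ord i); rewrite ij jn.
Qed.

Definition mix n (x y : seqsp E) : seqsp E :=
  fun i => if (i < n)%N then x i else y i.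

Lemma measurable_mix n :
  measurable_fun setT (fun z : seqsp E * seqsp E => mix n z.1 z.2).
Proof.
apply: measurable_fun_seqP => i; rewrite /mix; case: ltnP => _.
  exact: (measurableT_comp (@measurable_coord _ E i) measurable_fst).
exact: (measurableT_comp (@measurable_coord _ E i) measurable_snd).
Qed.

Lemma iid_mix n A : measurable A ->
  (Q A = (Q \x Q) [set z | A (mix n z.1 z.2)])%E.
Proof.
apply: (@iid_law _ _ (Q \x Q)%E); first exact: measurable_mix.
move=> m B mB.
pose B1 i := if (i < n)%N then B i else setT.
pose B2 i := if (i < n)%N then setT else B i.
have -> : (fun z => mix n z.1 z.2) @^-1` (box m B) = box m B1 `*` box m B2.
  apply/seteqP; split => -[x y]; rewrite /box/B1/B2/mix/=.
    by move=> h; split => i /h; case: ifP.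
  by move=> [hx hy] i ilt; have := hx _ ilt; have := hy _ ilt; case: ifP.
have mB1 i : measurable (B1 i) by rewrite /B1; case: ifP.
have mB2 i : measurable (B2 i) by rewrite /B2; case: ifP.
rewrite [LHS]product_measure1E//; [|exact: measurable_box..].
transitivity ((\prod_(i < m) la (B1 i)) * (\prod_(i < m) la (B2 i)))%E.
  by congr (_ * _)%E; exact: hQ.
rewrite -big_split/=; apply: eq_bigr => i _; rewrite /B1/B2.
by case: ifP; rewrite probability_setT ?mul1e ?mule1.
Qed.

Definition reidx (p : nat -> nat) (u : seqsp E) : seqsp E := fun i => u (p i).

Lemma measurable_reidx p : measurable_fun setT (reidx p).
Proof. by apply: measurable_fun_seqP => i; exact: measurable_coord. Qed.

Lemma iid_reidx M p A : involutive p -> (forall i, (M <= i)%N -> p i = i) ->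
  measurable A -> Q A = Q [set u | A (reidx p u)].
Proof.
move=> pK pM; apply: (@iid_law _ _ Q); first exact: measurable_reidx.
move=> n B mB.
(* [p] permutes the indices below [N], so the product over [i < N] can be reindexed; its factors
   with [n <= i] are 1. *)
pose N := maxn n M.
pose C i := if (i < n)%N then B i else setT.
have mC i : measurable (C i) by rewrite /C; case: ifP.
have pN i : (i < N)%N -> (p i < N)%N.
  rewrite !ltnNge; apply: contra => Np.
  by rewrite -(pK i) (pM (p i))// (leq_trans _ Np)// leq_maxr.
have -> : reidx p @^-1` (box n B) = box N (C \o p).
  apply/seteqP; split => u; rewrite /box/reidx/C/=.
    by move=> h i iN; case: ifP => // /h; rewrite pK.
  move=> h i ilt; have := h (p i); rewrite pK ilt; apply; apply: pN.
  by rewrite (leq_trans ilt)// leq_maxl.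
rewrite hQ; last by move=> i; exact: mC.
rewrite -(big_mkord xpredT (fun i => la ((C \o p) i)))%E.
rewrite -(big_map p xpredT (fun i => la (C i)))%E.
rewrite (perm_big (index_iota 0 N)); last first.
  apply: uniq_perm; rewrite ?iota_uniq ?map_inj_uniq ?iota_uniq//.
    exact: inv_inj.
  move=> i; rewrite mem_index_iota/=; apply/mapP/idP.
    by move=> [k]; rewrite mem_index_iota/= => /pN ? ->.
  by move=> /pN iN; exists (p i); rewrite ?mem_index_iota ?pK.
rewrite (big_cat_nat _ (n := n))//=; last by rewrite leq_maxl.
rewrite [X in (_ * X)%E]big1_seq ?mule1; last first.
  move=> i /andP[_]; rewrite mem_index_iota => /andP[ni _].
  by rewrite /C ltnNge ni/= probability_setT.
rewrite big_mkord; apply: eq_bigr => i _.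
by rewrite /C ltn_ord.
Qed.

(** The exchange of the blocks [[0, n)] and [[n, 2n)]. It carries an event about the first [n]
    coordinates to one that is independent of them, and as an involution it is its own inverse in
    the transport below. *)
Definition blockswap n i := if (i < n)%N then (n + i)%N else
  if (i < n + n)%N then (i - n)%N else i.

Lemma blockswapK n : involutive (blockswap n).
Proof.
move=> i; rewrite /blockswap.
have [i1|i1] := ltnP i n.
  by rewrite ltnNge leq_addr/= ltn_add2l i1 addKn.
have [i2|i2] := ltnP i (n + n).
  by rewrite -(ltn_add2r n) subnK// i2 subnKC.
by rewrite ltnNge i1/= ltnNge i2.
Qed.

Lemma blockswap_id n i : (n + n <= i)%N -> blockswap n i = i.
Proof.
move=> h; rewrite /blockswap !ltnNge h (leq_trans (leq_addr n n))//.
Qed.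

Let fin (A : set (seqsp E)) : measurable A -> Q A \is a fin_num.
Proof. by move=> mA; exact: fin_num_measure. Qed.

Lemma iid_blockswap_cylinder n D D' : cylinder n D -> cylinder n D' ->
  (Q ([set u | D (reidx (blockswap n) u)] `&` D') = Q D * Q D')%E.
Proof.
move=> [mD cD] [mD' cD'].
have mDs : measurable [set u | D (reidx (blockswap n) u)].
  by apply: measurable_preimageT => //; exact: measurable_reidx.
rewrite (@iid_mix n); last exact: measurableI.
rewrite (_ : [set _ | _] = D' `*` [set u | D (reidx (blockswap n) u)]).
  rewrite [LHS]product_measure1E// muleC; congr (_ * _)%E.
  apply: esym; apply: (@iid_reidx (n + n)) => //; first exact: blockswapK.
  exact: blockswap_id.
have h1 x y : D (reidx (blockswap n) (mix n x y)) <-> D (reidx (blockswap n) y).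
  split; apply: cD => i ilt; rewrite /reidx/mix/blockswap ilt;
    by rewrite [in RHS]ltnNge leq_addr || rewrite ltnNge leq_addr.
have h2 x y : D' (mix n x y) <-> D' x.
  by split; apply: cD' => i ilt; rewrite /mix ilt.
by apply/seteqP; split => -[x y] /=; rewrite h1 h2 => -[].
Qed.

(** The Hewitt-Savage law in the form used here: two events of positive probability meet after some
    block swap. Both are approximated by cylinders over the same first [n] coordinates, and the swap
    makes these cylinders independent. *)
Lemma iid_blockswap_pos A B : measurable A -> measurable B ->
  (0 < Q A)%E -> (0 < Q B)%E ->
  exists n, (0 < Q ([set u | A (reidx (blockswap n) u)] `&` B))%E.
Proof.
move=> mA mB A0 B0.
have fe C : measurable C -> Q C = (fine (Q C))%:E.
  by move=> mC; rewrite fineK// fin.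
set a := fine (Q A); set b := fine (Q B).
have a0 : 0 < a by rewrite -lte_fin -fe.
have b0 : 0 < b by rewrite -lte_fin -fe.
have le1 C : measurable C -> fine (Q C) <= 1.
  by move=> mC; rewrite -lee_fin -fe// probability_le1.
have a1 : a <= 1 by exact: le1.
have b1 : b <= 1 by exact: le1.
pose e := a * b / 5.
have e0 : 0 < e by rewrite divr_gt0// mulr_gt0.
have Qoo : (Q setT < +oo)%E by rewrite probability_setT ltry.
have [n1 [D1 [cD1 hD1]]] := cylinder_approx Qoo mA e0.
have [n2 [D2 [cD2 hD2]]] := cylinder_approx Qoo mB e0.
pose n := maxn n1 n2.
have cD1n : cylinder n D1 by apply: cylinderW cD1; rewrite leq_maxl.
have cD2n : cylinder n D2 by apply: cylinderW cD2; rewrite leq_maxr.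
exists n.
have mD1 := cD1.1; have mD2 := cD2.1.
have msw C : measurable C -> measurable [set u : seqsp E | C (reidx (blockswap n) u)].
  by move=> mC; apply: measurable_preimageT => //; exact: measurable_reidx.
have Qsw C : measurable C -> Q [set u | C (reidx (blockswap n) u)] = Q C.
  move=> mC; apply: esym; apply: (@iid_reidx (n + n)) => //; first exact: blockswapK.
  exact: blockswap_id.
have sub C D : measurable C -> measurable D -> 
    fine (Q C) <= fine (Q D) + fine (Q ((C `\` D) `|` (D `\` C))).
  move=> mC mD; rewrite -lee_fin EFinD -!fe//; last first.
    by apply: measurableU; exact: measurableD.
  apply: (@le_trans _ _ (Q (D `|` ((C `\` D) `|` (D `\` C))))%E).
    apply: le_measure; rewrite ?inE//.
      by apply: measurableU => //; apply: measurableU; exact: measurableD.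
    by move=> u; rewrite /setD/setU/=; case: (pselect (D u)); tauto.
  by apply: measureU2 => //; apply: measurableU; exact: measurableD.
have mAD : measurable ((A `\` D1) `|` (D1 `\` A)).
  by apply: measurableU; exact: measurableD.
have mBD : measurable ((B `\` D2) `|` (D2 `\` B)).
  by apply: measurableU; exact: measurableD.
have {}hD1 : fine (Q ((A `\` D1) `|` (D1 `\` A))) < e by rewrite -lte_fin -fe.
have {}hD2 : fine (Q ((B `\` D2) `|` (D2 `\` B))) < e by rewrite -lte_fin -fe.
have aD := sub A D1 mA mD1.
have bD := sub B D2 mB mD2.
have mI : measurable ([set u | A (reidx (blockswap n) u)] `&` B).
  by apply: measurableI => //; exact: msw.
have mDD : measurable ([set u | D1 (reidx (blockswap n) u)] `&` D2).
  by apply: measurableI => //; exact: msw.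
have cover : fine (Q ([set u | D1 (reidx (blockswap n) u)] `&` D2)) <=
   fine (Q ([set u | A (reidx (blockswap n) u)] `&` B)) +
   (fine (Q ((A `\` D1) `|` (D1 `\` A))) + fine (Q ((B `\` D2) `|` (D2 `\` B)))).
  rewrite -lee_fin !EFinD -!fe//.
  rewrite -(Qsw _ mAD).
  apply: (@le_trans _ _ (Q (([set u | A (reidx (blockswap n) u)] `&` B) `|`
    ([set u | ((A `\` D1) `|` (D1 `\` A)) (reidx (blockswap n) u)] `|`
     ((B `\` D2) `|` (D2 `\` B)))))%E).
    apply: le_measure; rewrite ?inE//.
      by apply: measurableU => //; apply: measurableU => //; exact: msw.
    move=> u; rewrite /setD/setU/setI/=.
    case: (pselect (A (reidx (blockswap n) u))); case: (pselect (B u)); tauto.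
  apply: (le_trans (measureU2 _ _ _)) => //.
    by apply: measurableU => //; exact: msw.
  by rewrite leeD2l// measureU2//; exact: msw.
have prod : fine (Q ([set u | D1 (reidx (blockswap n) u)] `&` D2)) =
    fine (Q D1) * fine (Q D2).
  by rewrite iid_blockswap_cylinder// fineM// fin.
rewrite fe// lte_fin.
have D11 := le1 _ mD1; have D21 := le1 _ mD2.
have e1 : e * 5 = a * b by rewrite /e divfK.
have h1 : a - e <= fine (Q D1) by rewrite -/a in aD; lra.
have h2 : b - e <= fine (Q D2) by rewrite -/b in bD; lra.
have D20 : 0 <= fine (Q D2) by rewrite fine_ge0.
have key : (a - e) * (b - e) <= fine (Q D1) * fine (Q D2).
  have ab : a * b <= a by rewrite ler_piMr// ltW.
  have ba : a * b <= b by rewrite ler_piMl// ltW.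
  by apply: ler_pM => //; lra.
rewrite prod in cover.
have ea : a * e <= e by rewrite ler_piMl// ltW.
have eb : e * b <= e by rewrite ler_piMr// ltW.
have ee : 0 <= e * e by rewrite mulr_ge0// ltW.
rewrite mulrBl !mulrBr in key.
lra.
Qed.

End iid.

(** * Real-valued densities *)

Section density.
Context d (T : measurableType d) (R : realType).

Lemma density_exists (nu mu : probability T R) :
  (forall N, measurable N -> mu N = 0%E -> nu N = 0%E) ->
  exists h : T -> R, [/\ measurable_fun setT h, (forall x, 0 <= h x) &
    forall f : T -> \bar R, measurable_fun setT f -> (forall x, (0 <= f x)%E) ->
      (\int[nu]_x f x = \int[mu]_x (f x * (h x)%:E))%E].
Proof.
move=> numu.
have dom : nu `<< mu by apply/null_content_dominatesP => A mA; exact: numu.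
pose h := Radon_Nikodym_SigmaFinite.f nu mu.
have hfin x : h x \is a fin_num by exact: Radon_Nikodym_SigmaFinite.f_fin_num.
have mh : measurable_fun setT h.
  exact: measurable_int (Radon_Nikodym_SigmaFinite.f_integrable dom).
exists (fine \o h); split.
- exact: measurableT_comp.
- by move=> x /=; rewrite fine_ge0//; exact: Radon_Nikodym_SigmaFinite.f_ge0.
- move=> f mf f0.
  rewrite -(Radon_Nikodym_SigmaFinite.change_of_variables dom)//.
  by apply: eq_integral => x _ /=; rewrite fineK.
Qed.

End density.

(** * Transport of a density to the constant 1 by block swaps *)

Section transport.
Context d (E : measurableType d) (R : realType) (la : probability E R)
  (Q : probability (seqsp E) R).
Hypothesis hQ : forall n A, (forall i, measurable (A i)) ->
  Q (box n A) = (\prod_(i < n) la (A i))%E.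
Variable phi : seqsp E -> R.
Hypotheses (mphi : measurable_fun setT phi) (phi0 : forall x, 0 <= phi x)
  (phi1 : (\int[Q]_x (phi x)%:E = 1)%E).

Let G n : seqsp E -> seqsp E := reidx (blockswap n).

Let GK n : involutive (G n).
Proof. by move=> u; apply/funext => i; rewrite /G /reidx blockswapK. Qed.

Let mG n : measurable_fun setT (G n). Proof. exact: measurable_reidx. Qed.

Let intG n (f : seqsp E -> \bar R) : measurable_fun setT f ->
  (forall x, (0 <= f x)%E) -> (\int[Q]_x f (G n x) = \int[Q]_x f x)%E.
Proof.
move=> mf f0; apply: esym; apply: ge0_integral_law => // A mA.
apply: (iid_reidx hQ (M := n + n)) => //; first exact: blockswapK.
exact: blockswap_id.
Qed.

(* Greedy matching of the densities [phi] and [1] along the involutions [G n]: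
   what is left of both after step [n] is mutually singular under [G n]. *)
Fixpoint residual n : (seqsp E -> R) * (seqsp E -> R) :=
  if n is k.+1 then
    let: (p, q) := residual k in
    (fun x => p x - Num.min (p x) (q (G k x)),
     fun x => q x - Num.min (p (G k x)) (q x))
  else (phi, cst 1).

Let p n := (residual n).1.
Let q n := (residual n).2.
(** The mass that step [n] moves from [x] to [G n x]: as much as is left of [phi] at [x] and can
    still be received at [G n x]. *)
Let a n x := Num.min (p n x) (q n (G n x)).

Let pS n x : p n.+1 x = p n x - a n x.
Proof. by rewrite /p /a /p /q /=; case: residual. Qed.

Let qS n x : q n.+1 x = q n x - a n (G n x).
Proof. by rewrite /q /a /p /q /=; case: residual => ? ? /=; rewrite GK. Qed.

Let p0 n x : 0 <= p n x.
Proof.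
by case: n => [|n]; [exact: phi0|rewrite pS subr_ge0 ge_min lexx].
Qed.

Let q0 n x : 0 <= q n x.
Proof.
by case: n => [|n]; [exact: ler01|rewrite qS subr_ge0 ge_min GK lexx orbT].
Qed.

Let a0 n x : 0 <= a n x. Proof. by rewrite le_min p0 q0. Qed.

Let mpq n : measurable_fun setT (p n) /\ measurable_fun setT (q n).
Proof.
elim: n => [|n [mp mq]]; first by split => //; exact: measurable_cst.
have ma : measurable_fun setT (a n).
  by apply: measurable_minr => //; exact: measurableT_comp.
split.
  rewrite (_ : p n.+1 = fun x => p n x - a n x); last exact/funext/pS.
  exact: measurable_funB.
rewrite (_ : q n.+1 = fun x => q n x - a n (G n x)); last exact/funext/qS.
by apply: measurable_funB => //; exact: measurableT_comp.
Qed.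

Let ma n : measurable_fun setT (a n).
Proof.
by have [mp mq] := mpq n; apply: measurable_minr => //; exact: measurableT_comp.
Qed.

Let homo_p x : {homo (p ^~ x) : n m / (n <= m)%N >-> m <= n}.
Proof.
apply: homo_leq => [//|m n k nm kn|n]; first exact: le_trans kn nm.
by rewrite pS lerBlDr lerDl a0.
Qed.

Let homo_q x : {homo (q ^~ x) : n m / (n <= m)%N >-> m <= n}.
Proof.
apply: homo_leq => [//|m n k nm kn|n]; first exact: le_trans kn nm.
by rewrite qS lerBlDr lerDl a0.
Qed.

Let pl x := limn (p ^~ x).
Let ql x := limn (q ^~ x).

Let cvgp x : p n x @[n --> \oo] --> pl x.
Proof.
apply: nonincreasing_is_cvgn; first exact: homo_p.
by exists 0 => _ [n _ <-]; exact: p0.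
Qed.

Let cvgq x : q n x @[n --> \oo] --> ql x.
Proof.
apply: nonincreasing_is_cvgn; first exact: homo_q.
by exists 0 => _ [n _ <-]; exact: q0.
Qed.

Let pl_le n x : pl x <= p n x.
Proof.
apply: nonincreasing_cvgn_ge; first exact: homo_p.
exact: cvgp.
Qed.

Let ql_le n x : ql x <= q n x.
Proof.
apply: nonincreasing_cvgn_ge; first exact: homo_q.
exact: cvgq.
Qed.

Let pl0 x : 0 <= pl x.
Proof. by apply: limr_ge; [exact: cvgp|apply: nearW => n; exact: p0]. Qed.

Let ql0 x : 0 <= ql x.
Proof. by apply: limr_ge; [exact: cvgq|apply: nearW => n; exact: q0]. Qed.

Let mpl : measurable_fun setT pl.
Proof.
apply: (@measurable_fun_cvg _ _ _ _ p) => [n|x _]; last exact: cvgp.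
exact: (mpq n).1.
Qed.

Let mql : measurable_fun setT ql.
Proof.
apply: (@measurable_fun_cvg _ _ _ _ q) => [n|x _]; last exact: cvgq.
exact: (mpq n).2.
Qed.

(** Step [n] takes [a n] from one density and [a n] composed with [G n] from the other; these have
    the same integral because [G n] preserves [Q]. All integrals are at most 1, so the subtraction
    is legitimate. *)
Let int_pq n : (\int[Q]_x (p n x)%:E = \int[Q]_x (q n x)%:E)%E.
Proof.
have le1 k : (\int[Q]_x (p k x)%:E <= 1)%E.
  rewrite -phi1; apply: ge0_le_integral => //.
  - by move=> x _; rewrite lee_fin.
  - by apply/measurable_EFinP; exact: (mpq k).1.
  - exact/measurable_EFinP.
  - by move=> x _; rewrite lee_fin; exact: (homo_p x (leq0n k)).
elim: n => [|n ih].
  by rewrite phi1 /q/= integral_cst// mul1e measure_probability_setT.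
have mp := (mpq n.+1).1; have mq := (mpq n.+1).2.
have ep : (\int[Q]_x (p n x)%:E =
    \int[Q]_x (p n.+1 x)%:E + \int[Q]_x (a n x)%:E)%E.
  rewrite -ge0_integralD//.
  - by apply: eq_integral => x _; rewrite pS -EFinD subrK.
  - by move=> x _; rewrite lee_fin.
  - exact/measurable_EFinP.
  - by move=> x _; rewrite lee_fin.
  - exact/measurable_EFinP.
have eq : (\int[Q]_x (q n x)%:E =
    \int[Q]_x (q n.+1 x)%:E + \int[Q]_x (a n x)%:E)%E.
  rewrite -(@intG n (fun x => (a n x)%:E)); last 2 first.
  - exact/measurable_EFinP.
  - by move=> x; rewrite lee_fin.
  rewrite -ge0_integralD//.
  - by apply: eq_integral => x _; rewrite qS -EFinD subrK.
  - by move=> x _; rewrite lee_fin.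
  - exact/measurable_EFinP.
  - by move=> x _; rewrite lee_fin.
  - by apply/measurable_EFinP; exact: measurableT_comp.
move: ih; rewrite ep eq.
have aoo : (\int[Q]_x (a n x)%:E)%E \is a fin_num.
  rewrite ge0_fin_numE; last by apply: integral_ge0 => x _; rewrite lee_fin.
  apply: (@le_lt_trans _ _ 1%E); last exact: ltry.
  apply: le_trans (le1 n); apply: ge0_le_integral => //.
  - by move=> x _; rewrite lee_fin.
  - exact/measurable_EFinP.
  - by apply/measurable_EFinP; exact: (mpq n).1.
  - by move=> x _; rewrite lee_fin ge_min lexx.
by move/(congr1 (fun y => y - \int[Q]_x (a n x)%:E)%E); rewrite !addeK.
Qed.

Let int_lim (f : nat -> seqsp E -> R) (l g : seqsp E -> R) :
  (forall n, measurable_fun setT (f n)) -> measurable_fun setT g ->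
  (forall x, f n x @[n --> \oo] --> l x) -> (forall n x, 0 <= f n x <= g x) ->
  (\int[Q]_x (g x)%:E < +oo)%E ->
  ((\int[Q]_x (f n x)%:E)%E @[n --> \oo] --> (\int[Q]_x (l x)%:E)%E).
Proof.
move=> mf mg fl fg goo.
have ml : measurable_fun setT l by apply: (measurable_fun_cvg mf) => x _; exact: fl.
have g0 x : 0 <= g x by have /andP[h1 h2] := fg 0%N x; exact: le_trans h2.
have ig : Q.-integrable setT (EFin \o g).
  apply/integrableP; split; first exact/measurable_EFinP.
  under eq_integral do rewrite /= ger0_norm//.
  exact: goo.
have := @dominated_convergence _ _ R Q setT measurableT
  (fun n x => (f n x)%:E) (EFin \o l) (EFin \o g).
case => //.
- by move=> n; exact/measurable_EFinP.
- exact/measurable_EFinP.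
- by apply: aeW => x _; apply: cvg_EFin; [exact: nearW|exact: fl].
- apply: aeW => x n _ /=; rewrite lee_fin ger0_norm//; by case/andP: (fg n x).
Qed.

Let int_plql : (\int[Q]_x (pl x)%:E = \int[Q]_x (ql x)%:E)%E.
Proof.
have h1 : ((\int[Q]_x (p n x)%:E)%E @[n --> \oo] --> (\int[Q]_x (pl x)%:E)%E).
  apply: (@int_lim p pl phi) => //.
  - by move=> n; exact: (mpq n).1.
  - by move=> n x; rewrite p0; exact: (homo_p x (leq0n n)).
  - by rewrite phi1 ltry.
have h2 : ((\int[Q]_x (q n x)%:E)%E @[n --> \oo] --> (\int[Q]_x (ql x)%:E)%E).
  apply: (@int_lim q ql (cst 1)) => //.
  - by move=> n; exact: (mpq n).2.
  - by move=> n x; rewrite q0; exact: (homo_q x (leq0n n)).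
  - by rewrite [X in (X < _)%E](integral_cst Q measurableT 1%E) mul1e measure_probability_setT ltry.
rewrite -(cvg_lim _ h1)// -(cvg_lim _ h2)//; congr (limn _).
by apply/funext => n; exact: int_pq.
Qed.

(** The minimum removed at step [n] is one of the two values, so [p n.+1 x] or [q n.+1 (G n x)] is
    0, and the limits are no larger. *)
Let singular n x : 0 < pl x -> 0 < ql (G n x) -> False.
Proof.
move=> hp hq.
have hp' : 0 < p n.+1 x by exact: lt_le_trans (pl_le _ _).
have hq' : 0 < q n.+1 (G n x) by exact: lt_le_trans (ql_le _ _).
move: hp' hq'; rewrite pS qS GK /a minEle; case: ifP => _; first by rewrite subrr ltxx.
by rewrite subrr ltxx.
Qed.

Let int0 (f : seqsp E -> R) : measurable_fun setT f -> (forall x, 0 <= f x) ->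
  (\int[Q]_x (f x)%:E = 0)%E <-> Q [set x | 0 < f x] = 0%E.
Proof.
move=> mf f0.
have mpos : measurable [set x | 0 < f x].
  by apply: measurable_set_lt => //; exact: measurable_cst.
have absE : (\int[Q]_x (f x)%:E = \int[Q]_x `|(f x)%:E|)%E.
  by apply: eq_integral => x _ /=; rewrite ger0_norm.
have mEf : measurable_fun setT (EFin \o f) by exact/measurable_EFinP.
have H := ae_eq_integral_abs Q measurableT mEf.
rewrite absE; split.
  move=> /H [N [mN N0 hN]].
  apply: (subset_measure0 mpos mN _ N0) => x /= fx; apply: hN => /=.
  by move=> /(_ I) [h]; rewrite h ltxx in fx.
move=> h; apply/H.
exists [set x | 0 < f x]; split => // x /= fx; rewrite lt_neqAle f0 andbT.
by apply/negP => /eqP fx0; apply: fx => _; rewrite -fx0.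
Qed.

(** If both limits were positive on sets of positive measure, some block swap would make these sets
    meet, against [singular]. So one limit vanishes almost everywhere, and the other does too
    because their integrals agree. *)
Let pl_ql0 : Q [set x | 0 < pl x] = 0%E /\ Q [set x | 0 < ql x] = 0%E.
Proof.
have mA : measurable [set x | 0 < pl x].
  by apply: measurable_set_lt => //; exact: measurable_cst.
have mB : measurable [set x | 0 < ql x].
  by apply: measurable_set_lt => //; exact: measurable_cst.
have pq : Q [set x | 0 < pl x] = 0%E <-> Q [set x | 0 < ql x] = 0%E.
  by rewrite -(int0 mpl pl0) -(int0 mql ql0) int_plql.
have [A0|A0] := eqVneq (Q [set x | 0 < pl x]) 0%E; first by split=> //; exact/pq.
have [B0|B0] := eqVneq (Q [set x | 0 < ql x]) 0%E; first by split=> //; exact/pq.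
have [n] := iid_blockswap_pos hQ mB mA ltac:(by rewrite lt0e B0 measure_ge0)
  ltac:(by rewrite lt0e A0 measure_ge0).
rewrite (_ : _ `&` _ = set0) ?measure0 ?ltxx//.
by apply/seteqP; split => // x /= [hq hp]; exact: (singular hp hq).
Qed.

(** The first series collects the mass that leaves [x], in total [phi x]; the second collects the
    mass that arrives at [x], in total 1. The partial sums telescope to [phi - p n] and
    [1 - q n]. *)
Lemma iid_transport : exists a : nat -> seqsp E -> R,
  [/\ forall n, measurable_fun setT (a n), forall n x, 0 <= a n x,
      {ae Q, forall x, (\sum_(0 <= n <oo) (a n x)%:E = (phi x)%:E)%E} &
      {ae Q, forall x,
        (\sum_(0 <= n <oo) (a n (reidx (blockswap n) x))%:E = 1)%E}].
Proof.
have [P0 Q0] := pl_ql0.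
exists a; split => //.
- exists [set x | 0 < pl x]; split => //.
    by apply: measurable_set_lt => //; exact: measurable_cst.
  move=> x /= hx; rewrite lt_neqAle pl0 andbT; apply/negP => /eqP plx; apply: hx.
  apply/cvg_lim => //.
  rewrite (_ : (fun n => _) = (fun n => (phi x - p n x)%:E)).
    apply: cvg_EFin; first exact: nearW.
    rewrite -[X in _ --> X]subr0 plx; apply: cvgB; [exact: cvg_cst|exact: cvgp].
  apply/funext; elim=> [|n ih]; first by rewrite big_nil subrr.
  by rewrite big_nat_recr//= ih -EFinD pS; congr EFin; lra.
- exists [set x | 0 < ql x]; split => //.
    by apply: measurable_set_lt => //; exact: measurable_cst.
  move=> x /= hx; rewrite lt_neqAle ql0 andbT; apply/negP => /eqP plx; apply: hx.
  apply/cvg_lim => //.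
  rewrite (_ : (fun n => _) = (fun n => (1 - q n x)%:E)).
    apply: cvg_EFin; first exact: nearW.
    rewrite -[X in _ --> X]subr0 plx; apply: cvgB; [exact: cvg_cst|exact: cvgq].
  apply/funext; elim=> [|n ih]; first by rewrite big_nil subrr.
  by rewrite big_nat_recr//= ih -EFinD qS; congr EFin; rewrite /G; lra.
Qed.

End transport.

(** * A quantitative law of large numbers *)

Section law_of_large_numbers.
Context d (E : measurableType d) (R : realType) (la : probability E R)
  (Q : probability (seqsp E) R).
Hypothesis hQ : forall n A, (forall i, measurable (A i)) ->
  Q (box n A) = (\prod_(i < n) la (A i))%E.

Lemma integral_setc j (f : seqsp E -> \bar R) : measurable_fun setT f ->
  (forall u, (0 <= f u)%E) ->
  (\int[Q]_u f u = \int[(la \x Q)%E]_z f (setc j z.1 z.2))%E.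
Proof.
move=> mf f0; apply: ge0_integral_law => //; first exact: measurable_setc.
by move=> A mA; exact: (iid_setc hQ).
Qed.

Lemma integral_coord j (f : E -> \bar R) : measurable_fun setT f ->
  (forall u, (0 <= f u)%E) -> (\int[Q]_u f (u j) = \int[la]_t f t)%E.
Proof.
move=> mf f0; rewrite (@integral_setc j (fun u => f (u j)))//; last first.
  by apply: measurableT_comp => //; exact: measurable_coord.
rewrite (fubini_tonelli1 (fun z : E * seqsp E => f (setc j z.1 z.2 j)))//.
  apply: eq_integral => t _; rewrite /fubini_F/= /setc eqxx.
  by rewrite integral_cst// measure_probability_setT mule1.
apply: (measurableT_comp mf); exact: (measurableT_comp (@measurable_coord _ E j) (@measurable_setc _ E j)).
Qed.

Section bounded.
Variables (f : E -> R) (K c : R).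
Hypotheses (mf : measurable_fun setT f) (f0 : forall t, 0 <= f t)
  (fK : forall t, f t <= K) (fc : (\int[la]_t (f t)%:E = c%:E)%E).

Let intf : la.-integrable setT (EFin \o f).
Proof.
apply/integrableP; split; first exact/measurable_EFinP.
under eq_integral do rewrite /= ger0_norm//.
by rewrite fc ltry.
Qed.

Let K0 : 0 <= K. Proof. exact: le_trans (f0 point) (fK point). Qed.

(** Expanding around [s - c] and bounding [f ^+ 2] by [K ^+ 2] leaves a function affine in [f], so
    that only the integral [c] of [f] enters; the result is [s ^+ 2 - c ^+ 2 + K ^+ 2]. *)
Let square_step s : (\int[la]_t ((s + (f t - c)) ^+ 2)%:E <= (s ^+ 2 + K ^+ 2)%:E)%E.
Proof.
pose a := (s - c) ^+ 2 + K ^+ 2; pose b := 2 * (s - c).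
have fb t : (s + (f t - c)) ^+ 2 <= a + b * f t.
  have h : f t ^+ 2 <= K ^+ 2 by rewrite lerXn2r// nnegrE.
  have -> : s + (f t - c) = (s - c) + f t by lra.
  by rewrite sqrrD /a /b; lra.
apply: (@le_trans _ _ (\int[la]_t (a%:E + b%:E * (f t)%:E))%E).
  apply: ge0_le_integral => //.
  - by move=> t _; rewrite lee_fin sqr_ge0.
  - apply/measurable_EFinP; apply: measurable_funX.
    by apply: measurable_funD => //; exact: measurable_funB.
  - apply/measurable_EFinP; apply: measurable_funD => //.
    exact: measurable_funM.
  - by move=> t _; rewrite -EFinM -EFinD lee_fin.
rewrite integralD//; last 2 first.
- exact: finite_measure_integrable_cst.
- exact: integrableZl.
rewrite integral_cst// measure_probability_setT mule1 integralZl// fc -EFinM -EFinD.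
rewrite lee_fin /a /b.
by have := sqr_ge0 c; rewrite !expr2; lra.
Qed.

Let S m n (u : seqsp E) := \sum_(j < n) (f (u (m + j)%N) - c).

Let mS m n : measurable_fun setT (S m n).
Proof.
rewrite /S; apply: measurable_sum => j.
apply: measurable_funB => //.
exact: (measurableT_comp mf (@measurable_coord _ E _)).
Qed.

(** Each new term adds at most [K ^+ 2] to the second moment: its coordinate is integrated first,
    all others being frozen. *)
Lemma iid_sum_square m n :
  (\int[Q]_u ((S m n u) ^+ 2)%:E <= (n%:R * K ^+ 2)%:E)%E.
Proof.
elim: n => [|n ih].
  rewrite (eq_integral (fun=> 0%E)) ?integral0 ?mul0r//.
  by move=> u _; rewrite /S big_ord0 expr0n.
have mSS : measurable_fun setT (fun u => (S m n.+1 u ^+ 2)%:E).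
  by apply/measurable_EFinP; exact: measurable_funX.
rewrite (@integral_setc (m + n))//; last by move=> u; rewrite lee_fin sqr_ge0.
rewrite (fubini_tonelli2 (fun z : E * seqsp E =>
  (S m n.+1 (setc (m + n)%N z.1 z.2) ^+ 2)%:E))//; last 2 first.
- exact: (measurableT_comp mSS (@measurable_setc _ E _)).
- by move=> u; rewrite lee_fin sqr_ge0.
have SE t u : S m n.+1 (setc (m + n)%N t u) = S m n u + (f t - c).
  rewrite /S big_ord_recr/= /setc eqxx; congr (_ + _).
  by apply: eq_bigr => j _; rewrite eqn_add2l ltn_eqF.
apply: (@le_trans _ _ (\int[Q]_u ((S m n u ^+ 2)%:E + (K ^+ 2)%:E))%E).
  apply: ge0_le_integral => //.
  - by move=> u _; apply: integral_ge0 => t _; rewrite lee_fin sqr_ge0.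
  - apply: (measurable_fun_fubini_tonelli_G (fun z : E * seqsp E =>
      (S m n.+1 (setc (m + n)%N z.1 z.2) ^+ 2)%:E)).
    + exact: (measurableT_comp mSS (@measurable_setc _ E _)).
    + by move=> u; rewrite lee_fin sqr_ge0.
  - by apply: emeasurable_funD => //; apply/measurable_EFinP; exact: measurable_funX.
  - move=> u _; rewrite /fubini_G/= -EFinD.
    by under eq_integral do rewrite SE; exact: square_step.
rewrite ge0_integralD//.
- rewrite integral_cst// measure_probability_setT mule1.
  by rewrite -natr1 mulrDl mul1r EFinD leeD2r.
- by move=> u _; rewrite lee_fin sqr_ge0.
- by apply/measurable_EFinP; exact: measurable_funX.
- by move=> u _; rewrite lee_fin sqr_ge0.
Qed.

(** The error is uniform in [A]: it comes from the pointwise bound of [S] by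
    [n * eta + S^2 / (4 * n * eta)] and from the second moment of [S]. *)
Lemma iid_sum_le m n (A : set (seqsp E)) (eta : R) : measurable A -> 0 < eta ->
  (0 < n)%N ->
  (\sum_(j < n) \int[Q]_u (f (u (m + j)%N) * \1_A u)%:E <=
   (n%:R * c)%:E * Q A + (n%:R * eta + K ^+ 2 / (4 * eta))%:E)%E.
Proof.
move=> mA eta0 n0.
have c0 : 0 <= c by rewrite -lee_fin -fc; apply: integral_ge0 => t _; rewrite lee_fin.
have nR : 0 < n%:R :> R by rewrite ltr0n.
have eta0' := ltW eta0.
have mterm j : measurable_fun setT (fun u : seqsp E => (f (u (m + j)%N) * \1_A u)%:E).
  apply/measurable_EFinP; apply: measurable_funM => //.
  exact: (measurableT_comp mf (@measurable_coord _ E _)).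
rewrite -ge0_integral_sum//; last by move=> j u _; rewrite lee_fin mulr_ge0.
(* For this value, [b * (S - 2 * n * eta)^2 >= 0] expands to [S <= n * eta + b * S^2]. *)
pose b := (4 * n%:R * eta)^-1.
have b0 : 0 <= b by rewrite invr_ge0 !mulr_ge0// ltW.
have bE : b * (4 * n%:R * eta) = 1 by rewrite mulVf// gt_eqF// !mulr_gt0.
apply: (@le_trans _ _ (\int[Q]_u ((n%:R * c)%:E * (\1_A u)%:E +
    ((n%:R * eta)%:E + b%:E * (S m n u ^+ 2)%:E)))%E).
  apply: ge0_le_integral => //.
  - by move=> u _; apply: sume_ge0 => j _; rewrite lee_fin mulr_ge0.
  - exact: emeasurable_sum.
  - apply: emeasurable_funD.
      by apply: measurable_funeM; apply/measurable_EFinP.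
    apply: emeasurable_funD => //; apply: measurable_funeM; apply/measurable_EFinP.
    exact: measurable_funX.
  - move=> u _; rewrite sumEFin -!EFinM -!EFinD lee_fin -mulr_suml.
    have -> : \sum_(j < n) f (u (m + j)%N) = S m n u + n%:R * c.
      by rewrite /S sumrB sumr_const card_ord mulr_natl subrK.
    have sq : S m n u <= n%:R * eta + b * S m n u ^+ 2.
      have : 0 <= b * (S m n u - 2 * n%:R * eta) ^+ 2 by rewrite mulr_ge0// sqr_ge0.
      rewrite sqrrB mulrDr mulrBr.
      have -> : b * (2 * n%:R * eta) ^+ 2 = n%:R * eta.
        have -> : (2 * n%:R * eta) ^+ 2 = 4 * n%:R * eta * (n%:R * eta).
          by rewrite expr2; lra.
        by rewrite [b * (_ * _)]mulrA bE mul1r.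
      have -> : b * (S m n u * (2 * n%:R * eta) *+ 2) = S m n u.
        have -> : S m n u * (2 * n%:R * eta) *+ 2 = 4 * n%:R * eta * S m n u.
          by rewrite mulr2n; lra.
        by rewrite [b * (_ * _)]mulrA bE mul1r.
      by lra.
    rewrite indicE; case: (u \in A); rewrite ?mulr1 ?mulr0 ?add0r.
      by rewrite [leRHS]addrC lerD2r.
    by apply: addr_ge0; apply: mulr_ge0 => //; exact: sqr_ge0.
rewrite ge0_integralD//; last 4 first.
- by move=> u _; rewrite -EFinM lee_fin !mulr_ge0.
- by apply: measurable_funeM; apply/measurable_EFinP.
- by move=> u _; rewrite -EFinM -EFinD lee_fin; apply: addr_ge0; apply: mulr_ge0 => //; exact: sqr_ge0.
- apply: emeasurable_funD => //; apply: measurable_funeM; apply/measurable_EFinP.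
  exact: measurable_funX.
rewrite ge0_integralZl//; last 2 first.
- exact/measurable_EFinP.
- by rewrite lee_fin mulr_ge0.
rewrite integral_indic// setIT leeD2l//.
rewrite ge0_integralD//; last 3 first.
- by move=> u _; rewrite lee_fin mulr_ge0.
- by move=> u _; rewrite -EFinM lee_fin mulr_ge0// sqr_ge0.
- by apply: measurable_funeM; apply/measurable_EFinP; exact: measurable_funX.
rewrite integral_cst// measure_probability_setT mule1 ge0_integralZl//; last 2 first.
- by apply/measurable_EFinP; exact: measurable_funX.
- by move=> u _; rewrite lee_fin sqr_ge0.
rewrite EFinD leeD2l//.
apply: (le_trans (lee_wpmul2l _ (iid_sum_square m n))); first by rewrite lee_fin.
rewrite -EFinM lee_fin.
suff -> : b * (n%:R * K ^+ 2) = K ^+ 2 / (4 * eta) by [].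
apply: (mulIf (lt0r_neq0 (mulr_gt0 (ltr0n R 4) eta0))); rewrite divfK.
  transitivity (b * (4 * n%:R * eta) * K ^+ 2); last by rewrite bE mul1r.
  by rewrite expr2; lra.
by rewrite gt_eqF// mulr_gt0.
Qed.

End bounded.

(** * Insertion of a point that has a density given the rest *)

Section insertion.
Context dS (S : measurableType dS) (ka : probability S R)
  (mu : probability (S * E)%type R).
Hypothesis muka : forall N, measurable N -> (ka \x la)%E N = 0%E -> mu N = 0%E.

Let mtrunc (h : S * E -> R) (K : R) : measurable_fun setT h ->
  measurable_fun setT (fun z => Num.min (h z) K).
Proof. by move=> mh; apply: measurable_minr => //; exact: measurable_cst. Qed.

(** The law of large numbers above is for bounded weights; by dominated convergence the part of the
    density beyond a large constant has small integral. *)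
Let trunc_tail (h : S * E -> R) (e : R) : measurable_fun setT h ->
  (forall z, 0 <= h z) -> (\int[(ka \x la)%E]_z (h z)%:E < +oo)%E -> 0 < e ->
  exists K : nat, (\int[(ka \x la)%E]_z (h z - Num.min (h z) K%:R)%:E <= e%:E)%E.
Proof.
move=> mh h0 hoo e0.
have ih : (ka \x la)%E.-integrable setT (EFin \o h).
  apply/integrableP; split; first exact/measurable_EFinP.
  under eq_integral do rewrite /= ger0_norm//.
  exact: hoo.
have := @dominated_convergence _ _ R (ka \x la)%E setT measurableT
  (fun n z => (h z - Num.min (h z) n%:R)%:E) (cst 0%E) (EFin \o h).
case => //.
- by move=> n; apply/measurable_EFinP; apply: measurable_funB => //; exact: mtrunc.
- apply: aeW => z _; apply: cvg_near_cst; near=> n.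
  rewrite minEle ifT ?subrr//.
  near: n; exists (Num.bound (h z)) => // n /= bn.
  apply: (le_trans (ltW (archi_boundP (h0 z)))).
  by rewrite ler_nat.
- apply: aeW => z n _ /=; rewrite lee_fin ger0_norm.
    by rewrite gerBl le_min h0 ler0n.
  by rewrite subr_ge0 ge_min lexx.
move=> _ _; rewrite integral0 => /fine_cvgP[finI] /cvgrPdist_lt/(_ e e0)[N _ /(_ N (leqnn N))]/=.
rewrite sub0r normrN => hN.
have I0 : (0 <= \int[(ka \x la)%E]_z (h z - Num.min (h z) N%:R)%:E)%E.
  by apply: integral_ge0 => z _; rewrite lee_fin subr_ge0 ge_min lexx.
exists N; rewrite -[leLHS]fineK.
  by rewrite lee_fin (le_trans (ler_norm _))// ltW.
rewrite ge0_fin_numE//; apply: le_lt_trans hoo; apply: ge0_le_integral => //.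
- by move=> z _; rewrite lee_fin subr_ge0 ge_min lexx.
- by apply/measurable_EFinP; apply: measurable_funB => //; exact: mtrunc.
- exact/measurable_EFinP.
- by move=> z _; rewrite lee_fin gerBl le_min h0 ler0n.
Unshelve. all: by end_near. Qed.

(** Overwriting [u j] by a point [t] of law [la] and integrating over [t] and [u] amounts to
    integrating over [u] alone with [t = u j]. The inserted point thus turns into the weight
    [h (p, u j)] on an unchanged sequence. *)
Let swap_integral (h : S * E -> R) j (D : set (S * seqsp E)) :
  measurable_fun setT h -> (forall z, 0 <= h z) -> measurable D ->
  (\int[(ka \x la)%E]_z (Q [set u | D (z.1, setc j z.2 u)] * (h z)%:E) =
   \int[ka]_p \int[Q]_u (h (p, u j) * \1_D (p, u))%:E)%E.
Proof.
move=> mh h0 mD.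
pose F (z : S * E) := (Q [set u | D (z.1, setc j z.2 u)] * (h z)%:E)%E.
pose D' : set ((S * E) * seqsp E) := [set y | D (y.1.1, setc j y.1.2 y.2)].
have mD' : measurable D'.
  apply: measurable_preimageT => //; apply: measurable_fun_pair.
    exact: (measurableT_comp measurable_fst measurable_fst).
  pose g (y : S * E * seqsp E) := (y.1.2, y.2).
  have mg : measurable_fun setT g.
    apply: measurable_fun_pair; last exact: measurable_snd.
    exact: (measurableT_comp measurable_snd measurable_fst).
  exact: (measurableT_comp (@measurable_setc _ E j) mg).
have mQ : measurable_fun setT (fun z : S * E => Q [set u | D (z.1, setc j z.2 u)]).
  rewrite (_ : (fun z => _) = Q \o xsection D'); first exact: measurable_fun_xsection.
  apply/funext => z /=; congr (Q _); apply/seteqP.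
  by split => u; rewrite /xsection/= inE.
have mF : measurable_fun setT F.
  by apply: emeasurable_funM => //; exact/measurable_EFinP.
rewrite (fubini_tonelli1 F)//; last first.
  by move=> z; rewrite mule_ge0// lee_fin.
apply: eq_integral => p _; rewrite /fubini_F/F/=.
pose f (u : seqsp E) := (h (p, u j) * \1_D (p, u))%:E.
have mf : measurable_fun setT f.
  apply/measurable_EFinP; apply: measurable_funM.
    apply: (measurableT_comp mh); apply: measurable_fun_pair; first exact: measurable_cst.
    exact: measurable_coord.
  apply: measurableT_comp; first exact: measurable_indic.
  exact: pair1_measurable.
have f0 u : (0 <= f u)%E by rewrite lee_fin mulr_ge0.
rewrite (integral_setc j mf f0).
have mfs : measurable_fun setT (fun z : E * seqsp E => f (setc j z.1 z.2)).
  exact: (measurableT_comp mf (@measurable_setc _ E j)).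
rewrite (fubini_tonelli1 (fun z : E * seqsp E => f (setc j z.1 z.2)))//.
apply: eq_integral => t _; rewrite /fubini_F/f/=.
have mDt : measurable [set u : seqsp E | D (p, setc j t u)].
  exact: (measurable_section_l (p, t) mD').
under [RHS]eq_integral.
  move=> u _; rewrite {1}/setc eqxx EFinM.
  rewrite (_ : (\1_D (p, setc j t u))%:E = (\1_[set u : seqsp E | D (p, setc j t u)] u)%:E :> \bar R)%E.
    over.
  by congr EFin; rewrite !indicE; congr (nat_of_bool _)%:R; apply/idP/idP; rewrite !inE.
rewrite ge0_integralZl//; last 2 first.
- by apply/measurable_EFinP; exact: measurable_indic.
- by rewrite lee_fin.
by rewrite integral_indic// setIT muleC.
Qed.

(* Averaging over the position where a point with a density is inserted makes
   the insertion asymptotically invisible in the sequence. *)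
Lemma iid_insertion m (e : R) : 0 < e ->
  exists L, (0 < L)%N /\ forall D : set (S * seqsp E), measurable D ->
  (\sum_(j < L) (mu \x Q) [set z | D (z.1.1, setc (m + j)%N z.1.2 z.2)] <=
   L%:R%:E * ((mu \x Q) [set z | D (z.1.1, z.2)] + e%:E))%E.
Proof.
move=> e0.
have [h [mh h0 hE]] := density_exists muka.
have h1 : (\int[(ka \x la)%E]_z (h z)%:E = 1)%E.
  transitivity (\int[mu]_x (cst 1%E x))%E.
    by rewrite hE//; apply: eq_integral => z _; rewrite mul1e.
  by rewrite integral_cst// mul1e measure_probability_setT.
have e20 : 0 < e / 2 by rewrite divr_gt0.
have e40 : 0 < e / 4 by rewrite divr_gt0.
have [K hK] := @trunc_tail h (e / 2) mh h0 ltac:(by rewrite h1 ltry) e20.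
(* For [eta := e / 4], [iid_sum_le] leaves the error [L * (e / 4) + b], at most [L * (e / 2)] by the
   choice of [L]. The tail of the density beyond [K] takes the other [e / 2]. *)
pose b : R := K%:R ^+ 2 / (4 * (e / 4)).
have b0 : 0 <= b by rewrite divr_ge0// ?sqr_ge0// ltW// mulr_gt0.
pose L := (Num.bound (b / (e / 4))).+1.
have L0 : (0 < L)%N by [].
have bL : b <= L%:R * (e / 4).
  rewrite -ler_pdivrMr//; apply: (le_trans (ltW (archi_boundP _))).
    by rewrite divr_ge0// ltW.
  by rewrite ler_nat /L leqnSn.
exists L; split => // D mD.
have mDsec p : measurable [set u | D (p, u)] by exact: measurable_section_l.
pose hk (z : S * E) := Num.min (h z) K%:R.
have mhk : measurable_fun setT hk by exact: mtrunc.
have hk0 z : 0 <= hk z by rewrite le_min h0 ler0n.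
have hkK z : hk z <= K%:R by rewrite ge_min lexx orbT.
have hkh z : hk z <= h z by rewrite ge_min lexx.
pose r (z : S * E) := h z - hk z.
have mr : measurable_fun setT r by exact: measurable_funB.
have r0 z : 0 <= r z by rewrite subr_ge0.
have mh2 (f : S * E -> R) p : measurable_fun setT f ->
    measurable_fun setT (fun t => (f (p, t))%:E).
  by move=> mf; apply/measurable_EFinP; exact: (measurableT_comp mf (pair1_measurable _)).
pose g p := (\int[la]_t (h (p, t))%:E)%E.
pose rho p := (\int[la]_t (r (p, t))%:E)%E.
have mg : measurable_fun setT g.
  apply: (measurable_fun_fubini_tonelli_F (fun z : S * E => (h z)%:E)) => //.
  exact/measurable_EFinP.
have mrho : measurable_fun setT rho.
  apply: (measurable_fun_fubini_tonelli_F (fun z : S * E => (r z)%:E)) => //.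
  exact/measurable_EFinP.
have g0 p : (0 <= g p)%E by apply: integral_ge0 => t _; rewrite lee_fin.
have rho0 p : (0 <= rho p)%E by apply: integral_ge0 => t _; rewrite lee_fin.
have mQD : measurable_fun setT (fun p => Q [set u | D (p, u)]).
  rewrite (_ : (fun z => _) = Q \o xsection D); first exact: measurable_fun_xsection.
  apply/funext => z /=; congr (Q _); apply/seteqP.
  by split => u; rewrite /xsection/= inE.
pose W j p := (\int[Q]_u (h (p, u (m + j)%N) * \1_D (p, u))%:E)%E.
have mhD (f : S * E -> R) j : measurable_fun setT f ->
   measurable_fun setT (fun z : S * seqsp E => (f (z.1, z.2 j) * \1_D z)%:E).
  move=> mf; apply/measurable_EFinP; apply: measurable_funM; last exact: measurable_indic.
  apply: (measurableT_comp mf); apply: measurable_fun_pair; first exact: measurable_fst.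
  exact: (measurableT_comp (@measurable_coord _ E j) measurable_snd).
have mW j : measurable_fun setT (W j).
  apply: (measurable_fun_fubini_tonelli_F
     (fun z : S * seqsp E => (h (z.1, z.2 (m + j)%N) * \1_D z)%:E)) => //.
    exact: mhD.
  by move=> z; rewrite lee_fin mulr_ge0.
have W0 j p : (0 <= W j p)%E by apply: integral_ge0 => u _; rewrite lee_fin mulr_ge0.
have LHSE (j : nat) : ((mu \x Q) [set z | D (z.1.1, setc (m + j)%N z.1.2 z.2)] =
    \int[ka]_p W j p)%E.
  pose D' : set ((S * E) * seqsp E) := [set y | D (y.1.1, setc (m + j)%N y.1.2 y.2)].
  have mD' : measurable D'.
    apply: measurable_preimageT => //; apply: measurable_fun_pair.
      exact: (measurableT_comp measurable_fst measurable_fst).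
    pose gg (y : S * E * seqsp E) := (y.1.2, y.2).
    have mgg : measurable_fun setT gg.
      apply: measurable_fun_pair; last exact: measurable_snd.
      exact: (measurableT_comp measurable_snd measurable_fst).
    exact: (measurableT_comp (@measurable_setc _ E _) mgg).
  rewrite product_measure_integral_l// hE//.
    by rewrite (swap_integral (m + j)%N).
  rewrite (_ : (fun z => _) = Q \o xsection D'); first exact: measurable_fun_xsection.
  apply/funext => z /=; congr (Q _); apply/seteqP.
  by split => u; rewrite /xsection/= inE.
have RHSE : ((mu \x Q) [set z | D (z.1.1, z.2)] =
    \int[ka]_p (Q [set u | D (p, u)] * g p))%E.
  have mD' : measurable [set z : S * E * seqsp E | D (z.1.1, z.2)].
    apply: measurable_preimageT => //; apply: measurable_fun_pair.
      exact: (measurableT_comp measurable_fst measurable_fst).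
    exact: measurable_snd.
  have mQ1 : measurable_fun setT (fun z : S * E => Q [set u | D (z.1, u)]).
    exact: (measurableT_comp mQD measurable_fst).
  rewrite product_measure_integral_l// hE//.
  rewrite (fubini_tonelli1 (fun z : S * E => Q [set u | D (z.1, u)] * (h z)%:E)%E)//.
  - apply: eq_integral => p _; rewrite /fubini_F/= ge0_integralZl//.
      exact: mh2.
    by move=> t _; rewrite lee_fin.
  - by apply: emeasurable_funM => //; exact/measurable_EFinP.
  - by move=> z; rewrite mule_ge0// lee_fin.
under eq_bigr do rewrite LHSE.
rewrite RHSE -ge0_integral_sum//.
have rhoe : (\int[ka]_p rho p <= (e / 2)%:E)%E.
  by rewrite -(fubini_tonelli1 (fun z : S * E => (r z)%:E))//; exact/measurable_EFinP.
(* With the context [p] fixed, the truncated density is averaged over the places by [iid_sum_le].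
   For the tail the event [D] is dropped, at the cost of [rho p] for each place. *)
have key p : (\sum_(j < L) W j p <=
    L%:R%:E * (Q [set u | D (p, u)] * g p + (rho p + (e / 2)%:E)))%E.
  have intk : (\int[la]_t (hk (p, t))%:E \is a fin_num)%E.
    rewrite ge0_fin_numE; last by apply: integral_ge0 => t _; rewrite lee_fin.
    apply: (@le_lt_trans _ _ (\int[la]_t (cst K%:R%:E t))%E).
      apply: ge0_le_integral => //.
      - by move=> t _; rewrite lee_fin.
      - exact: mh2.
      - by move=> t _; rewrite lee_fin.
    by rewrite integral_cst// measure_probability_setT mule1 ltry.
  have split_W j : (W j p = \int[Q]_u (hk (p, u (m + j)%N) * \1_[set u | D (p, u)] u)%:E +
      \int[Q]_u (r (p, u (m + j)%N) * \1_[set u | D (p, u)] u)%:E)%E.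
    have indE u : \1_[set u | D (p, u)] u = \1_D (p, u) :> R.
      by rewrite !indicE; congr (nat_of_bool _)%:R; apply/idP/idP; rewrite !inE.
    have mm (f : S * E -> R) : measurable_fun setT f -> measurable_fun setT
        (fun u : seqsp E => (f (p, u (m + j)%N) * \1_[set u | D (p, u)] u)%:E).
      move=> mf; apply/measurable_EFinP; apply: measurable_funM; last exact: measurable_indic.
      apply: (measurableT_comp mf); apply: measurable_fun_pair; first exact: measurable_cst.
      exact: measurable_coord.
    rewrite -ge0_integralD//.
    - by apply: eq_integral => u _; rewrite -EFinD -mulrDl /r subrKC indE.
    - by move=> u _; rewrite lee_fin mulr_ge0.
    - exact: mm.
    - by move=> u _; rewrite lee_fin mulr_ge0.
    - exact: mm.
  have rbound j : (\int[Q]_u (r (p, u (m + j)%N) * \1_[set u | D (p, u)] u)%:E <= rho p)%E.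
    rewrite /rho -(integral_coord (m + j) (mh2 r p mr)); last first.
      by move=> t; rewrite lee_fin.
    apply: ge0_le_integral => //.
    - by move=> u _; rewrite lee_fin mulr_ge0.
    - apply/measurable_EFinP; apply: measurable_funM; last exact: measurable_indic.
      apply: (measurableT_comp mr); apply: measurable_fun_pair; first exact: measurable_cst.
      exact: measurable_coord.
    - exact: (measurableT_comp (mh2 r p mr) (@measurable_coord _ E _)).
    - by move=> u _; rewrite lee_fin ler_piMr// indicE; case: (_ \in _).
  under eq_bigr do rewrite split_W.
  rewrite big_split/=.
  have mhkp : measurable_fun setT (fun t => hk (p, t)).
    exact: (measurableT_comp mhk (pair1_measurable _)).
  have := @iid_sum_le (fun t => hk (p, t)) K%:R (fine (\int[la]_t (hk (p, t))%:E)%E)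
    mhkp (fun t => hk0 (p, t)) (fun t => hkK (p, t)) _ m L _ (e / 4) (mDsec p) e40 L0.
  rewrite fineK// => /(_ erefl) hsum.
  apply: (@le_trans _ _ ((L%:R * fine (\int[la]_t (hk (p, t))%:E))%:E * Q [set u | D (p, u)] +
     (L%:R * (e / 4) + K%:R ^+ 2 / (4 * (e / 4)))%:E + L%:R%:E * rho p)%E).
    apply: leeD => //.
    apply: (@le_trans _ _ (\sum_(j < L) rho p)%E); first exact: lee_sum.
    suff -> : forall n, (\sum_(j < n) rho p = n%:R%:E * rho p)%E by [].
    elim=> [|n ih]; first by rewrite big_ord0 mul0e.
    by rewrite big_ord_recr/= ih -natr1 EFinD ge0_muleDl ?lee_fin// mul1e.
  have Qg0 : (0 <= Q [set u | D (p, u)] * g p)%E by rewrite mule_ge0.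
  have re0 : (0 <= rho p + (e / 2)%:E)%E by rewrite adde_ge0// lee_fin ltW.
  rewrite (ge0_muleDr _ Qg0 re0) -addeA leeD//.
    rewrite EFinM -muleA lee_wpmul2l// ?lee_fin//.
    rewrite muleC lee_wpmul2l// fineK//.
    apply: ge0_le_integral => //; try exact: mh2.
    - by move=> t _; rewrite lee_fin.
    - by move=> t _; rewrite lee_fin.
  have e20' : (0 <= (e / 2)%:E)%E by rewrite lee_fin ltW.
  rewrite addeC (ge0_muleDr _ (rho0 p) e20') leeD2l// -EFinM lee_fin -/b.
  by lra.
apply: (@le_trans _ _ (\int[ka]_p
    (L%:R%:E * (Q [set u | D (p, u)] * g p + (rho p + (e / 2)%:E))))%E).
  apply: ge0_le_integral => //.
  - by move=> p _; exact: sume_ge0.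
  - exact: emeasurable_sum.
  - apply: measurable_funeM; apply: emeasurable_funD; first exact: emeasurable_funM.
    exact: emeasurable_funD.
rewrite ge0_integralZl//; last 2 first.
- apply: emeasurable_funD; first exact: emeasurable_funM.
  exact: emeasurable_funD.
- move=> p _; apply: adde_ge0; first exact: mule_ge0.
  by rewrite adde_ge0// lee_fin ltW.
rewrite lee_wpmul2l// ?lee_fin// ge0_integralD//; last 4 first.
- by move=> p _; rewrite mule_ge0.
- exact: emeasurable_funM.
- by move=> p _; rewrite adde_ge0// lee_fin ltW.
- exact: emeasurable_funD.
rewrite leeD2l// ge0_integralD//; last by move=> p _; rewrite lee_fin ltW.
rewrite integral_cst// measure_probability_setT mule1.
by rewrite [in leRHS](splitr e) EFinD leeD2r.
Qed.

End insertion.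

End law_of_large_numbers.

(** * The unit interval *)

Section unit_interval.
Context (R : realType).

Definition to01 (x : R) : mI01 R := odflt (point : I01 R) (insub x : option (I01 R)).

Lemma to01K (x : R) : 0 < x < 1 -> I01val (to01 x) = x.
Proof.
move=> x01; rewrite /to01; case: insubP => [u _ <-//|]; by rewrite x01.
Qed.

Lemma I01valK (u : mI01 R) : to01 (I01val u) = u.
Proof. by rewrite /to01 (valK (u : I01 R)). Qed.

Lemma I01val_inj : injective (@I01val R).
Proof. exact: val_inj. Qed.

Lemma I01val_itv (u : mI01 R) : 0 < I01val u < 1.
Proof. by case: u. Qed.

Lemma measurable_I01val : measurable_fun setT (@I01val R : mI01 R -> R).
Proof. by move=> _ A mA; rewrite setTI; exists A => //; rewrite setTI. Qed.

Lemma measurable_funI01P d (T : measurableType d) (f : T -> mI01 R) :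
  measurable_fun setT (fun x => I01val (f x)) -> measurable_fun setT f.
Proof.
move=> mf _ A [B mB <-]; rewrite setTI.
rewrite (_ : f @^-1` _ = [set x | B (I01val (f x))]).
  exact: measurable_preimageT.
by apply/seteqP; split => x /=; rewrite /preimage/=; [move=> []|split].
Qed.

Lemma measurable_to01 : measurable_fun setT to01.
Proof.
apply: measurable_funI01P.
apply: (@measurable_fun_glue _ _ R R [set x : R | x \in `]0, 1[] idfun
  (cst (I01val (point : I01 R))) (fun x => I01val (to01 x))).
- exact: measurable_itv.
- exact: measurable_id.
- exact: measurable_cst.
- by move=> x /=; rewrite in_itv/= => /to01K.
- by move=> x /=; rewrite in_itv/= => /negP x01; rewrite /to01 insubN.
Qed.

Lemma measurable_I01_image (A : set (mI01 R)) : measurable A ->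
  measurable (I01val @` A).
Proof.
move=> [B mB <-]; rewrite (_ : _ @` _ = `]0, 1[%classic `&` B).
  exact: measurableI.
apply/seteqP; split => x /=.
  by move=> [u [_ Bu] <-]; rewrite in_itv/= I01val_itv.
rewrite in_itv/= => -[x01 Bx]; exists (to01 x); last exact: to01K.
by split => //=; rewrite /preimage/= to01K.
Qed.

Let mes010 : @mes01 R set0 = 0%E.
Proof. by rewrite /mes01 image_set0 measure0. Qed.

Let mes01_ge0 A : (0 <= @mes01 R A)%E.
Proof. exact: measure_ge0. Qed.

Let mes01_sigma_additive : semi_sigma_additive (@mes01 R).
Proof.
move=> F mF tF mUF; rewrite /mes01 image_bigcup.
apply: measure_semi_sigma_additive => //.
- by move=> n; exact: measurable_I01_image.
- apply/trivIsetP => i j _ _ ij.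
  have /trivIsetP/(_ i j I I ij) Fij := tF.
  apply/seteqP; split => // x /= [[u Fu <-] [v Fv] /I01val_inj uv].
  have : (F i `&` F j) u by split=> //; rewrite -uv.
  by rewrite Fij.
- by rewrite -image_bigcup; exact: measurable_I01_image.
Qed.

HB.instance Definition _ := isMeasure.Build _ _ _ (@mes01 R)
  mes010 mes01_ge0 mes01_sigma_additive.

Let mes01T : @mes01 R setT = 1%E.
Proof.
rewrite /mes01 (_ : _ @` _ = `]0, 1[%classic).
  by rewrite lebesgue_measure_itv/= lte_fin ltr01 oppr0 adde0.
apply/seteqP; split => x /=.
  by move=> [u _ <-]; rewrite in_itv/= I01val_itv.
by rewrite in_itv/= => x01; exists (to01 x) => //; exact: to01K.
Qed.

HB.instance Definition _ := Measure_isProbability.Build _ _ _ (@mes01 R) mes01T.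

End unit_interval.

Arguments to01 {R} x.

(** * Comparison of measures and of laws on the line *)

Lemma measure_eq_null d (T : measurableType d) (R : realType)
    (mu : {measure set T -> \bar R}) (A B N : set T) :
  measurable A -> measurable B -> measurable N -> mu N = 0%E ->
  A `<=` B `|` N -> B `<=` A `|` N -> mu A = mu B.
Proof.
move=> mA mB mN N0 AB BA; apply/eqP; rewrite eq_le; apply/andP; split.
  rewrite -[leRHS]adde0 -N0; apply: le_trans (measureU2 _ mB mN).
  by apply: le_measure; rewrite ?inE//; exact: measurableU.
rewrite -[leRHS]adde0 -N0; apply: le_trans (measureU2 _ mA mN).
by apply: le_measure; rewrite ?inE//; exact: measurableU.
Qed.

Lemma real_law_unique d1 d2 (S1 : measurableType d1) (S2 : measurableType d2)
    (R : realType) (P1 : probability S1 R) (P2 : probability S2 R)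
    (f1 : S1 -> R) (f2 : S2 -> R) :
  measurable_fun setT f1 -> measurable_fun setT f2 ->
  (forall t, P1 [set x | t < f1 x] = P2 [set x | t < f2 x]) ->
  forall B, measurable B -> P1 (f1 @^-1` B) = P2 (f2 @^-1` B).
Proof.
move=> mf1 mf2 h B mB.
pose g1 : {mfun S1 >-> R} := HB.pack f1 (isMeasurableFun.Build _ _ _ _ _ mf1).
pose g2 : {mfun S2 >-> R} := HB.pack f2 (isMeasurableFun.Build _ _ _ _ _ mf2).
suff : distribution P1 g1 B = distribution P2 g2 B by [].
apply: (@measure_unique _ R R (@RGenOInfty.G R) (fun n => `](- n%:R), +oo[%classic)
  _ _ _ _ (distribution P1 g1) (distribution P2 g2)) => //.
- exact: RGenOInfty.measurableE.
- move=> _ _ [x ->] [y ->]; exists (Num.max x y).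
  apply/seteqP; split => z /=; rewrite !in_itv/= !andbT gt_max; first by move=> [-> ->].
  by move/andP.
- by move=> n; exists (- n%:R).
- rewrite -subTset => x _; exists (Num.bound `|x|) => //=.
  rewrite in_itv/= andbT ltrNl; apply: le_lt_trans (archi_boundP (normr_ge0 x)).
  by rewrite -normrN ler_norm.
- move=> _ [t ->].
  transitivity (P1 [set x | t < f1 x]).
    by congr (P1 _); apply/seteqP; split => x /=; rewrite in_itv/= andbT.
  rewrite h.
  by congr (P2 _); apply/seteqP; split => x /=; rewrite in_itv/= andbT.
- by move=> k; rewrite (le_lt_trans _ (ltry 1))// probability_le1.
Qed.

(** * Invariance of Lebesgue measure *)

Section lebesgue_invariance.
Context (R : realType).
Local Notation leb := (@lebesgue_measure R).

Lemma lebesgue_translate (c : R) (A : set R) : measurable A ->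
  leb [set x | A (x + c)] = leb A.
Proof.
move=> mA; apply: esym.
have mf : measurable_fun setT (fun x : measurableTypeR R => x + c : measurableTypeR R).
  exact: measurable_funD.
pose mf_pack : {mfun _ >-> _} := HB.pack (fun x : measurableTypeR R => x + c : measurableTypeR R)
  (isMeasurableFun.Build _ _ _ _ _ mf).
apply: (@lebesgue_measure_unique R (pushforward leb mf_pack)) => //.
move=> X [[a b] _ <-].
transitivity (leb `]a - c, b - c]%classic); last first.
  by congr (leb _); apply/seteqP; split => x /=; rewrite !in_itv/= ltrBlDr lerBrDr.
by rewrite !lebesgue_measure_itv/= !lte_fin ltrD2r -!EFinB; case: ifP => // _; congr EFin; lra.
Qed.

Lemma lebesgue_opp (A : set R) : measurable A ->
  leb [set x | A (- x)] = leb A.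
Proof.
move=> mA; apply: esym.
have mf : measurable_fun setT (fun x : measurableTypeR R => - x : measurableTypeR R).
  exact: oppr_measurable.
pose mf_pack : {mfun _ >-> _} := HB.pack (fun x : measurableTypeR R => - x : measurableTypeR R)
  (isMeasurableFun.Build _ _ _ _ _ mf).
apply: (@lebesgue_measure_unique R (pushforward leb mf_pack)) => //.
move=> X [[a b] _ <-].
transitivity (leb `[- b, - a[%classic); last first.
  by congr (leb _); apply/seteqP; split => x /=; rewrite !in_itv/= ltrNr lerNl andbC.
by rewrite !lebesgue_measure_itv/= !lte_fin ltrN2 -!EFinB; case: ifP => // _; congr EFin; lra.
Qed.

(** Since [I01val t + e < 1] and [0 <= a <= e], the shifted point stays in (0,1), where translation
    invariance applies. The restriction mentions [e] only, so it is the same for all shifts [a]. *)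
Lemma mes01_translate (C : set (mI01 R)) (a e : R) : measurable C -> 0 <= a <= e ->
  (mes01 [set t : mI01 R | (I01val t + e < 1)%R /\ C (to01 (I01val t + a)%R)]
     <= mes01 C)%E.
Proof.
move=> mC /andP[a0 ae]; rewrite /mes01 -[leRHS](lebesgue_translate a); last first.
  exact: measurable_I01_image.
have mL : measurable [set t : mI01 R | I01val t + e < 1 /\ C (to01 (I01val t + a))].
  apply: measurable_set_and.
    apply: measurable_set_lt; last exact: measurable_cst.
    by apply: measurable_funD; [exact: measurable_I01val|exact: measurable_cst].
  have mta : measurable_fun setT (fun t : mI01 R => I01val t + a).
    by apply: measurable_funD; [exact: measurable_I01val|exact: measurable_cst].
  apply: (measurable_preimageT (f := fun t : mI01 R => to01 (I01val t + a))) => //.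
  exact: (measurableT_comp (@measurable_to01 R) mta).
apply: le_measure; rewrite ?inE//.
- exact: measurable_I01_image.
- have mfa : measurable_fun [set: R] (fun x => x + a).
    by apply: measurable_funD => //; exact: measurable_cst.
  exact: (measurable_preimageT mfa (measurable_I01_image mC)).
move=> x /= [t [te Ct] <-]; exists (to01 (I01val t + a)) => //.
apply: to01K; have /andP[t0 t1] := I01val_itv t.
by apply/andP; split; lra.
Qed.

Lemma mes01_set1 (x : mI01 R) : mes01 [set x] = 0%E.
Proof. by rewrite /mes01 image_set1 lebesgue_measure_set1. Qed.

End lebesgue_invariance.

(** * The centred normal law: symmetry, absence of atoms, reduction to the uniform law *)

Section normal.
Context (R : realType) (s : R).
Hypothesis s0 : s != 0.
Local Notation leb := (@lebesgue_measure R).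

Lemma normal_prob_opp (A : set R) : measurable A ->
  normal_prob 0 s [set x | A (- x)] = normal_prob 0 s A.
Proof.
move=> mA; rewrite /normal_prob.
have mf : measurable_fun setT (fun x : measurableTypeR R => - x : measurableTypeR R).
  exact: oppr_measurable.
have mpdf : measurable_fun A (fun x => (normal_pdf 0 s x)%:E).
  by apply: measurable_funTS; apply/measurable_EFinP; exact: measurable_normal_pdf.
pose mf_pack : {mfun _ >-> _} := HB.pack (fun x : measurableTypeR R => - x : measurableTypeR R)
  (isMeasurableFun.Build _ _ _ _ _ mf).
transitivity (\int[pushforward leb mf_pack]_(x in A) (normal_pdf 0 s x)%:E)%E; last first.
  by apply: eq_measure_integral => B mB _; rewrite -[RHS]lebesgue_opp.
rewrite (ge0_integral_pushforward mf leb mA mpdf); last first.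
  by move=> y _; rewrite lee_fin normal_pdf_ge0.
apply: eq_integral => x _ /=; congr EFin.
by rewrite !normal_pdfE// /normal_fun !subr0 sqrrN.
Qed.

Lemma normal_prob_le (A : set R) : measurable A ->
  (normal_prob 0 s A <= (normal_peak s)%:E * leb A)%E.
Proof.
move=> mA; rewrite -integral_cst//; apply: ge0_le_integral => //.
- by move=> x _; rewrite lee_fin normal_pdf_ge0.
- by apply: measurable_funTS; apply/measurable_EFinP; exact: measurable_normal_pdf.
- by move=> x _; rewrite lee_fin normal_pdf_ub.
Qed.

Lemma normal_prob_set1 (x : R) : normal_prob 0 s [set x] = 0%E.
Proof.
apply/eqP; rewrite eq_le measure_ge0 andbT.
by apply: (le_trans (normal_prob_le _)) => //; rewrite lebesgue_measure_set1 mule0.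
Qed.

Local Notation nu := (normal_prob 0 s).

Let G (x : R) := fine (nu `]-oo, x]).

Let nuG x : nu `]-oo, x] = (G x)%:E.
Proof. by rewrite /G fineK// fin_num_measure. Qed.

Let G_lip x y : x <= y -> G x <= G y <= G x + normal_peak s * (y - x).
Proof.
move=> xy.
have E : (`]-oo, y]%classic = `]-oo, x]%classic `|` `]x, y]%classic :> set R).
  apply/seteqP; split => z /=; rewrite !in_itv/=.
    by move=> zy; case: (leP z x); [left|right; rewrite zy].
  by case=> [/le_trans->//|/andP[]].
have : nu `]-oo, y] = (nu `]-oo, x] + nu `]x, y])%E.
  rewrite E measureU//.
  apply/seteqP; split => z //=; rewrite !in_itv/= => -[zx /andP[xz _]].
  by rewrite ltNge zx in xz.
rewrite !nuG => H.
have fin : nu `]x, y] \is a fin_num by rewrite fin_num_measure.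
have H' : G y = G x + fine (nu `]x, y]).
  by rewrite -[G y]/(fine (G y)%:E) H fineD.
have h0 : 0 <= fine (nu `]x, y]) by rewrite fine_ge0.
have h1 : fine (nu `]x, y]) <= normal_peak s * (y - x).
  rewrite -lee_fin fineK//; apply: (le_trans (normal_prob_le _)) => //.
  rewrite lebesgue_measure_itv/= lte_fin; case: ifPn => [_|].
    by rewrite -EFinB -EFinM.
  by rewrite mule0 lee_fin mulr_ge0 ?normal_peak_ge0// subr_ge0.
by rewrite H'; apply/andP; split; lra.
Qed.

Let Gabs x y : `|G x - G y| <= normal_peak s * `|x - y|.
Proof.
wlog xy : x y / x <= y.
  move=> H; case: (leP x y) => [|/ltW]; first exact: H.
  by move=> /H; rewrite distrC [`|y - x|]distrC.
have /andP[h1 h2] := G_lip xy.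
rewrite distrC ger0_norm ?subr_ge0// distrC ger0_norm ?subr_ge0//; lra.
Qed.

Let G_ivt t : 0 < t < 1 -> exists x, G x = t.
Proof.
move=> /andP[t0 t1].
have mid : measurable_fun [set: measurableTypeR R] (idfun : measurableTypeR R -> R).
  exact: measurable_id.
pose X0 : {mfun measurableTypeR R >-> R} :=
  HB.pack (idfun : measurableTypeR R -> R) (isMeasurableFun.Build _ _ _ _ _ mid).
pose X : {RV nu >-> R} := X0.
have [a Ga] : exists a, G a < t.
  have := @cvg_cdfNy0 _ _ _ nu X => /fine_cvgP[_ /cvgrPdist_lt/(_ t t0)].
  move=> [M [_ h]]; have M1 : M - 1 < M by lra.
  have {h} : `|0 - G (M - 1)| < t := h _ M1.
  by rewrite sub0r normrN => h; exists (M - 1); exact: le_lt_trans (ler_norm _) h.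
have [b Gb] : exists b, t < G b.
  have t10 : 0 < 1 - t by lra.
  have := @cvg_cdfy1 _ _ _ nu X => /fine_cvgP[_ /cvgrPdist_lt/(_ _ t10)].
  move=> [M [_ h]]; have M1 : M < M + 1 by lra.
  have {h} : `|1 - G (M + 1)| < 1 - t := h _ M1.
  by move=> /(le_lt_trans (ler_norm _)) h; exists (M + 1); lra.
have ab : a <= b.
  rewrite leNgt; apply/negP => /ltW /G_lip/andP[h _].
  by have := le_lt_trans h (lt_trans Ga Gb); rewrite ltxx.
have cG : {within `[a, b], continuous G}.
  apply: continuous_subspaceT => x; apply/cvgrPdist_le => /= e e0.
  have k0 : 0 < normal_peak s + 1 by rewrite ltr_wpDl// normal_peak_ge0.
  near=> y.
  have yx : `|x - y| <= e / (normal_peak s + 1).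
    by near: y; apply: cvgr_dist_le => //; rewrite divr_gt0.
  apply: (le_trans (Gabs x y)); apply: (@le_trans _ _ ((normal_peak s + 1) * `|x - y|)).
    by rewrite ler_wpM2r// lerDl.
  by rewrite mulrC -ler_pdivlMr.
have [|x _ Gx] := @IVT R G a b t ab cG; last by exists x.
by rewrite ge_min le_max (ltW Ga) (ltW Gb) orbT.
Unshelve. all: by end_near. Qed.

Let mG : measurable_fun setT G.
Proof.
by apply: nondecreasing_measurable => // x y /G_lip/andP[].
Qed.

(** The distribution function [G] is continuous and takes every value in (0,1), so the event is
    squeezed between two half-lines, one ending at a point of level [t] and one at a point of
    slightly larger level. *)
Let G_law t : 0 < t < 1 -> nu [set x | G x <= t] = t%:E.
Proof.
move=> t01.
have mS : measurable [set x | G x <= t].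
  by apply: measurable_set_le => //; exact: measurable_cst.
apply/eqP; rewrite eq_le; apply/andP; split; last first.
  have [x Gx] := G_ivt t01; rewrite -Gx -nuG.
  apply: le_measure; rewrite ?inE//; first by rewrite Gx.
  by move=> y /=; rewrite in_itv/= => /G_lip/andP[].
apply/lee_addgt0Pr => e e0.
have /andP[t0 t1] := t01.
(* A level above [t] by at most [e] and still below 1. *)
pose r := Num.min (t + e) ((t + 1) / 2).
have r01 : 0 < r < 1.
  rewrite /r lt_min gt_min; apply/andP; split; first by apply/andP; split; lra.
  by apply/orP; right; lra.
have [x Gx] := G_ivt r01.
apply: (@le_trans _ _ r%:E); last by rewrite -EFinD lee_fin /r ge_min lexx.
rewrite -Gx -nuG; apply: le_measure; rewrite ?inE// => y /= Gy.
rewrite in_itv/= leNgt; apply/negP => /ltW /G_lip/andP[h _].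
have tr : t < r by rewrite /r lt_min; apply/andP; split; lra.
by rewrite Gx in h; lra.
Qed.

(** A normal variable becomes uniform under its own distribution function. In this way increments of
    the Brownian path will supply an i.i.d. uniform sequence. *)
Lemma normal_prob_to_uniform : exists F : R -> mI01 R, measurable_fun setT F /\
  forall A, measurable A -> normal_prob 0 s (F @^-1` A) = mes01 A.
Proof.
exists (to01 \o G); split; first exact: (measurableT_comp (@measurable_to01 R) mG).
move=> A mA.
have mF : measurable_fun setT (I01val \o (to01 \o G)).
  by apply: (measurableT_comp (@measurable_I01val R)); exact: (measurableT_comp (@measurable_to01 R) mG).
have [B mB BA] := mA; rewrite -BA setTI.
(* [to01] takes its default value where [G] is 0 or 1; these two sets are shown to be null. *)
have G0 : nu [set x | G x <= 0] = 0%E.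
  apply/eqP; rewrite eq_le measure_ge0 andbT; apply/lee_addgt0Pr => e e0.
  pose r := Num.min e (1 / 2).
  have r01 : 0 < r < 1 by rewrite /r lt_min gt_min; lra.
  apply: (@le_trans _ _ r%:E); last by rewrite add0e lee_fin /r ge_min lexx.
  rewrite -(G_law r01); apply: le_measure; rewrite ?inE//.
  - by apply: measurable_set_le => //; exact: measurable_cst.
  - by apply: measurable_set_le => //; exact: measurable_cst.
  - by move=> x /= h; case/andP: r01; lra.
have G1 : nu [set x | 1 <= G x] = 0%E.
  apply/eqP; rewrite eq_le measure_ge0 andbT; apply/lee_addgt0Pr => e e0.
  pose r := Num.min e (1 / 2).
  have r01 : 0 < 1 - r < 1.
    have : 0 < r <= 1 / 2 by rewrite /r lt_min ge_min lexx orbT andbT; lra.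
    by lra.
  have mS : measurable [set x | G x <= 1 - r].
    by apply: measurable_set_le => //; exact: measurable_cst.
  apply: (@le_trans _ _ (nu (~` [set x | G x <= 1 - r]))).
    apply: le_measure; rewrite ?inE//.
    - by apply: measurable_set_le => //; exact: measurable_cst.
    - exact: measurableC.
    - by move=> x /= h; apply/negP; rewrite -ltNge; case/andP: r01; lra.
  have E : nu (~` [set x | G x <= 1 - r]) = (1 - (1 - r)%:E)%E.
    rewrite (@probability_setC _ _ _ (normal_prob 0 s) _ mS).
    have H : (1 - nu [set x | (G x <= 1 - r)%R] = 1 - (1 - r)%:E)%E by rewrite G_law.
    exact: H.
  by rewrite [leLHS]E -EFinB add0e lee_fin subKr ge_min lexx.
have tail t : 0 < t < 1 -> nu [set x | t < I01val (to01 (G x))] = (1 - t)%:E.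
  move=> t01; have /andP[t0 t1] := t01.
  have mS : measurable [set x | G x <= t].
    by apply: measurable_set_le => //; exact: measurable_cst.
  have E : nu (~` [set x | G x <= t]) = (1 - t)%:E.
    rewrite (@probability_setC _ _ _ (normal_prob 0 s) _ mS).
    have H : (1 - nu [set x | (G x <= t)%R] = (1 - t)%:E)%E by rewrite G_law.
    exact: H.
  rewrite -E.
  apply: (@measure_eq_null _ _ _ (normal_prob 0 s) _ _ ([set x | G x <= 0] `|` [set x | 1 <= G x])).
  - apply: measurable_set_lt; first exact: measurable_cst.
    exact: mF.
  - by apply: measurableC; apply: measurable_set_le => //; exact: measurable_cst.
  - by apply: measurableU; apply: measurable_set_le => //; exact: measurable_cst.
  - have m0 : measurable [set x | G x <= 0].
      by apply: measurable_set_le => //; exact: measurable_cst.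
    have m1 : measurable [set x | 1 <= G x].
      by apply: measurable_set_le => //; exact: measurable_cst.
    exact: (etrans (@measureU0 _ _ _ (normal_prob 0 s) _ _ m0 m1 G1) G0).
  - move=> x; rewrite /setU/setC/= => h.
    have [h1|h1] := leP (G x) 0; first by right; left.
    have [h2|h2] := leP 1 (G x); first by right; right.
    by left; apply/negP; rewrite -ltNge -(@to01K R (G x)) ?h1.
  - move=> x; rewrite /setU/setC/= => /negP; rewrite -ltNge => h.
    have [h1|h1] := leP (G x) 0; first by right; left.
    have [h2|h2] := leP 1 (G x); first by right; right.
    by left; rewrite to01K ?h1.
have mtail t : mes01 [set u : mI01 R | t < I01val u] =
    lebesgue_measure (`]Num.max t 0, 1[%classic : set R).
  rewrite /mes01; congr (lebesgue_measure _); apply/seteqP; split => x /=.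
    by move=> [u /= tu <-]; rewrite in_itv/= gt_max tu I01val_itv.
  rewrite in_itv/= gt_max => /andP[/andP[tx x0] x1].
  by exists (to01 x) => /=; rewrite to01K ?x0.
apply: (@real_law_unique _ _ _ _ R (normal_prob 0 s) (@mes01 R)
  (fun x => I01val (to01 (G x))) (@I01val R)) => //; first exact: measurable_I01val.
move=> t; rewrite [RHS]mtail lebesgue_measure_itv/= lte_fin gt_max ltr01 andbT.
have [t0|t0] := leP t 0.
  rewrite (_ : [set _ | _] = setT); last first.
    apply/seteqP; split => // x _ /=; apply: (le_lt_trans t0).
    by case/andP: (I01val_itv (to01 (G x))).
  rewrite measure_probability_setT (le_lt_trans t0 ltr01).
  by rewrite oppr0 adde0.
have [t1|t1] := ltP t 1.
  by rewrite -EFinB; apply: tail; rewrite t0.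
rewrite (_ : [set _ | _] = set0) ?measure0//.
apply/seteqP; split => // x /= h.
have /andP[_ h1] := I01val_itv (to01 (G x)).
by have := lt_trans h h1; rewrite ltNge t1.
Qed.

End normal.

(** * Minimizers of continuous paths *)

Section paths.
Context (R : realType).
Implicit Types (f g : R -> R) (p q s t : R).

Definition qn (n : nat) : R := ratr (odflt 0%Q (unpickle n)).

Lemma qn_dense p q : p < q -> exists n, p < qn n < q.
Proof.
move=> /rat_in_itvoo[r]; rewrite in_itv/= => rpq.
by exists (pickle r); rewrite /qn pickleK.
Qed.

Lemma qn_rat (r : rat) : exists n, qn n = ratr r.
Proof. by exists (pickle r); rewrite /qn pickleK. Qed.

Definition sample f : seqsp R := fun n => f (qn n).

(* The minimum of the sampled path over [p, q] is attained before [qn k]. *)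
Definition attained p q (g : seqsp R) k :=
  p <= qn k <= q /\ forall n, p <= qn n <= q -> forall m,
    exists l, p <= qn l <= qn k /\ g l < g n + m.+1%:R^-1.

(** For a continuous path and [p < q] this is the leftmost minimizer on [[p, q]]. The element [q] is
    needed when the minimum is reached only at an irrational [q], for then no rational time
    qualifies. Only countably many samples are involved, whence joint measurability in [p], [q] and
    the path. *)
Definition argmin p q (g : seqsp R) : R :=
  inf [set r | r = q \/ exists2 k, attained p q g k & r = qn k].

Definition is_argmin p q f s := [/\ p <= s <= q,
  forall t, p <= t <= q -> f s <= f t & forall t, p <= t < s -> f s < f t].

Lemma is_argmin_unique p q f s s' :
  is_argmin p q f s -> is_argmin p q f s' -> s = s'.
Proof.
move=> [/andP[ps sq] hs hs1] [/andP[ps' sq'] hs' hs1'].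
case: (ltgtP s s') => // ss'.
  have := hs1' s; rewrite ps ss' => /(_ isT).
  by rewrite ltNge hs// ps'.
have := hs1 s'; rewrite ps' ss' => /(_ isT).
by rewrite ltNge hs'// ps.
Qed.

Lemma continuousP_dist f t e : {for t, continuous f} -> 0 < e ->
  exists2 d, 0 < d & forall x, `|x - t| < d -> `|f x - f t| < e.
Proof.
move=> /cvgrPdist_lt/(_ e) h /h [d /= d0 hd]; exists d => // x xt.
by rewrite distrC; apply: hd; rewrite /ball/= distrC.
Qed.

Lemma is_argmin_exists p q f : continuous f -> p <= q -> exists s, is_argmin p q f s.
Proof.
move=> cf pq.
have [c cpq hc] := EVT_min pq (continuous_subspaceT cf).
pose Z := [set t | p <= t <= q /\ f t = f c].
have Zc : Z c by split => //; rewrite in_itv in cpq.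
have hZ : has_inf Z by split; [exists c|exists p => t [/andP[]]].
have sp : p <= inf Z by apply: lb_le_inf; [exists c|move=> t [/andP[]]].
have sq : inf Z <= q.
  by apply: (le_trans (ge_inf hZ.2 Zc)); case: Zc => /andP[].
have fs : f (inf Z) = f c.
  apply/eqP; rewrite eq_le; apply/andP; split; last by apply: hc; rewrite in_itv/= sp.
  rewrite leNgt; apply/negP => fcs.
  have e0 : 0 < f (inf Z) - f c by rewrite subr_gt0.
  have [d d0 hd] := continuousP_dist (@cf (inf Z)) e0.
  have [z Zz zd] := inf_adherent d0 hZ.
  have zs : inf Z <= z by exact: (ge_inf hZ.2 Zz).
  have : `|f z - f (inf Z)| < f (inf Z) - f c.
    by apply: hd; rewrite ger0_norm ?subr_ge0// ltrBlDl.
  case: Zz => _ ->; rewrite distrC ger0_norm ?ltxx//.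
  exact: ltW.
exists (inf Z); split; first by rewrite sp.
  by move=> t tpq; rewrite fs; apply: hc; rewrite in_itv.
move=> t /andP[pt tsZ]; rewrite fs lt_neqAle; apply/andP; split.
  apply/negP => /eqP ft; have : Z t.
    by split=> //; rewrite pt (le_trans (ltW tsZ)).
  by move=> /(ge_inf hZ.2); rewrite leNgt tsZ.
by apply: hc; rewrite in_itv/= pt (le_trans (ltW tsZ)).
Qed.

Lemma inv_succ_lt (e : R) : 0 < e -> exists m : nat, m.+1%:R^-1 < e.
Proof.
move=> e0; exists (Num.bound e^-1).
rewrite invf_plt ?posrE//; apply: (lt_trans (archi_boundP _)).
  by rewrite invr_ge0 ltW.
by rewrite ltr_nat.
Qed.

(** Let [s] be the leftmost minimizer. A rational beyond [s] is [attained], since values close to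
    [f s] occur at rationals before it. A rational before [s] is not: up to there the path exceeds
    [f s] by a positive gap, by compactness. *)
Lemma argminP p q f : continuous f -> p < q -> is_argmin p q f (argmin p q (sample f)).
Proof.
move=> cf pq; have [s sP] := is_argmin_exists cf (ltW pq).
suff -> : argmin p q (sample f) = s by [].
have [/andP[ps sq] hs hs1] := sP.
rewrite /argmin; set S := [set r | _].
have Sq : S q by left.
have hS : has_inf S.
  by split; [exists q|exists p => r [->|[k [/andP[? _] _] ->]]//; exact: ltW].
have near_s e r : 0 < e -> s < r -> p < r ->
    exists l, p <= qn l <= r /\ f (qn l) < f s + e.
  move=> e0 sr pr; have [d d0 hd] := continuousP_dist (@cf s) e0.
  have : Num.max p (s - d) < Num.min r (s + d).
    by rewrite lt_min !gt_max pr/=; apply/and3P; split; lra.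
  move=> /qn_dense[l]; rewrite gt_max lt_min => /andP[/andP[pl sl] /andP[lr ls]].
  exists l; split; first by rewrite !ltW.
  have : `|f (qn l) - f s| < e.
    by apply: hd; rewrite ltr_norml; apply/andP; split; lra.
  by move=> /(le_lt_trans (ler_norm _)); lra.
apply/eqP; rewrite eq_le; apply/andP; split.
  case: (ltgtP s q) sq => // [sq _|sqE _]; last by rewrite sqE; exact: (ge_inf hS.2 Sq).
  apply/ler_addgt0Pr => e e0.
  have : s < Num.min q (s + e) by rewrite lt_min sq; lra.
  move=> /qn_dense[k]; rewrite lt_min => /andP[sk /andP[kq ke]].
  apply: (@le_trans _ _ (qn k)); last exact: ltW.
  apply: (ge_inf hS.2); right; exists k => //; split.
    by rewrite (le_trans ps (ltW sk)) ltW.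
  move=> n npq m.
  have [||l [lk fl]] := near_s (m.+1%:R^-1) (qn k) _ sk; rewrite ?invr_gt0//.
    exact: le_lt_trans ps sk.
  exists l; split => //; apply: (lt_le_trans fl).
  by rewrite lerD2r; exact: hs.
apply: lb_le_inf; first by exists q.
move=> r [->//|[k [/andP[pk kq] Ak] ->]].
rewrite leNgt; apply/negP => ks.
have [c ck hc] := EVT_min pk (continuous_subspaceT cf).
move: ck; rewrite in_itv/= => /andP[pc ck].
have sc : f s < f c by apply: hs1; rewrite pc (le_lt_trans ck).
pose e := (f c - f s) / 2.
have e0 : 0 < e by rewrite divr_gt0// subr_gt0.
have [m hm] := inv_succ_lt e0.
have [n [npq fn]] : exists n, p <= qn n <= q /\ f (qn n) < f s + e.
  have [sq'|] := ltP s q; first exact: near_s.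
  move=> qs; have {qs} sq1 : s = q by apply/le_anti; rewrite sq.
  have [d d0 hd] := continuousP_dist (@cf s) e0.
  have : Num.max p (s - d) < s by rewrite gt_max sq1 pq; lra.
  move=> /qn_dense[l]; rewrite gt_max => /andP[/andP[pl sl] ls].
  exists l; split; first by rewrite -sq1 !ltW.
  have : `|f (qn l) - f s| < e.
    by apply: hd; rewrite ltr_norml; apply/andP; split; lra.
  by move=> /(le_lt_trans (ler_norm _)); lra.
have [l [/andP[pl lk] fl]] := Ak n npq m.
have : f c <= f (qn l) by apply: hc; rewrite in_itv/= pl.
have {}fl : f (qn l) < f (qn n) + m.+1%:R^-1 by exact: fl.
by move: fl hm fn; rewrite /e; move: (m.+1%:R^-1) => v; lra.
Qed.

Lemma argminE p q f s : continuous f -> p < q -> is_argmin p q f s ->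
  argmin p q (sample f) = s.
Proof. by move=> cf pq; apply: is_argmin_unique; exact: argminP. Qed.

Lemma is_argmin_strict p q f s : p <= s <= q ->
  (forall t, p <= t <= q -> t != s -> f s < f t) -> is_argmin p q f s.
Proof.
move=> spq h; split => // t.
  by case: (eqVneq t s) => [->//|ts tpq]; exact: ltW (h _ tpq ts).
move=> /andP[pt ts]; apply: h; last by rewrite lt_eqF.
by rewrite pt (le_trans (ltW ts)); case/andP: spq.
Qed.

Lemma measurable_argmin d (T : measurableType d) (p q : T -> R) (g : T -> seqsp R) :
  measurable_fun setT p -> measurable_fun setT q -> measurable_fun setT g ->
  (forall x, p x <= q x) -> measurable_fun setT (fun x => argmin (p x) (q x) (g x)).
Proof.
move=> mp mq mg pq; apply: measurable_fun_of_lt => r.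
have E : [set x | argmin (p x) (q x) (g x) < r] =
    [set x | q x < r] `|` [set x | exists k, attained (p x) (q x) (g x) k /\ qn k < r].
  apply/seteqP; split => x /=; rewrite /argmin; set S := [set r | _].
    have hS : has_inf S.
      by split; [exists (q x); left|exists (p x) => t [->|[k [/andP[? _] _] ->]]//].
    move=> h; have e0 : 0 < r - inf S by rewrite subr_gt0.
    have [t [->|[k Ak ->]] tr] := inf_adherent e0 hS; first by left; lra.
    by right; exists k; split => //; lra.
  have lS : has_lbound S.
    by exists (p x) => t [->|[k [/andP[? _] _] ->]].
  case=> [qr|[k [Ak kr]]].
    by apply: le_lt_trans qr; apply: ge_inf => //; left.
  by apply: le_lt_trans kr; apply: ge_inf => //; right; exists k.
rewrite E; apply: measurableU.
  by apply: measurable_set_lt => //; exact: measurable_cst.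
have mc n : measurable_fun setT (fun x => g x n).
  exact: (measurableT_comp (@measurable_coord _ R n) mg).
have mle2 (a b : T -> R) (c : R) : measurable_fun setT a -> measurable_fun setT b ->
    measurable [set x | a x <= c <= b x].
  move=> ma mb; rewrite (_ : [set x | _] = [set x | a x <= c] `&` [set x | c <= b x]).
    by apply: measurableI; apply: measurable_set_le => //; exact: measurable_cst.
  by apply/seteqP; split => x /=; [move/andP|move=> [h1 h2]; rewrite h1 h2].
apply: measurable_set_exists => k; apply: measurable_set_and; last exact: measurable_set_const.
apply: measurable_set_and; first exact: mle2.
apply: measurable_set_forall => n; apply: measurable_set_imp; first exact: mle2.
apply: measurable_set_forall => m; apply: measurable_set_exists => l.
apply: measurable_set_and.
  by apply: mle2 => //; exact: measurable_cst.
apply: measurable_set_lt => //; apply: measurable_funD => //; exact: measurable_cst.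
Qed.

(** * Resampling a path on an interval *)

Definition clamp (e x : R) := Num.min (Num.max x 0) e.

(* On [th, th + de] the increments of [f] are replaced by those of [g] on [0, de]. *)
Definition resample th de f g t := f (Num.min t th) + (g (clamp de (t - th)) - g 0)
  + (f (Num.max t (th + de)) - f (th + de)).

Lemma resample_left th de f g t : 0 <= de -> t <= th -> resample th de f g t = f t.
Proof.
move=> de0 tth; rewrite /resample /clamp (min_l tth) (@max_r _ _ (t - th)) ?subr_le0//.
by rewrite (min_l de0) subrr addr0 max_r ?subrr ?addr0//; lra.
Qed.

Lemma resample_mid th de f g t : th <= t <= th + de ->
  resample th de f g t = f th + (g (t - th) - g 0).
Proof.
move=> /andP[h1 h2]; rewrite /resample /clamp (min_r h1) max_l ?subr_ge0//.
by rewrite (max_r h2) subrr addr0 min_l//; lra.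
Qed.

Lemma resample_right th de f g t : 0 <= de -> th + de <= t ->
  resample th de f g t = f t + (f th + (g de - g 0) - f (th + de)).
Proof.
move=> de0 h; rewrite /resample /clamp min_r; last by lra.
by rewrite max_l; [rewrite min_r ?max_l//|]; lra.
Qed.

Lemma continuous_clampe (e : R) : continuous (clamp e).
Proof.
move=> x; have hm : {for x, continuous ((fun x : R => Num.max x 0) : R -> R^o)}.
  by apply: (@continuous_max _ _ id (cst 0)); [exact: cvg_id|exact: cvg_cst].
exact: (continuous_min hm (@cst_continuous R R^o e x)).
Qed.

Lemma continuous_resample th de f g : continuous f -> continuous g ->
  continuous (resample th de f g).
Proof.
move=> cf cg t; rewrite /resample.
apply: (@cvgD _ R^o); first apply: (@cvgD _ R^o).
- apply: (@continuous_comp _ _ _ (fun t => Num.min t th) f); last exact: cf.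
  by apply: (@continuous_min _ _ id (cst th)); [exact: cvg_id|exact: cvg_cst].
- apply: (@cvgB _ R^o); last exact: cvg_cst.
  apply: (@continuous_comp _ _ _ (fun t => clamp de (t - th)) g); last exact: cg.
  apply: (@continuous_comp _ _ _ (fun t => t - th) (clamp de)); last exact: continuous_clampe.
  by apply: (@cvgB _ R^o); [exact: cvg_id|exact: cvg_cst].
- apply: (@cvgB _ R^o); last exact: cvg_cst.
  apply: (@continuous_comp _ _ _ (fun t => Num.max t (th + de)) f); last exact: cf.
  by apply: (@continuous_max _ _ id (cst (th + de))); [exact: cvg_id|exact: cvg_cst].
Qed.

(** On the interval the resampled path is a translate of [g] up to an additive constant. Its
    minimizer is therefore the left end plus a quantity that depends on [g] alone. *)
Lemma argmin_resample_mid th de f g : continuous f -> continuous g -> 0 < de ->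
  argmin th (th + de) (sample (resample th de f g)) = th + argmin 0 de (sample g).
Proof.
move=> cf cg de0; apply: argminE; first exact: continuous_resample.
  by lra.
have [/andP[s0 sd] hs hs1] := argminP cg de0.
set s := argmin 0 de (sample g) in s0 sd hs hs1 *.
have val t : 0 <= t <= de -> resample th de f g (th + t) = f th + (g t - g 0).
  move=> tde; rewrite resample_mid; first by congr (_ + (g _ - _)); lra.
  by case/andP: tde; lra.
have val' t : th <= t <= th + de -> resample th de f g t = f th + (g (t - th) - g 0).
  exact: resample_mid.
split; first by lra.
  move=> t tth; rewrite val ?s0// val'//.
  have : g s <= g (t - th) by apply: hs; lra.
  by lra.
move=> t tth; rewrite val ?s0// val'; last by lra.
have : g s < g (t - th) by apply: hs1; lra.
by lra.
Qed.

(** [f] varies little near [th] and [g] near 0; to the right of a short interval the resampled path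
    differs from [f] by a constant of the same size. *)
Lemma resample_close th f g (e : R) : continuous f -> continuous g -> 0 < e ->
  exists2 d, 0 < d & forall de, 0 <= de < d ->
    forall t, `|resample th de f g t - f t| <= e.
Proof.
move=> cf cg e0; have e20 : 0 < e / 2 by lra.
have [d1 d10 h1] := continuousP_dist (@cf th) e20.
have [d2 d20 h2] := continuousP_dist (@cg 0) e20.
exists (Num.min d1 d2); first by rewrite lt_min d10.
move=> de; rewrite lt_min => /andP[de0 /andP[de1 de2]] t.
have hf x : th <= x <= th + de -> `|f x - f th| < e / 2.
  by move=> xth; apply: h1; rewrite ger0_norm; lra.
have hg x : 0 <= x <= de -> `|g x - g 0| < e / 2.
  by move=> xde; apply: h2; rewrite subr0 ger0_norm; lra.
have [tl|tl] := leP t th.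
  by rewrite resample_left// subrr normr0 ltW.
have [tr|tr] := leP t (th + de).
  rewrite resample_mid; last by rewrite (ltW tl).
  have := hf t; rewrite (ltW tl) tr => /(_ isT); rewrite ltr_norml => /andP[f1 f2].
  have : `|g (t - th) - g 0| < e / 2 by apply: hg; lra.
  by rewrite ltr_norml => /andP[g1 g2]; rewrite ler_norml; lra.
rewrite resample_right//; last exact: ltW.
have := hf (th + de); rewrite lexx andbT lerDl de0 => /(_ isT).
rewrite ltr_norml => /andP[f1 f2].
have : `|g de - g 0| < e / 2 by apply: hg; rewrite de0 lexx.
by rewrite ltr_norml => /andP[g1 g2]; rewrite ler_norml; lra.
Qed.

Lemma strict_min_gap p q f s r : continuous f ->
  (forall t, p <= t <= q -> t != s -> f s < f t) -> 0 < r ->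
  exists2 c, 0 < c & forall t, p <= t <= q -> r <= `|t - s| -> f s + c <= f t.
Proof.
move=> cf hs r0.
have gap a b : p <= a -> b <= q -> (forall t, a <= t <= b -> t != s) ->
    exists2 c, 0 < c & forall t, a <= t <= b -> f s + c <= f t.
  move=> pa bq hab; have [ab|ba] := leP a b; last first.
    by exists 1 => // t /andP[/le_trans h /h]; rewrite leNgt ba.
  have [m mab hm] := EVT_min ab (continuous_subspaceT cf).
  move: mab; rewrite in_itv/= => mab.
  exists (f m - f s).
    rewrite subr_gt0; apply: hs; last exact: hab.
    by case/andP: mab; lra.
  by move=> t tab; rewrite subrKC; apply: hm; rewrite in_itv.
have [|t /andP[_]|c1 c10 h1] := gap p (Num.min q (s - r)) (lexx p).
- by rewrite ge_min lexx.
- by rewrite le_min => /andP[_ ts]; rewrite lt_eqF//; lra.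
have [|t /andP[]|c2 c20 h2] := gap (Num.max p (s + r)) q _ (lexx q).
- by rewrite le_max lexx.
- by rewrite ge_max => /andP[_ ts] _; rewrite gt_eqF//; lra.
exists (Num.min c1 c2); first by rewrite lt_min c10.
move=> t /andP[pt tq]; rewrite ler_normr => /orP[rt|rt].
  apply: (@le_trans _ _ (f s + c2)); first by rewrite lerD2l ge_min lexx orbT.
  by apply: h2; rewrite ge_max pt tq andbT; lra.
apply: (@le_trans _ _ (f s + c1)); first by rewrite lerD2l ge_min lexx.
by apply: h1; rewrite le_min pt tq; lra.
Qed.

(** A point at distance at least [r] from [s] lies above [f s] by a gap [c], which a perturbation of
    size [c / 3] cannot close. A nearer point is on the same side of the resampled interval as [s],
    by the choice [r = |th - s| / 2], and there only a common constant is added. *)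
Lemma argmin_resample_stable p q f g s th : continuous f -> continuous g ->
  p < q -> p <= s <= q -> (forall t, p <= t <= q -> t != s -> f s < f t) -> th != s ->
  exists2 d, 0 < d & forall de, 0 <= de < d ->
    argmin p q (sample (resample th de f g)) = s.
Proof.
move=> cf cg pq spq hs ths.
pose r := `|th - s| / 2.
have r0 : 0 < r by rewrite divr_gt0// normr_gt0 subr_eq0.
have [c c0 hc] := strict_min_gap cf hs r0.
have c30 : 0 < c / 3 by lra.
have [d d0 hd] := resample_close th cf cg c30.
exists (Num.min d r); first by rewrite lt_min d0.
move=> de; rewrite lt_min => /andP[de0 /andP[ded der]].
have cl := hd de; rewrite de0 ded in cl; have {}cl := cl isT.
have ch : continuous (resample th de f g) by exact: continuous_resample.
have [s'pq hs' _] := argminP ch pq.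
set s' := argmin _ _ _ in s'pq hs' *.
apply/eqP/negPn/negP => s's.
have {}hs' := hs' s spq.
have [far|near_] := leP r `|s' - s|.
  have := hc s' s'pq far.
  have := cl s'; have := cl s; rewrite !ler_norml => /andP[? ?] /andP[? ?].
  by lra.
have lt := hs s' s'pq s's.
move: near_; rewrite ltr_norml => /andP[n1 n2].
have [sth|ths'] := ltP s th.
  have rE : r = (th - s) / 2 by rewrite /r gtr0_norm// subr_gt0.
  move: hs'; rewrite !resample_left//; by lra.
have ths1 : th < s by rewrite lt_neqAle ths.
have rE : r = (s - th) / 2 by rewrite /r ltr0_norm ?subr_lt0// opprB.
by move: hs'; rewrite !resample_right//; lra.
Qed.

Lemma local_min_resample th de f g s : 0 <= de -> s < th \/ th + de < s ->
  local_minimizers (resample th de f g) s -> local_minimizers f s.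
Proof.
move=> de0 hs [s01 [e e0 he]]; split => //.
case: hs => hs.
  exists (Num.min e (th - s)); first by rewrite lt_min e0 subr_gt0.
  move=> t ht; have tth : t <= th.
    case: ht => /=; rewrite in_itv/=; first by lra.
    by move=> /andP[_]; rewrite -ltrBlDl lt_min => /andP[]; lra.
  have := he t; rewrite !resample_left ?(ltW hs)//; apply.
  case: ht => /=; rewrite in_itv/= => /andP[h1 h2]; [left|right] => /=; rewrite in_itv/=.
    rewrite h2 andbT; apply: le_lt_trans h1; rewrite lerD2l lerN2 ge_min lexx//.
  by rewrite h1; apply: (lt_le_trans h2); rewrite lerD2l ge_min lexx.
exists (Num.min e (s - (th + de))); first by rewrite lt_min e0 subr_gt0.
move=> t ht; have tth : th + de <= t.
  case: ht => /=; rewrite in_itv/=; last by lra.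
  by move=> /andP[+ _]; rewrite ltrBlDl -ltrBlDr lt_min => /andP[]; lra.
have := he t; rewrite !resample_right ?(ltW hs)// ltrD2r; apply.
case: ht => /=; rewrite in_itv/= => /andP[h1 h2]; [left|right] => /=; rewrite in_itv/=.
  rewrite h2 andbT; apply: le_lt_trans h1; rewrite lerD2l lerN2 ge_min lexx//.
by rewrite h1; apply: (lt_le_trans h2); rewrite lerD2l ge_min lexx.
Qed.

End paths.

(** * Enumeration of the local minimizers of a path by rational intervals *)

Section points.
Context (R : realType).
Implicit Types (f : R -> R) (p q s t : R).

Definition strictmin p q f s := p < s < q /\
  forall t, p <= t <= q -> t != s -> f s < f t.

(** What is used of a single Brownian path. Rational end points suffice, because every local
    minimizer is the strict minimizer of some rational interval. *)
Definition good f := continuous f /\ forall i j : nat,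
  0 <= qn R i -> qn R i < qn R j -> qn R j <= 1 -> exists s, strictmin (qn R i) (qn R j) f s.

Lemma strictmin_argmin p q f s : continuous f -> strictmin p q f s ->
  argmin p q (sample f) = s.
Proof.
move=> cf [/andP[ps sq] h]; apply: argminE => //; first exact: lt_trans sq.
by apply: is_argmin_strict => //; rewrite !ltW.
Qed.

Lemma strictmin_local p q f s : 0 <= p -> q <= 1 -> strictmin p q f s ->
  local_minimizers f s.
Proof.
move=> p0 q1 [/andP[ps sq] h]; split; first by lra.
exists (Num.min (s - p) (q - s)); first by rewrite lt_min; lra.
have h1 : Num.min (s - p) (q - s) <= s - p by rewrite ge_min lexx.
have h2 : Num.min (s - p) (q - s) <= q - s by rewrite ge_min lexx orbT.
move=> t [] /=; rewrite in_itv/= => /andP[t1 t2]; apply: h.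
- by lra.
- by rewrite lt_eqF.
- by lra.
- by rewrite gt_eqF.
Qed.

Definition itv_index (l : nat) : nat * nat := odflt (0%N, 0%N) (unpickle l).

Definition valid_itv (ij : nat * nat) :=
  [&& 0 <= qn R ij.1, qn R ij.1 < qn R ij.2 & qn R ij.2 <= 1].

(** Indices that code no admissible interval are sent to [[0, 1]], so that every index names a
    nondegenerate interval with rational end points. *)
Definition lo l := if valid_itv (itv_index l) then qn R (itv_index l).1 else 0.
Definition hi l := if valid_itv (itv_index l) then qn R (itv_index l).2 else 1.

Lemma lo_hi l : [/\ 0 <= lo l, lo l < hi l & hi l <= 1].
Proof. by rewrite /lo /hi; case: ifP => // /and3P[]. Qed.

Lemma lo_hi_rat l : exists i j, lo l = qn R i /\ hi l = qn R j.
Proof.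
rewrite /lo /hi; case: ifP => _; first by exists (itv_index l).1, (itv_index l).2.
have [i hi0] := qn_rat R 0%Q; have [j hj] := qn_rat R 1%Q.
by exists i, j; rewrite hi0 hj rmorph0 rmorph1.
Qed.

Lemma lo_hi_surj i j : 0 <= qn R i -> qn R i < qn R j -> qn R j <= 1 ->
  exists l, lo l = qn R i /\ hi l = qn R j.
Proof.
move=> h1 h2 h3; exists (pickle (i, j)).
by rewrite /lo /hi /itv_index pickleK/= /valid_itv/= h1 h2 h3.
Qed.

Definition pt l (g : seqsp R) : mI01 R := to01 (argmin (lo l) (hi l) g).

Lemma good_pt f l : good f -> exists2 s, strictmin (lo l) (hi l) f s &
  I01val (pt l (sample f)) = s.
Proof.
move=> [cf gf]; have [i [j [li hj]]] := lo_hi_rat l.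
have [l0 lh h1] := lo_hi l.
have [s sP] : exists s, strictmin (lo l) (hi l) f s.
  by rewrite li hj; apply: gf; rewrite -?li -?hj.
exists s => //; rewrite /pt (strictmin_argmin cf sP) to01K//.
by case: sP => /andP[]; lra.
Qed.

Lemma good_pt_local f l : good f -> local_minimizers f (I01val (pt l (sample f))).
Proof.
move=> gf; have [s sP ->] := good_pt l gf; have [l0 _ h1] := lo_hi l.
exact: strictmin_local sP.
Qed.

Lemma local_min_strict f s : local_minimizers f s ->
  exists2 e, 0 < e & (0 <= s - e /\ s + e <= 1) /\
    forall t, `|t - s| < e -> t != s -> f s < f t.
Proof.
move=> [s01 [e e0 he]]; exists (Num.min e (Num.min s (1 - s))).
  by rewrite !lt_min e0; lra.
have h0 : Num.min e (Num.min s (1 - s)) <= e by rewrite ge_min lexx.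
have h1 : Num.min e (Num.min s (1 - s)) <= s by rewrite !ge_min lexx orbT.
have h2 : Num.min e (Num.min s (1 - s)) <= 1 - s by rewrite !ge_min lexx !orbT.
split; first by lra.
move=> t; rewrite ltr_norml => /andP[t1 t2]; rewrite neq_lt => /orP[ts|ts]; apply: he.
  by left => /=; rewrite in_itv/= ts andbT; lra.
by right => /=; rewrite in_itv/= ts/=; lra.
Qed.

(** A local minimizer is the strict minimizer of a rational interval close around it. So [pt]
    enumerates all local minimizers, with repetitions. *)
Lemma good_pt_surj f s : continuous f -> local_minimizers f s ->
  exists l, I01val (pt l (sample f)) = s.
Proof.
move=> cf /[dup] -[s01 _] /local_min_strict[e e0 [[e1 e2] he]].
have [i /andP[i1 i2]] : exists i, s - e < qn R i < s by apply: qn_dense; lra.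
have [j /andP[j1 j2]] : exists j, s < qn R j < s + e by apply: qn_dense; lra.
have [l [li lj]] : exists l, lo l = qn R i /\ hi l = qn R j.
  by apply: lo_hi_surj; lra.
exists l; rewrite /pt (_ : argmin _ _ _ = s) ?to01K//.
apply: strictmin_argmin => //; rewrite li lj; split; first by rewrite i2.
move=> t /andP[t1 t2]; apply: he; rewrite ltr_norml; lra.
Qed.

(** Of the two outer thirds of an interval, one misses a given point. *)
Lemma avoid_finite (y : nat -> R) m p q : p < q -> exists p' q',
  [/\ p <= p', p' < q', q' <= q & forall i, (i < m)%N -> ~ (p' <= y i <= q')].
Proof.
move=> pq; elim: m => [|m [p' [q' [h1 h2 h3 h4]]]]; first by exists p, q; split.
have [ym|ym] := leP (y m) ((p' + q') / 2).
  exists ((p' + 2 * q') / 3), q'; split; [lra|lra|lra|].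
  move=> i; rewrite ltnS leq_eqVlt => /orP[/eqP ->|/h4 h]; first by lra.
  by move=> hy; apply: h; lra.
exists p', ((2 * p' + q') / 3); split; [lra|lra|lra|].
move=> i; rewrite ltnS leq_eqVlt => /orP[/eqP ->|/h4 h]; first by lra.
by move=> hy; apply: h; lra.
Qed.

Lemma good_pt_in f p q : good f -> 0 <= p -> p < q -> q <= 1 ->
  exists l, p < I01val (pt l (sample f)) < q.
Proof.
move=> gf p0 pq q1.
have [i /andP[i1 i2]] := qn_dense pq.
have [j /andP[j1 j2]] := qn_dense i2.
have [l [li lj]] : exists l, lo l = qn R i /\ hi l = qn R j.
  by apply: lo_hi_surj; lra.
exists l; have [s [+ _] ->] := good_pt l gf.
by rewrite li lj => /andP[]; lra.
Qed.

Lemma good_dense f : good f -> `]0, 1[ `<=` closure (local_minimizers f).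
Proof.
move=> gf x /=; rewrite in_itv/= => /andP[x0 x1] B /nbhs_ballP[e /= e0 xB].
have [l /andP[l1 l2]] : exists l, Num.max 0 (x - e) < I01val (pt l (sample f)) < x.
  apply: good_pt_in => //; rewrite ?le_max ?lexx// ?gt_max; lra.
exists (I01val (pt l (sample f))); split; first exact: good_pt_local.
apply: xB; rewrite /ball/= gtr0_norm ?subr_gt0//.
by move: l1; rewrite gt_max => /andP[_]; lra.
Qed.

Definition fresh m (g : seqsp R) (y : seqsp (mI01 R)) l :=
  forall i, (i < m)%N -> pt l g <> y i.

(** The least fresh index is taken, which forces every minimizer to be used sooner or later. The
    value [pt 0 g] is reached only when no index is fresh, which does not happen for a good path. *)
Definition next_pt m (g : seqsp R) (y : seqsp (mI01 R)) : mI01 R :=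
  if pselect (exists l, `[< fresh m g y l >]) is left h then pt (ex_minn h) g
  else pt 0 g.

Lemma next_ptE m g y l : fresh m g y l -> (forall k, (k < l)%N -> ~ fresh m g y k) ->
  next_pt m g y = pt l g.
Proof.
move=> fl hl; rewrite /next_pt; case: pselect => [h|]; last first.
  by case; exists l; apply/asboolP.
case: ex_minnP => k /asboolP fk hk; congr pt; apply/eqP.
rewrite eqn_leq hk ?andTb; last exact/asboolP.
by rewrite leqNgt; apply/negP => /hl.
Qed.

Lemma next_ptP m g y : (exists l, fresh m g y l) -> exists l,
  [/\ fresh m g y l, forall k, (k < l)%N -> ~ fresh m g y k & next_pt m g y = pt l g].
Proof.
move=> [l0 f0]; have h : exists l, `[< fresh m g y l >] by exists l0; apply/asboolP.
case: (ex_minnP h) => l /asboolP fl hl.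
have hl' k : (k < l)%N -> ~ fresh m g y k.
  by move=> kl /asboolP /hl; rewrite leqNgt kl.
by exists l; split=> //; exact: next_ptE.
Qed.

Lemma good_fresh f m y : good f -> exists l, fresh m (sample f) y l.
Proof.
move=> gf; have [p [q [p0 pq q1 h]]] := avoid_finite (fun i => I01val (y i)) m (@ltr01 R).
have [l /andP[l1 l2]] := good_pt_in gf p0 pq q1.
exists l => i /h + lE; rewrite -lE; apply; by rewrite !ltW.
Qed.

Lemma good_next_pt f m y : good f ->
  local_minimizers f (I01val (next_pt m (sample f) y)) /\
  forall i, (i < m)%N -> next_pt m (sample f) y <> y i.
Proof.
move=> gf; have [l [fl _ ->]] := next_ptP (good_fresh m y gf).
by split => //; exact: good_pt_local.
Qed.

(** Either index [k] was already used, or it is the least fresh one and its point is the one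
    inserted. The sequence [z] may list the points in any order, since they will be shuffled. *)
Lemma next_pt_covers f m y k : good f -> (forall l, (l < k)%N -> ~ fresh m (sample f) y l) ->
  forall z : seqsp (mI01 R), (exists2 i, (i < m.+1)%N & z i = next_pt m (sample f) y) ->
  (forall i, (i < m)%N -> exists2 j, (j < m.+1)%N & z j = y i) ->
  forall l, (l < k.+1)%N -> ~ fresh m.+1 (sample f) z l.
Proof.
move=> gf hk z [i0 i0m zi0] zy l lk fl.
have [l0 [fl0 hl0 nE]] := next_ptP (good_fresh m y gf).
have fly : fresh m (sample f) y l.
  by move=> i im ptE; have [j jm zj] := zy i im; apply: (fl j) => //; rewrite zj.
have kl : (k <= l)%N by rewrite leqNgt; apply/negP => /hk.
have {kl lk} lE : l = k by apply/eqP; rewrite eqn_leq kl andbT.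
have l0E : l0 = l.
  apply/eqP; rewrite eqn_leq; apply/andP; split.
    by rewrite leqNgt; apply/negP => /hl0.
  by rewrite leqNgt; apply/negP; rewrite lE => /hk.
by apply: (fl i0) => //; rewrite zi0 nE l0E.
Qed.

Lemma measurable_pt l : measurable_fun setT (pt l).
Proof.
apply: (measurableT_comp (@measurable_to01 R)).
apply: measurable_argmin; [exact: measurable_cst..|exact: measurable_id|].
by move=> _; have [_ /ltW] := lo_hi l.
Qed.

Lemma measurable_set_eqI01 d (T : measurableType d) (f g : T -> mI01 R) :
  measurable_fun setT f -> measurable_fun setT g -> measurable [set x | f x = g x].
Proof.
move=> mf mg.
rewrite (_ : [set x | _] = [set x | I01val (f x) = I01val (g x)]).
  by apply: measurable_set_eq; apply: (measurableT_comp (@measurable_I01val R)).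
by apply/seteqP; split => x /=; [move=> ->|exact: I01val_inj].
Qed.

Lemma measurable_next_pt m d (T : measurableType d) (g : T -> seqsp R)
    (y : T -> seqsp (mI01 R)) : measurable_fun setT g -> measurable_fun setT y ->
  measurable_fun setT (fun x => next_pt m (g x) (y x)).
Proof.
move=> mg my.
have mpt l : measurable_fun setT (fun x => pt l (g x)).
  exact: (measurableT_comp (measurable_pt l) mg).
have mfresh l : measurable [set x | fresh m (g x) (y x) l].
  apply: measurable_set_forall => i; apply: measurable_set_imp.
    exact: measurable_set_const.
  apply: measurable_set_not; apply: measurable_set_eqI01 => //.
  exact: (measurableT_comp (@measurable_coord _ (mI01 R) i) my).
(* Case 0 is the absence of a fresh index; case [l.+1] means that [l] is the least fresh index. *)
pose D n := if n is l.+1 then [set x | fresh m (g x) (y x) l /\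
    forall k, (k < l)%N -> ~ fresh m (g x) (y x) k]
  else [set x | ~ exists l, fresh m (g x) (y x) l].
pose F n x := if n is l.+1 then pt l (g x) else pt 0 (g x).
apply: (@measurable_fun_case_nat _ _ _ _ D F).
- case=> [|l] /=.
    by apply: measurable_set_not; exact: measurable_set_exists.
  apply: (measurable_set_and (mfresh l)).
  apply: (@measurable_set_forall _ _ (fun k x => (k < l)%N -> ~ fresh m (g x) (y x) k)) => k.
  exact: (measurable_set_imp (measurable_set_const _ _) (measurable_set_not (mfresh k))).
- by case=> [|l]; exact: mpt.
- move=> x; have [h|h] := pselect (exists l, fresh m (g x) (y x) l); last by exists 0%N.
  by have [l [h1 h2 _]] := next_ptP h; exists l.+1.
- case=> [|l] x /=.
    move=> h; rewrite /next_pt; case: pselect => // h'; exfalso; apply: h.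
    by case: h' => l /asboolP fl; exists l.
  by move=> [h1 h2]; exact: next_ptE.
Qed.

Lemma near_forall_lt (k : nat) (P : nat -> nat -> Prop) :
  (forall i, (i < k)%N -> \forall n \near \oo, P i n) ->
  \forall n \near \oo, forall i, (i < k)%N -> P i n.
Proof.
elim: k => [_|k ih h]; first exact: nearW.
have h1 := h k (ltnSn k).
have h2 : \forall n \near \oo, forall i, (i < k)%N -> P i n.
  by apply: ih => i ik; apply: h; rewrite ltnS ltnW.
near=> n => i; rewrite ltnS leq_eqVlt => /orP[/eqP ->|ik].
  by near: n.
by move: i ik; near: n.
Unshelve. all: by end_near. Qed.

(** If [l] is the least fresh index, the choice depends on [pt 0, ..., pt l] and on the first [m]
    coordinates only: finitely many quantities, all eventually constant. *)
Lemma next_pt_stable m (g_ : nat -> seqsp R) (y_ : nat -> seqsp (mI01 R)) g y :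
  (forall l, \forall n \near \oo, pt l (g_ n) = pt l g) ->
  (forall i, (i < m)%N -> \forall n \near \oo, y_ n i = y i) ->
  (exists l, fresh m g y l) ->
  \forall n \near \oo, next_pt m (g_ n) (y_ n) = next_pt m g y.
Proof.
move=> hg hy /next_ptP[l [fl hl ->]].
have h1 := @near_forall_lt l.+1 _ (fun i _ => hg i).
have h2 := near_forall_lt hy.
near=> n.
have e1 : forall i, (i < l.+1)%N -> pt i (g_ n) = pt i g by near: n.
have e2 : forall i, (i < m)%N -> y_ n i = y i by near: n.
rewrite -(e1 l (ltnSn l)); apply: next_ptE.
  by move=> i im; rewrite e1// e2//; exact: fl.
move=> k kl fk; apply: (hl k kl) => i im.
by rewrite -e2// -e1 ?ltnS 1?ltnW//; exact: fk.
Unshelve. all: by end_near. Qed.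

End points.

Lemma clamp01 (R : realType) (t : R) : 0 <= clamp 1 t <= 1.
Proof. by rewrite /clamp le_min ge_min le_max lexx orbT ler01 lexx orbT. Qed.

Lemma clamp_id (R : realType) (t : R) : 0 <= t <= 1 -> clamp 1 t = t.
Proof. by move=> /andP[t0 t1]; rewrite /clamp max_l// min_l. Qed.

Lemma clamp_idem (R : realType) (t : R) : clamp 1 (clamp 1 t) = clamp 1 t.
Proof. exact: clamp_id (clamp01 t). Qed.

(** * Laws of processes with independent Gaussian increments *)

Lemma seqsp_law_unique d d1 d2 (E : measurableType d) (S1 : measurableType d1)
    (S2 : measurableType d2) (R : realType) (P1 : probability S1 R)
    (P2 : probability S2 R) (F1 : S1 -> seqsp E) (F2 : S2 -> seqsp E) :
  measurable_fun setT F1 -> measurable_fun setT F2 ->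
  (forall n A, (forall i, measurable (A i)) ->
    P1 (F1 @^-1` box n A) = P2 (F2 @^-1` box n A)) ->
  forall C, measurable C -> P1 (F1 @^-1` C) = P2 (F2 @^-1` C).
Proof.
move=> m1 m2 h C mC.
pose g1 : {mfun S1 >-> seqsp E} := HB.pack F1 (isMeasurableFun.Build _ _ _ _ _ m1).
pose g2 : {mfun S2 >-> seqsp E} := HB.pack F2 (isMeasurableFun.Build _ _ _ _ _ m2).
have oo : (distribution P1 g1 setT < +oo)%E by rewrite probability_setT ltry.
exact: (@seqsp_measure_unique _ E R (distribution P1 g1) (distribution P2 g2) oo h C mC).
Qed.

Section gaussian_increments.
Context (R : realType).

Definition grid n (t : nat -> R) :=
  [/\ 0 <= t 0%N, t n <= 1 & forall i, (i < n)%N -> t i < t i.+1].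

(** [F] lists times that the grid has to contain. For a resampled path these are [th] and [th + de],
    where its definition changes; refining a grid by finitely many times loses nothing. *)
Definition gaussian_increments d (S : measurableType d) (mu : probability S R)
    (Z : S -> R -> R) (F : seq R) :=
  forall n t, grid n t -> (forall x, x \in F -> exists2 i, (i <= n)%N & t i = x) ->
  forall A : nat -> set R, (forall i, measurable (A i)) ->
    mu [set w | forall i, (i < n)%N -> A i (Z w (t i.+1) - Z w (t i))] =
    (\prod_(i < n) normal_prob 0 (Num.sqrt (t i.+1 - t i)) (A i))%E.

Lemma grid_lt n t i j : grid n t -> (i < j)%N -> (j <= n)%N -> t i < t j.
Proof.
move=> [_ _ h]; elim: j => // j ih; rewrite ltnS leq_eqVlt => /orP[/eqP ->|ij] jn.
  exact: h.
by apply: lt_trans (h _ jn); apply: ih => //; exact: ltnW.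
Qed.

Lemma grid_le n t i j : grid n t -> (i <= j)%N -> (j <= n)%N -> t i <= t j.
Proof.
move=> gt; rewrite leq_eqVlt => /orP[/eqP ->//|ij] jn.
by apply: ltW; exact: grid_lt gt ij jn.
Qed.

Lemma grid_exists (s : seq R) : (forall x, x \in s -> 0 <= x <= 1) ->
  exists n t, [/\ grid n t, t 0%N = 0 &
    forall x, x \in s -> exists2 i, (i <= n)%N & t i = x].
Proof.
move=> hs; pose L := sort <=%R (undup (0 :: s)).
have mL x : (x \in L) = (x \in 0 :: s) by rewrite mem_sort mem_undup.
have L01 x : x \in L -> 0 <= x <= 1.
  by rewrite mL inE => /orP[/eqP ->|/hs //]; rewrite lexx ler01.
have sL : sorted <%R L.
  by rewrite lt_sorted_uniq_le sort_uniq undup_uniq sort_le_sorted.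
have L0 : (0 < size L)%N.
  by rewrite -has_predT; apply/hasP; exists 0; rewrite // mL inE eqxx.
have inL i : (i < size L)%N -> nth 0 L i \in L by exact: mem_nth.
have t00 : nth 0 L 0 = 0.
  have : 0 \in L by rewrite mL inE eqxx.
  move=> /(nthP 0)[i iL Li].
  apply/le_anti; case/andP: (L01 _ (inL _ L0)) => -> _; rewrite andbT -[leRHS]Li.
  by apply: (sorted_leq_nth le_trans (lexx (T := R))); rewrite ?inE// sort_le_sorted.
exists (size L).-1, (nth 0 L); split=> //.
- split; first by rewrite t00.
    have /andP[] := L01 _ (inL (size L).-1 ltac:(by rewrite prednK)); by [].
  move=> i iL; apply: (sorted_ltn_nth lt_trans 0 sL); rewrite ?inE//.
    by rewrite (leq_trans iL)// leq_pred.
  by rewrite -ltn_predRL.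
- move=> x xs; have : x \in L by rewrite mL inE xs orbT.
  by move=> /(nthP 0)[i iL <-]; exists i => //; rewrite -ltnS prednK.
Qed.

(** A box concerns the values at finitely many times. Along a grid that contains 0, [F] and the
    clamped times, these values are sums of increments, whose joint law is prescribed. *)
Lemma gaussian_law_unique d1 d2 (S1 : measurableType d1) (S2 : measurableType d2)
    (mu : probability S1 R) (nu : probability S2 R) (Z1 : S1 -> R -> R)
    (Z2 : S2 -> R -> R) (F : seq R) :
  (forall x, x \in F -> 0 <= x <= 1) ->
  (forall t, measurable_fun setT (Z1 ^~ t)) -> (forall t, measurable_fun setT (Z2 ^~ t)) ->
  (forall w, Z1 w 0 = 0) -> (forall w, Z2 w 0 = 0) ->
  (forall w t, Z1 w t = Z1 w (clamp 1 t)) -> (forall w t, Z2 w t = Z2 w (clamp 1 t)) ->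
  gaussian_increments mu Z1 F -> gaussian_increments nu Z2 F ->
  forall C, measurable C ->
    mu [set w | C (sample (Z1 w))] = nu [set w | C (sample (Z2 w))].
Proof.
move=> hF m1 m2 z1 z2 c1 c2 g1 g2.
have mS d (S : measurableType d) (Z : S -> R -> R) :
    (forall t, measurable_fun setT (Z ^~ t)) -> measurable_fun setT (fun w => sample (Z w)).
  by move=> mZ; apply: measurable_fun_seqP => i; exact: mZ.
apply: (seqsp_law_unique (F1 := fun w => sample (Z1 w)) (F2 := fun w => sample (Z2 w))).
- exact: mS.
- exact: mS.
move=> N A mA.
have [|n [t [gt t0 ht]]] := @grid_exists (F ++ [seq clamp 1 (qn R k) | k <- iota 0 N]).
  move=> x; rewrite mem_cat => /orP[/hF//|/mapP[k _ ->]].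
  by rewrite /clamp le_min ge_min le_max lexx orbT ler01 lexx orbT.
have [idx hidx] : exists idx : nat -> nat, forall k, (k < N)%N ->
    (idx k <= n)%N /\ t (idx k) = clamp 1 (qn R k).
  have h k : exists i, (k < N)%N -> (i <= n)%N /\ t i = clamp 1 (qn R k).
    have [kN|_] := ltnP k N; last by exists 0%N.
    have [i i1 i2] := ht (clamp 1 (qn R k)) ltac:(by rewrite mem_cat; apply/orP; right; apply/mapP; exists k; rewrite // mem_iota).
    by exists i.
  by exists (fun k => sval (cid (h k))) => k; case: cid => i /=.
pose I d (S : measurableType d) (Z : S -> R -> R) (w : S) : seqsp R := fun i =>
  if (i < n)%N then Z w (t i.+1) - Z w (t i) else 0.
pose D : set (seqsp R) := [set xi : seqsp R | forall k, (k < N)%N -> A k (\sum_(i < idx k) xi i)].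
have mI d (S : measurableType d) (Z : S -> R -> R) :
    (forall t, measurable_fun setT (Z ^~ t)) -> measurable_fun setT (I _ S Z).
  move=> mZ; apply: measurable_fun_seqP => i; rewrite /I; case: (i < n)%N.
    exact: measurable_funB.
  exact: measurable_cst.
have mD : measurable D.
  apply: measurable_set_forall => k; apply: measurable_set_imp.
    exact: measurable_set_const.
  apply: (measurable_preimageT (f := fun xi : seqsp R => \sum_(i < idx k) xi i)) => //.
  by apply: measurable_sum => i; exact: measurable_coord.
have boxD d (S : measurableType d) (Z : S -> R -> R) :
   (forall w, Z w 0 = 0) -> (forall w t, Z w t = Z w (clamp 1 t)) ->
   (fun w => sample (Z w)) @^-1` box N A = I _ S Z @^-1` D.
  move=> z0 zc.
  have tele w j : (j <= n)%N -> \sum_(i < j) I _ S Z w i = Z w (t j).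
    elim: j => [_|j ih jn]; first by rewrite big_ord0 t0 z0.
    by rewrite big_ord_recr/= ih ?(ltnW jn)// /I jn subrKC.
  apply/seteqP; split => w /= h k kN; have [i1 i2] := hidx _ kN.
    by rewrite tele// i2 -zc; exact: h.
  by have := h k kN; rewrite tele// i2 -zc.
rewrite !boxD//.
apply: seqsp_law_unique => //; [exact: mI|exact: mI|].
move=> m B mB.
pose B' i := if (i < m)%N then B i else setT.
have boxB d (S : measurableType d) (Z : S -> R -> R) :
   I _ S Z @^-1` box m B = [set w | (forall i, (i < n)%N -> B' i (Z w (t i.+1) - Z w (t i)))
     /\ forall i, (n <= i < m)%N -> B i 0].
  apply/seteqP; split => w /=.
    move=> h; split => i.
      by move=> inn; rewrite /B'; case: ifP => // /h; rewrite /I inn.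
    by move=> /andP[ni /h]; rewrite /I ltnNge ni.
  move=> [h1 h2] i im; rewrite /I; case: ltnP => ni; last by apply: h2; rewrite ni.
  by have := h1 _ ni; rewrite /B' im.
have mB' i : measurable (B' i) by rewrite /B'; case: ifP.
have hF' x : x \in F -> exists2 i, (i <= n)%N & t i = x.
  by move=> xF; apply: ht; rewrite mem_cat xF.
rewrite !boxB.
(* The increments were extended by 0 beyond [n]. Constraints on these coordinates hold either for
   every [w], or for none, and then both events are empty. *)
have [c|c] := pselect (forall i, (n <= i < m)%N -> B i 0).
  rewrite (_ : [set w : S1 | _ /\ _] =
     [set w | forall i, (i < n)%N -> B' i (Z1 w (t i.+1) - Z1 w (t i))]); last first.
    by apply/seteqP; split => w /= => [[]|].
  rewrite (_ : [set w : S2 | _ /\ _] =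
     [set w | forall i, (i < n)%N -> B' i (Z2 w (t i.+1) - Z2 w (t i))]); last first.
    by apply/seteqP; split => w /= => [[]|].
  by rewrite g1// g2.
rewrite (_ : [set w : S1 | _ /\ _] = set0); last by apply/seteqP; split => w // [_ /c].
rewrite (_ : [set w : S2 | _ /\ _] = set0); last by apply/seteqP; split => w // [_ /c].
by rewrite !measure0.
Qed.

End gaussian_increments.

(** * Resampling preserves the law of the path *)

Section brownian_laws.
Context (R : realType) (d : measure_display) (T : measurableType d)
  (P : probability T R) (b : T -> R -> R).
Hypotheses (mb : forall t, measurable_fun setT (b ^~ t))
  (b0 : forall w, b w 0 = 0) (bc : forall w t, b w t = b w (clamp 1 t))
  (gb : gaussian_increments P b [::]).

Let Zres th de (z : T * T) := resample th de (b z.1) (b z.2).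

Let mZres th de t : measurable_fun setT (Zres th de ^~ t).
Proof.
have m1 s : measurable_fun setT (fun z : T * T => b z.1 s).
  exact: (measurableT_comp (mb s) measurable_fst).
have m2 s : measurable_fun setT (fun z : T * T => b z.2 s).
  exact: (measurableT_comp (mb s) measurable_snd).
rewrite /Zres /resample; apply: measurable_funD; last exact: measurable_funB.
by apply: measurable_funD => //; exact: measurable_funB.
Qed.

(** Let [a] and [c] be the indices of [th] and [th + de] in the grid. Increments outside [[a, c)]
    come from the first path, those inside from the second path along the grid shifted to start at
    0. So the event is the product of [E1] and [E2], where [E1] relaxes the inner constraints to
    [setT]. *)
Let gaussian_resample th de : 0 <= th -> 0 < de -> th + de <= 1 ->
  gaussian_increments (P \x P)%E (Zres th de) [:: th; th + de].
Proof.
move=> th0 de0 thde n t gt hF A mA.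
have [a an ta] := hF th ltac:(by rewrite inE eqxx).
have [c cn tc] := hF (th + de) ltac:(by rewrite !inE eqxx orbT).
have ac : (a < c)%N.
  rewrite ltnNge; apply/negP => ca; have := grid_le gt ca an.
  by rewrite ta tc; lra.
have lea i : (i < a)%N -> t i.+1 <= th by move=> ia; rewrite -ta; exact: grid_le gt ia an.
have lec i : (i < c)%N -> t i.+1 <= th + de.
  by move=> ic; rewrite -tc; exact: grid_le gt ic cn.
have gea i : (a <= i)%N -> (i <= n)%N -> th <= t i.
  by move=> ai inn; rewrite -ta; exact: grid_le gt ai inn.
have gec i : (c <= i)%N -> (i <= n)%N -> th + de <= t i.
  by move=> ai inn; rewrite -tc; exact: grid_le gt ai inn.
have lt1 i : (i < n)%N -> t i < t i.+1 by case: gt => _ _; apply.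
pose A1 i := if (a <= i < c)%N then setT else A i.
pose E1 := [set w | forall i, (i < n)%N -> A1 i (b w (t i.+1) - b w (t i))].
pose s j := t (a + j)%N - th.
pose E2 := [set w | forall j, (j < c - a)%N -> A (a + j)%N (b w (s j.+1) - b w (s j))].
have gs : grid (c - a) s.
  split; first by rewrite /s addn0 ta subrr.
    rewrite /s subnKC ?(ltnW ac)// tc addrC addKr.
    by lra.
  by move=> j jc; rewrite /s ltrD2r addnS; apply: lt1; rewrite (leq_trans _ cn)// -ltn_subRL.
have -> : [set w | forall i, (i < n)%N -> A i (Zres th de w (t i.+1) - Zres th de w (t i))] =
    E1 `*` E2.
  have incr1 w i : (i < n)%N -> ~~ (a <= i < c)%N ->
      Zres th de w (t i.+1) - Zres th de w (t i) = b w.1 (t i.+1) - b w.1 (t i).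
    move=> inn; rewrite negb_and -!leqNgt -ltnNge => /orP[ia|ci].
      have := lea _ ia; have := lt1 _ inn => h1 h2.
      by rewrite /Zres !resample_left// ?ltW//; lra.
    have h2 := gec _ ci (ltnW inn); have := lt1 _ inn => h1.
    by rewrite /Zres !resample_right//; lra.
  have incr2 w j : (j < c - a)%N ->
      Zres th de w (t (a + j).+1) - Zres th de w (t (a + j)%N) = b w.2 (s j.+1) - b w.2 (s j).
    move=> jc; have ajc : (a + j < c)%N by rewrite -ltn_subRL.
    have h1 := lt1 _ (leq_trans ajc cn); have h2 := lec _ ajc.
    have h3 := gea (a + j)%N (leq_addr _ _) (ltnW (leq_trans ajc cn)).
    rewrite /Zres !resample_mid; [|lra|lra].
    by rewrite /s addnS; lra.
  apply/seteqP; split => w /=.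
    move=> h; split.
      move=> i inn; rewrite /A1; case: ifPn => // ni.
      by rewrite -incr1//; exact: h.
    move=> j jc; rewrite -incr2//; apply: h.
    by rewrite (leq_trans _ cn)// -ltn_subRL.
  move=> [h1 h2] i inn; have := h1 _ inn; rewrite /A1; case: ifPn => ni.
    move=> _; move/andP: ni => [ai ic].
    have := h2 (i - a)%N; rewrite ltn_sub2r// => /(_ isT).
    by rewrite -incr2 ?ltn_sub2r// subnKC.
  by rewrite -incr1.
have mA1 i : measurable (A1 i) by rewrite /A1; case: ifP.
have mE1 : measurable E1.
  apply: measurable_set_forall => i; apply: measurable_set_imp.
    exact: measurable_set_const.
  apply: (measurable_preimageT (f := fun w => b w (t i.+1) - b w (t i))) => //.
  exact: measurable_funB.
have mE2 : measurable E2.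
  apply: measurable_set_forall => i; apply: measurable_set_imp.
    exact: measurable_set_const.
  apply: (measurable_preimageT (f := fun w => b w (s i.+1) - b w (s i))) => //.
  exact: measurable_funB.
rewrite [LHS]product_measure1E//.
pose nn i B := normal_prob 0 (Num.sqrt (t i.+1 - t i)) B.
have ordE (F : nat -> \bar R) : (\prod_(i < n) F i = \prod_(0 <= i < n) F i)%E.
  by rewrite big_mkord.
transitivity ((\prod_(i < n) nn i (A1 i)) *
   (\prod_(j < c - a) normal_prob 0 (Num.sqrt (s j.+1 - s j)) (A (a + j)%N)))%E.
  by congr (_ * _)%E; [exact: (gb gt _ mA1)|exact: (gb gs _ (fun j => mA (a + j)%N))].
rewrite [in LHS](ordE (fun i => nn i (A1 i))).
rewrite [RHS](ordE (fun i => nn i (A i))).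
rewrite (big_cat_nat _ (n := a))//= [in RHS](big_cat_nat _ (n := a))//= -muleA.
congr (_ * _)%E.
  rewrite big_nat_cond [in RHS]big_nat_cond; apply: eq_bigr => i /andP[/andP[_ ia] _].
  by rewrite /A1 leqNgt ia.
rewrite (big_cat_nat _ (n := c))//= ?(ltnW ac)// [in RHS](big_cat_nat _ (n := c))//= ?(ltnW ac)//.
rewrite [X in (X * _ * _)%E](_ : _ = 1%E); last first.
  rewrite big_nat_cond big1// => i /andP[ic _]; rewrite /A1 ic.
  exact: probability_setT.
rewrite mul1e muleC; congr (_ * _)%E.
  have -> : (\prod_(a <= i < c) nn i (A i) =
      \prod_(0 <= j < c - a) nn (j + a)%N (A (j + a)%N))%E.
    by rewrite -{1}(add0n a) big_addn.
  rewrite big_mkord; apply: eq_bigr => j _.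
  have -> : s j.+1 - s j = t (j + a).+1 - t (j + a)%N.
    by rewrite /s addnS [(j + a)%N]addnC; lra.
  by rewrite [(j + a)%N]addnC.
rewrite big_nat_cond [in RHS]big_nat_cond; apply: eq_bigr => i /andP[/andP[ci _] _].
by rewrite /A1 [(i < c)%N]ltnNge ci andbF.
Qed.

Lemma resample_law th de (C : set (seqsp R)) : 0 <= th -> 0 < de -> th + de <= 1 ->
  measurable C ->
  P [set w | C (sample (b w))] =
  (P \x P)%E [set z | C (sample (resample th de (b z.1) (b z.2)))].
Proof.
move=> th0 de0 thde; apply: (@gaussian_law_unique _ _ _ _ _ P (P \x P)%E b (Zres th de)
  [:: th; th + de]) => //.
- by move=> x; rewrite !inE => /orP[] /eqP ->; lra.
- by move=> w; rewrite /Zres resample_left// ltW.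
- move=> w t; rewrite /Zres.
  have [t0|t0] := leP t 0.
    rewrite [clamp 1 t](_ : _ = 0) ?resample_left ?(ltW de0)//.
    + by rewrite bc /clamp (max_r t0) min_l.
    + exact: le_trans t0 th0.
    + by rewrite /clamp (max_r t0) min_l.
  have [t1|t1] := leP t 1.
    by rewrite [clamp 1 t](_ : _ = t)// /clamp (max_l (ltW t0)) min_l.
  rewrite [clamp 1 t](_ : _ = 1); last by rewrite /clamp (max_l (ltW t0)) min_r// ltW.
  have tde : th + de <= t by lra.
  rewrite (resample_right _ _ (ltW de0) tde) (resample_right _ _ (ltW de0) thde).
  by rewrite bc /clamp (max_l (ltW t0)) min_r// ltW.
- by move=> n t gt _ A mA; apply: gb.
- exact: gaussian_resample.
Qed.

End brownian_laws.

(** * Time reversal *)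

Section brownian_reversal.
Context (R : realType) (d : measure_display) (T : measurableType d)
  (P : probability T R) (b : T -> R -> R).
Hypotheses (mb : forall t, measurable_fun setT (b ^~ t))
  (b0 : forall w, b w 0 = 0) (bc : forall w t, b w t = b w (clamp 1 t))
  (gb : gaussian_increments P b [::]).

(** Reversal negates the increments and lists them backwards; the normal law is symmetric. It will
    turn a minimum at a left end point into one at a right end point. *)
Lemma reversed_law (C : set (seqsp R)) : measurable C ->
  P [set w | C (sample (b w))] =
  P [set w | C (sample (fun t => b w (1 - clamp 1 t) - b w 1))].
Proof.
apply: (@gaussian_law_unique _ _ _ _ _ P P b _ [::]) => //.
- by move=> t; exact: measurable_funB.
- by move=> w; rewrite /clamp maxxx min_l// subr0 subrr.
- move=> w t; by rewrite clamp_idem.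
move=> n t gt _ A mA.
have t01 i : (i <= n)%N -> 0 <= t i <= 1.
  move=> inn; have [h0 h1 _] := gt.
  by rewrite (le_trans h0 (grid_le gt (leq0n i) inn)) (le_trans (grid_le gt inn (leqnn n)) h1).
have cl i : (i <= n)%N -> clamp 1 (t i) = t i.
  by move=> /t01/andP[h0 h1]; rewrite /clamp max_l// min_l.
pose s j := 1 - t (n - j)%N.
have gs : grid n s.
  have [h0 h1 h2] := gt.
  split; rewrite /s ?subn0 ?subnn; [lra|lra|].
  move=> i inn; rewrite ltrD2l ltrN2.
  have := h2 (n - i.+1)%N; rewrite -subSn// subSS; apply.
  exact: leq_subr.
(* Increment [j] of the path along [s] is minus increment [n.-1 - j] of the reversed path along
   [t]. *)
pose A' j := [set x : R | A (n.-1 - j)%N (- x)].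
have incr x y z : x - z - (y - z) = - (y - x) :> R by lra.
have mA' j : measurable (A' j).
  by apply: (measurable_preimageT (f := fun x : R => - x)) => //; exact: oppr_measurable.
transitivity (P [set w | forall j, (j < n)%N -> A' j (b w (s j.+1) - b w (s j))]).
  congr (P _); apply/seteqP; split => w /= h i inn.
    have ni : (n.-1 - i < n)%N by case: n {gt t01 cl s gs A' mA' h} inn => // m _; rewrite ltnS leq_subr.
    have := h _ ni; rewrite !cl//; last exact: ltnW.
    rewrite /A'/= /s.
    have -> : (n.-1 - i).+1 = (n - i)%N by case: n inn {ni gt t01 cl s gs A' mA' h} => // m im; rewrite /= -subSn.
    have -> : (n - i.+1)%N = (n.-1 - i)%N by case: n inn {ni gt t01 cl s gs A' mA' h} => // m im; rewrite /= subSS.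
    by rewrite incr.
  have ni : (n.-1 - i < n)%N by case: n {gt t01 cl s gs A' mA' h} inn => // m _; rewrite ltnS leq_subr.
  have := h _ ni; rewrite /A'/= !cl//; last exact: ltnW.
  rewrite /s.
  have -> : (n.-1 - (n.-1 - i))%N = i by rewrite subKn//; case: n inn {ni gt t01 cl s gs A' mA' h}.
  have -> : (n - (n.-1 - i).+1)%N = i.
    case: n inn {ni gt t01 cl s gs A' mA' h} => // m im.
    by rewrite subSS /= subKn.
  have -> : (n - (n.-1 - i))%N = i.+1.
    case: n inn {ni gt t01 cl s gs A' mA' h} => // m im.
    by rewrite /= subSn ?leq_subr// subKn.
  by rewrite incr.
have hF : forall x, x \in [::] -> exists2 i, (i <= n)%N & s i = x by [].
etransitivity; first exact: (gb gs hF mA').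
etransitivity; first exact: (reindex_inj (@rev_ord_inj n)).
apply: eq_bigr => i _; change (nat_of_ord (rev_ord i)) with (n - i.+1)%N.
have var : s (n - i.+1).+1 - s (n - i.+1)%N = t i.+1 - t i.
  rewrite /s subKn// -subSn// subSS subKn; last exact: ltnW.
  by lra.
have sd0 : Num.sqrt (t i.+1 - t i) != 0.
  rewrite gt_eqF// sqrtr_gt0 subr_gt0.
  by case: gt => _ _; apply.
have idx : (n.-1 - (n - i.+1))%N = i.
  by rewrite -subn1 -subnDA add1n -subSn// subSS subKn// ltnW.
rewrite var /A' idx.
exact: (normal_prob_opp sd0 (mA i)).
Qed.

End brownian_reversal.

(** * Events of the sampled path *)

Section path_events.
Context (R : realType).
Implicit Types (f : R -> R) (g : seqsp R) (p q s t : R).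

Lemma sample_near f p q t e : continuous f -> p < q -> p <= t <= q -> 0 < e ->
  exists l, p < qn R l < q /\ `|f (qn R l) - f t| < e.
Proof.
move=> cf pq /andP[pt tq] e0; have [d d0 hd] := continuousP_dist (@cf t) e0.
have : Num.max p (t - d) < Num.min q (t + d).
  by rewrite lt_min !gt_max pq/=; apply/and3P; split; lra.
move=> /qn_dense[l]; rewrite gt_max lt_min => /andP[/andP[l1 l2] /andP[l3 l4]].
exists l; split; first by rewrite l1.
by apply: hd; rewrite ltr_norml; apply/andP; split; lra.
Qed.

(** A strict interior minimum in countable terms: outside a short rational bracket inside [(p, q)],
    all samples exceed one fixed sample by a fixed margin. *)
Definition separated p q g (m i j k e : nat) :=
  [/\ p < qn R i /\ qn R j < q, qn R i <= qn R j < qn R i + m.+1%:R^-1, p <= qn R k <= q &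
    forall l, p <= qn R l <= q -> ~ (qn R i <= qn R l <= qn R j) ->
      g k + e.+1%:R^-1 < g l].

Definition sepmin p q g := forall m, exists i j k e, separated p q g m i j k e.

Lemma sepminP f p q : continuous f -> p < q ->
  sepmin p q (sample f) <-> exists s, strictmin p q f s.
Proof.
move=> cf pq; split.
  move=> h; have [apq ha ha1] := argminP cf pq; set a := argmin _ _ _ in apq ha ha1 *.
  have key m i j k e : separated p q (sample f) m i j k e ->
      forall t, p <= t <= q -> ~ (qn R i <= t <= qn R j) -> f a < f t.
    move=> [[pi jq] /andP[ij _] kpq hl] t /andP[pt tq] tij; rewrite ltNge; apply/negP => fta.
    have e0 : 0 < e.+1%:R^-1 / 2 :> R by rewrite divr_gt0// invr_gt0.
    have fak := ha _ kpq.
    have {tij} [ti|jt] : t < qn R i \/ qn R j < t.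
      have [|it] := ltP t (qn R i); first by left.
      by have [|tj] := ltP (qn R j) t; [right|case: tij; rewrite it].
    - have [l [/andP[l1 l2] fl]] := sample_near (p := p) (q := qn R i) (t := t) cf pi
        ltac:(by rewrite pt ltW) e0.
      have := hl l; rewrite /sample (ltW l1).
      have -> : qn R l <= q by lra.
      move=> /(_ isT); have nl : ~ (qn R i <= qn R l <= qn R j) by lra.
      move=> /(_ nl); move: fl e0; rewrite ltr_norml; move: (e.+1%:R^-1) => v /andP[? ?]; lra.
    - have [l [/andP[l1 l2] fl]] := sample_near (p := qn R j) (q := q) (t := t) cf jq
        ltac:(by rewrite tq ltW) e0.
      have := hl l; rewrite /sample (ltW l2).
      have -> : p <= qn R l by lra.
      move=> /(_ isT); have nl : ~ (qn R i <= qn R l <= qn R j) by lra.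
      move=> /(_ nl); move: fl e0; rewrite ltr_norml; move: (e.+1%:R^-1) => v /andP[? ?]; lra.
  have inn m i j k e (H : separated p q (sample f) m i j k e) : qn R i <= a <= qn R j.
    apply: contrapT => na; have := @key m i j k e H a apq na.
    by rewrite ltxx.
  exists a; split.
    have [i [j [k [e H]]]] := h 0%N; have := inn _ _ _ _ _ H.
    by case: H => -[]; lra.
  move=> t tpq ta; have d0 : 0 < `|t - a| by rewrite normr_gt0 subr_eq0.
  have [m hm] := inv_succ_lt d0.
  have [i [j [k [e H]]]] := h m; have := inn _ _ _ _ _ H => aij.
  apply: (key _ _ _ _ _ H) => // tij.
  case: H => _ /andP[_ ij] _ _; have : `|t - a| < m.+1%:R^-1.
    rewrite ltr_norml; move: ij; move: (m.+1%:R^-1) => v ij; apply/andP; split; lra.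
  by rewrite ltNge (ltW hm).
move=> [s [/andP[ps sq] hs]] m.
pose r := Num.min (m.+1%:R^-1 / 2) (Num.min (s - p) (q - s)).
have m0 : 0 < m.+1%:R^-1 :> R by rewrite invr_gt0.
have [r0 r1 r2 r3] : [/\ 0 < r, r <= m.+1%:R^-1 / 2, r <= s - p & r <= q - s].
  split; rewrite /r; [by rewrite !lt_min divr_gt0// !subr_gt0 ps|..];
  by rewrite !ge_min lexx ?orbT.
have [i /andP[i1 i2]] : exists i, s - r < qn R i < s by apply: qn_dense; lra.
have [j /andP[j1 j2]] : exists j, s < qn R j < s + r by apply: qn_dense; lra.
pose r' := Num.min (s - qn R i) (qn R j - s).
have [r'0 r'1 r'2] : [/\ 0 < r', r' <= s - qn R i & r' <= qn R j - s].
  split; rewrite /r'; [rewrite lt_min; apply/andP; split; lra|..];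
  by rewrite !ge_min lexx ?orbT.
have [c c0 hc] := strict_min_gap cf hs r'0.
have c20 : 0 < c / 2 by lra.
have [k [/andP[k1 k2] fk]] := sample_near (p := p) (q := q) (t := s) cf pq
  ltac:(by rewrite !ltW) c20.
have [e he] := inv_succ_lt c20.
exists i, j, k, e; split.
- by split; lra.
- by move: m0 r1; move: (m.+1%:R^-1) => v; lra.
- by rewrite !ltW.
move=> l lpq lij; rewrite /sample.
have : f s + c <= f (qn R l).
  apply: hc => //; rewrite ler_normr; apply: contrapT => /negP; rewrite negb_or -!ltNge.
  by move=> /andP[h1 h2]; apply: lij; lra.
by move: fk he; rewrite ltr_norml; move: (e.+1%:R^-1) => v /andP[? ?]; lra.
Qed.

Definition good_sample g := forall i j, 0 <= qn R i -> qn R i < qn R j -> qn R j <= 1 ->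
  sepmin (qn R i) (qn R j) g.

Lemma good_sampleP f : continuous f -> good_sample (sample f) <-> good f.
Proof.
move=> cf; split=> [h|[_ h]]; [split=> //|] => i j i0 ij j1.
  by apply/sepminP => //; exact: h.
by apply/sepminP => //; exact: h.
Qed.

Definition minat t p q f := forall x, p <= x <= q -> f t <= f x.

(** A countable form of [minat] for a time [t] at which the path need not be sampled: [f t] is
    replaced by the values at rationals close to [t]. *)
Definition lows t p q g := forall n, p <= qn R n <= q -> forall m : nat,
  exists d : nat, forall l, `|qn R l - t| < d.+1%:R^-1 -> g l < g n + m.+1%:R^-1.

Lemma lowsP f t p q : continuous f -> p < q ->
  lows t p q (sample f) <-> minat t p q f.
Proof.
move=> cf pq; split.
  move=> h x xpq; rewrite leNgt; apply/negP => fxt.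
  have e0 : 0 < (f t - f x) / 3 by lra.
  have [n [/andP[n1 n2] fn]] := sample_near cf pq xpq e0.
  have [m hm] := inv_succ_lt e0.
  have [d hd] := h n ltac:(by rewrite !ltW) m.
  have d0 : 0 < d.+1%:R^-1 :> R by rewrite invr_gt0.
  have [l [/andP[l1 l2] fl]] := sample_near (p := t - d.+1%:R^-1) (q := t + d.+1%:R^-1) (t := t) cf
    ltac:(move: d0; move: (d.+1%:R^-1) => v; lra) ltac:(move: d0; move: (d.+1%:R^-1) => v; lra) e0.
  have := hd l; rewrite /sample ltr_norml; move: l1 l2 => l1 l2.
  have -> : - d.+1%:R^-1 < qn R l - t < d.+1%:R^-1.
    by move: l1 l2; move: (d.+1%:R^-1) => v; lra.
  move=> /(_ isT); move: hm fl fn; rewrite !ltr_norml; move: (m.+1%:R^-1) => v ? /andP[? ?] /andP[? ?].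
  by lra.
move=> h n npq m; have m0 : 0 < m.+1%:R^-1 :> R by rewrite invr_gt0.
have [d d0 hd] := continuousP_dist (@cf t) m0.
have [k hk] := inv_succ_lt d0.
exists k => l lt; have := hd (qn R l) (lt_trans lt hk); have := h _ npq.
by rewrite /sample ltr_norml; move: (m.+1%:R^-1) => v ? /andP[? ?]; lra.
Qed.

(** For continuous paths: the minimum over [[p, q]] is at most the minimum over [[p', q']]. *)
Definition belows p q p' q' g := forall n, p' <= qn R n <= q' -> forall m : nat,
  exists l, p <= qn R l <= q /\ g l < g n + m.+1%:R^-1.

Lemma belowsP f p q p' q' s : continuous f -> p < q -> p' < q' -> p <= s <= q ->
  minat s p q f -> belows p q p' q' (sample f) <-> minat s p' q' f.
Proof.
move=> cf pq pq' spq hs; split.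
  move=> h x xpq; rewrite leNgt; apply/negP => fxs.
  have e0 : 0 < (f s - f x) / 3 by lra.
  have [n [/andP[n1 n2] fn]] := sample_near cf pq' xpq e0.
  have [m hm] := inv_succ_lt e0.
  have [l [lpq hl]] := h n ltac:(by rewrite !ltW) m.
  have := hs _ lpq; move: hl hm fn; rewrite /sample ltr_norml.
  by move: (m.+1%:R^-1) => v ? ? /andP[? ?]; lra.
move=> h n npq m; have m0 : 0 < m.+1%:R^-1 :> R by rewrite invr_gt0.
have [l [/andP[l1 l2] fl]] := sample_near cf pq spq m0.
exists l; rewrite !ltW//; split => //; have := h _ npq; move: fl.
by rewrite /sample ltr_norml; move: (m.+1%:R^-1) => v /andP[? ?]; lra.
Qed.

Definition ties p q p' q' g := belows p q p' q' g /\ belows p' q' p q g.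

Lemma tiesP f p q p' q' s s' : continuous f -> p < q -> p' < q' ->
  p <= s <= q -> minat s p q f -> p' <= s' <= q' -> minat s' p' q' f ->
  ties p q p' q' (sample f) <-> f s = f s'.
Proof.
move=> cf pq pq' spq hs spq' hs'; rewrite /ties (belowsP cf pq pq' spq hs).
rewrite (belowsP cf pq' pq spq' hs'); split.
  by move=> [h1 h2]; apply/le_anti; rewrite h1// h2.
by move=> e; split=> x xpq; [rewrite e; exact: hs'|rewrite -e; exact: hs].
Qed.

Section measurability.
Context d (T : measurableType d).

Let measurable_itv (a b : T -> R) (c : R) : measurable_fun setT a ->
  measurable_fun setT b -> measurable [set x | a x <= c <= b x].
Proof.
move=> ma mb; rewrite (_ : [set x | _] = [set x | a x <= c] `&` [set x | c <= b x]).
  by apply: measurableI; apply: measurable_set_le => //; exact: measurable_cst.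
by apply/seteqP; split => x /=; [move/andP|move=> [h1 h2]; rewrite h1 h2].
Qed.

Let measurable_gap (g : T -> seqsp R) (k l : nat) (e : R) : measurable_fun setT g ->
  measurable [set x | g x k + e < g x l].
Proof.
move=> mg; have mc n : measurable_fun setT (fun x => g x n).
  exact: (measurableT_comp (@measurable_coord _ R n) mg).
by apply: measurable_set_lt => //; apply: measurable_funD => //; exact: measurable_cst.
Qed.

Let measurable_gap' (g : T -> seqsp R) (k l : nat) (e : R) : measurable_fun setT g ->
  measurable [set x | g x k < g x l + e].
Proof.
move=> mg; have mc n : measurable_fun setT (fun x => g x n).
  exact: (measurableT_comp (@measurable_coord _ R n) mg).
by apply: measurable_set_lt => //; apply: measurable_funD => //; exact: measurable_cst.
Qed.

Lemma measurable_sepmin (p q : T -> R) (g : T -> seqsp R) :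
  measurable_fun setT p -> measurable_fun setT q -> measurable_fun setT g ->
  measurable [set x | sepmin (p x) (q x) (g x)].
Proof.
move=> mp mq mg; apply: measurable_set_forall => m.
apply: measurable_set_exists => i; apply: measurable_set_exists => j.
apply: measurable_set_exists => k; apply: measurable_set_exists => e.
rewrite (_ : (fun x => _) = [set x | (p x < qn R i /\ qn R j < q x) /\
  (qn R i <= qn R j < qn R i + m.+1%:R^-1 /\ (p x <= qn R k <= q x /\
    forall l, p x <= qn R l <= q x -> ~ (qn R i <= qn R l <= qn R j) ->
      g x k + e.+1%:R^-1 < g x l))]); last first.
  by apply/seteqP; split => x /= [] // ? [] ? [].
apply: measurable_set_and.
  apply: measurable_set_and; apply: measurable_set_lt => //; exact: measurable_cst.
apply: measurable_set_and; first exact: measurable_set_const.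
apply: measurable_set_and; first exact: measurable_itv.
apply: measurable_set_forall => l; apply: measurable_set_imp; first exact: measurable_itv.
apply: measurable_set_imp; first exact: measurable_set_const.
exact: measurable_gap.
Qed.

Lemma measurable_lows (t p q : T -> R) (g : T -> seqsp R) :
  measurable_fun setT t -> measurable_fun setT p -> measurable_fun setT q ->
  measurable_fun setT g -> measurable [set x | lows (t x) (p x) (q x) (g x)].
Proof.
move=> mt mp mq mg; apply: measurable_set_forall => n.
apply: measurable_set_imp; first exact: measurable_itv.
apply: measurable_set_forall => m; apply: measurable_set_exists => e.
apply: measurable_set_forall => l; apply: measurable_set_imp; last exact: measurable_gap'.
apply: measurable_set_lt; last exact: measurable_cst.
by apply: measurableT_comp => //; apply: measurable_funB => //; exact: measurable_cst.
Qed.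

Lemma measurable_ties (p q p' q' : R) : measurable [set g | ties p q p' q' g].
Proof.
have mb (a b a' b' : R) : measurable [set g | belows a b a' b' g].
  apply: measurable_set_forall => n; apply: measurable_set_imp.
    exact: measurable_set_const.
  apply: measurable_set_forall => m; apply: measurable_set_exists => l.
  apply: measurable_set_and; first exact: measurable_set_const.
  apply: measurable_set_lt; first exact: measurable_coord.
  by apply: measurable_funD; [exact: measurable_coord|exact: measurable_cst].
by apply: measurable_set_and; exact: mb.
Qed.

End measurability.

Lemma measurable_good_sample : measurable good_sample.
Proof.
apply: measurable_set_forall => i; apply: measurable_set_forall => j.
do 3! (apply: measurable_set_imp; first exact: measurable_set_const).
by apply: measurable_sepmin; [exact: measurable_cst..|exact: measurable_id].
Qed.

End path_events.

(** * Continuous versions of Brownian motion *)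

Lemma gaussian_increments_ae (R : realType) d (T : measurableType d) (P : probability T R)
    (Z Z' : T -> R -> R) F N :
  measurable N -> P N = 0%E ->
  (forall t, 0 <= t <= 1 -> measurable_fun setT (Z ^~ t)) ->
  (forall t, 0 <= t <= 1 -> measurable_fun setT (Z' ^~ t)) ->
  (forall w, ~ N w -> forall t, 0 <= t <= 1 -> Z' w t = Z w t) ->
  gaussian_increments P Z F -> gaussian_increments P Z' F.
Proof.
move=> mN N0 mZ mZ' ZZ' gZ n t gt hF A mA.
have t01 i : (i <= n)%N -> 0 <= t i <= 1.
  move=> inn; have [h0 h1 _] := gt.
  by rewrite (le_trans h0 (grid_le gt (leq0n i) inn)) (le_trans (grid_le gt inn (leqnn n)) h1).
have mE (X : T -> R -> R) : (forall t, 0 <= t <= 1 -> measurable_fun setT (X ^~ t)) ->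
    measurable [set w | forall i, (i < n)%N -> A i (X w (t i.+1) - X w (t i))].
  move=> mX; apply: measurable_set_forall => i.
  have [inn|ni] := boolP (i < n)%N; last first.
    by rewrite (_ : (fun x => _) = setT)//; apply/seteqP; split.
  rewrite (_ : (fun x => _) = [set w | A i (X w (t i.+1) - X w (t i))]); last first.
    by apply/seteqP; split => w /=; [apply|].
  apply: (measurable_preimageT (f := fun w => X w (t i.+1) - X w (t i))) => //.
  by apply: measurable_funB; apply: mX; apply: t01 => //; exact: ltnW.
rewrite -(gZ n t gt hF A mA); apply: (measure_eq_null (N := N)) => //; [exact: mE|exact: mE|..].
all: move=> w /= h; have [Nw|Nw] := pselect (N w); [by right|left => i inn].
  by rewrite -(ZZ' w Nw _ (t01 _ inn)) -(ZZ' w Nw _ (t01 _ (ltnW inn))); exact: h.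
by rewrite (ZZ' w Nw _ (t01 _ inn)) (ZZ' w Nw _ (t01 _ (ltnW inn))); exact: h.
Qed.

Lemma continuous_clamp_within (R : realType) (f : R -> R) :
  {within `[0, 1], continuous f} -> continuous (fun t => f (clamp 1 t)).
Proof.
move=> /subspace_continuousP cf t U fU.
have ct : `[0, 1]%classic (clamp 1 t) by rewrite /= in_itv/= clamp01.
have h : \forall s \near clamp 1 t, `[0, 1]%classic s -> U (f s) := cf _ ct U fU.
have {}h : \forall y \near t, `[0, 1]%classic (clamp 1 y) -> U (f (clamp 1 y)).
  exact: continuous_clampe h.
change (\forall y \near t, U (f (clamp 1 y))).
by apply: filterS h => y /=; apply; rewrite in_itv/= clamp01.
Qed.

(** A modification whose properties hold for every [w] and every real time: time is clamped to
    [[0, 1]] and exceptional paths are replaced. This keeps null sets out of the pathwise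
    arguments. *)
Record brownian_version (R : realType) d (T : measurableType d) (P : probability T R)
    (b : T -> R -> R) : Prop := {
  bv_measurable : forall t, measurable_fun setT (b ^~ t) ;
  bv_start : forall w, b w 0 = 0 ;
  bv_clamp : forall w t, b w t = b w (clamp 1 t) ;
  bv_continuous : forall w, continuous (b w) ;
  bv_gaussian : gaussian_increments P b [::] }.

Lemma brownian_version_exists (R : realType) d (T : measurableType d) (P : probability T R)
    (B : R -> T -> R) : Brownian_motion P B ->
  exists b, brownian_version P b /\ exists N, [/\ measurable N, P N = 0%E &
    forall w, ~ N w -> forall t, 0 <= t <= 1 -> b w t = B t w].
Proof.
move=> hB; have [N1 [mN1 N10 sN1]] := BM_start hB.
have [N2 [mN2 N20 sN2]] := BM_continuous hB.
pose N := N1 `|` N2.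
have mN : measurable N by exact: measurableU.
have N0 : P N = 0%E.
  by apply/eqP; rewrite eq_le measure_ge0 andbT -[leRHS]adde0 -{1}N10 -{1}N20 measureU2.
have start w : ~ N w -> B 0 w = 0.
  by move=> Nw; apply: contrapT => h; apply: Nw; left; exact: sN1.
have cont w : ~ N w -> {within `[0, 1], continuous (fun t => B t w)}.
  by move=> Nw; apply: contrapT => h; apply: Nw; right; exact: sN2.
pose b w t := if `[< N w >] then 0 else B (clamp 1 t) w.
have bB w : ~ N w -> forall t, 0 <= t <= 1 -> b w t = B t w.
  by move=> Nw t t01; rewrite /b asboolF// clamp_id.
have mb t : measurable_fun setT (b ^~ t).
  refine (@measurable_fun_glue _ _ T R N (fun=> 0) (B (clamp 1 t)) (b ^~ t) mN _ _ _ _).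
  - exact: measurable_cst.
  - exact: (BM_measurable hB (clamp01 t)).
  - by move=> w Nw; rewrite /b asboolT.
  - by move=> w Nw; rewrite /b asboolF.
exists b; split; last by exists N.
split=> //.
- move=> w; rewrite /b; case: asboolP => // Nw.
  by rewrite clamp_id ?start// lexx ler01.
- by move=> w t; rewrite /b clamp_idem.
- move=> w; rewrite /b; case: asboolP => Nw t; first exact: cst_continuous.
  exact: continuous_clamp_within (cont _ Nw) t.
- apply: (@gaussian_increments_ae _ _ _ _ (fun w t => B t w) b [::] N) => //.
    exact: BM_measurable hB.
  move=> n t gt _ A mA; have [h0 h1 h2] := gt.
  transitivity (P [set w | forall i : 'I_n, A i (B (t i.+1) w - B (t i) w)]).
    congr (P _); apply/seteqP; split => w /= h i; first exact: h.
    by move=> inn; exact: (h (Ordinal inn)).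
  rewrite (BM_independent hB h0 h1 h2 (A := fun i : 'I_n => A i))//.
  apply: eq_bigr => i _; apply: (BM_gaussian hB) => //.
  + by apply: (le_trans h0); apply: (grid_le gt) => //; exact: ltnW.
  + exact: h2.
  + by apply: le_trans h1; apply: (grid_le gt).
Qed.

(** * Minima over disjoint intervals almost surely differ *)

Section version.
Context (R : realType) d (T : measurableType d) (P : probability T R) (b : T -> R -> R).
Hypothesis hb : brownian_version P b.

Lemma measurable_bv_sample : measurable_fun setT (fun w => sample (b w)).
Proof. by apply: measurable_fun_seqP => n; exact: bv_measurable hb _. Qed.

Lemma measurable_bv_event (C : set (seqsp R)) : measurable C ->
  measurable [set w | C (sample (b w))].
Proof. exact: measurable_preimageT measurable_bv_sample. Qed.

Lemma bv_increment s t (A : set R) : 0 <= s -> s < t -> t <= 1 -> measurable A ->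
  P [set w | A (b w t - b w s)] = normal_prob 0 (Num.sqrt (t - s)) A.
Proof.
move=> s0 st t1 mA; pose u i := if i is 0 then s else t.
have gu : grid 1 u by split=> //; case.
have h : forall x, x \in [::] -> exists2 i, (i <= 1)%N & u i = x by [].
transitivity (P [set w | forall i, (i < 1)%N -> A (b w (u i.+1) - b w (u i))]).
  congr (P _); apply/seteqP; split => w /=; first by move=> h' [|//] _.
  by move=> /(_ 0%N isT).
by rewrite (bv_gaussian hb gu h (A := fun=> A))// big_ord1.
Qed.

Lemma bv_resample_law th de (C : set (seqsp R)) : 0 <= th -> 0 < de -> th + de <= 1 ->
  measurable C ->
  P [set w | C (sample (b w))] =
  (P \x P)%E [set z | C (sample (resample th de (b z.1) (b z.2)))].
Proof.
exact: (resample_law (bv_measurable hb) (bv_start hb) (bv_clamp hb) (bv_gaussian hb)).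
Qed.

Lemma measurable_resample_sample th de : measurable_fun setT
  (fun z : T * T => sample (resample th de (b z.1) (b z.2))).
Proof.
have m1 s : measurable_fun setT (fun z : T * T => b z.1 s).
  exact: (measurableT_comp (bv_measurable hb s) measurable_fst).
have m2 s : measurable_fun setT (fun z : T * T => b z.2 s).
  exact: (measurableT_comp (bv_measurable hb s) measurable_snd).
apply: measurable_fun_seqP => n; rewrite /sample /resample.
apply: measurable_funD; last exact: measurable_funB.
by apply: measurable_funD => //; exact: measurable_funB.
Qed.

(** The path is resampled on the gap [[r1, r2]] between the two intervals. This moves one minimum
    against the other by the new increment, so a tie forces that increment to take one particular
    value, and the normal law has no atoms. *)
Lemma ties_null p r1 r2 q : 0 <= p -> p < r1 -> r1 < r2 -> r2 < q -> q <= 1 ->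
  P [set w | ties p r1 r2 q (sample (b w))] = 0%E.
Proof.
move=> p0 pr1 r12 r2q q1.
have mt := measurable_ties p r1 r2 q.
have r12' : r1 + (r2 - r1) = r2 by lra.
rewrite (@bv_resample_law r1 (r2 - r1)) ?r12'//; [|lra|lra|lra].
rewrite product_measure_integral_l; last first.
  by apply: measurable_preimageT => //; exact: measurable_resample_sample.
apply: integral0_eq => w _ /=.
have cw := @bv_continuous _ _ _ _ _ hb w.
have [s1 [s1pr hs1 _]] := is_argmin_exists cw (ltW pr1).
have [s2 [s2rq hs2 _]] := is_argmin_exists cw (ltW r2q).
(* The increment of the second path for which the minimum to the right, shifted by the resampling,
   equals the minimum to the left. *)
pose c := b w s1 - b w s2 - b w r1 + b w r2.
apply/eqP; rewrite eq_le measure_ge0 andbT.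
have sd0 : Num.sqrt (r2 - r1 - 0) != 0 by rewrite gt_eqF// sqrtr_gt0; lra.
rewrite -(normal_prob_set1 sd0 c) -(bv_increment (A := [set c])) ?subr0//; [|lra..].
have msec : measurable [set w' | ties p r1 r2 q (sample (resample r1 (r2 - r1) (b w) (b w')))].
  apply: (measurable_section_l w (A := [set z : T * T | ties p r1 r2 q
    (sample (resample r1 (r2 - r1) (b z.1) (b z.2)))])).
  by apply: measurable_preimageT => //; exact: measurable_resample_sample.
apply: le_measure; rewrite ?inE//.
  apply: (measurable_preimageT (f := fun x => b x (r2 - r1) - b x 0)) => //.
  by apply: measurable_funB; exact: bv_measurable hb _.
move=> w' /=; have cw' := @bv_continuous _ _ _ _ _ hb w'.
have de0 : 0 <= r2 - r1 by lra.
have left t : t <= r1 -> resample r1 (r2 - r1) (b w) (b w') t = b w t.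
  exact: resample_left.
have right t : r2 <= t -> resample r1 (r2 - r1) (b w) (b w') t =
    b w t + (b w r1 + (b w' (r2 - r1) - b w' 0) - b w r2).
  by move=> h; rewrite resample_right ?r12'.
have cr : continuous (resample r1 (r2 - r1) (b w) (b w')) by exact: continuous_resample.
rewrite (tiesP (s := s1) (s' := s2) cr pr1 r2q)//.
- rewrite left; last by case/andP: s1pr.
  rewrite right; last by case/andP: s2rq.
  by rewrite /c => ->; lra.
- move=> x /andP[px xr]; rewrite !left//; last by case/andP: s1pr.
  by apply: hs1; rewrite px.
- move=> x /andP[rx xq]; rewrite !right//; last by case/andP: s2rq.
  by rewrite lerD2r; apply: hs2; rewrite rx.
Qed.

(* Two minimizers of a path would be separated by rationals, and produce a tie. *)
Definition tied p q (g : seqsp R) := exists i j : nat,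
  [/\ p < qn R i, qn R i < qn R j, qn R j < q & ties p (qn R i) (qn R j) q g].

Lemma measurable_tied p q : measurable (tied p q).
Proof.
apply: measurable_set_exists => i; apply: measurable_set_exists => j.
rewrite (_ : (fun g => _) = [set g | (p < qn R i /\ qn R i < qn R j /\ qn R j < q) /\
  ties p (qn R i) (qn R j) q g]); last first.
  by apply/seteqP; split => g /= [] => [h1 h2 h3 h4|[h1 [h2 h3]] h4]; split.
apply: measurable_set_and; first exact: measurable_set_const.
exact: measurable_ties.
Qed.

Lemma tied_null p q : 0 <= p -> q <= 1 -> P [set w | tied p q (sample (b w))] = 0%E.
Proof.
move=> p0 q1; apply/negligibleP; first exact: (measurable_bv_event (measurable_tied _ _)).
rewrite (_ : [set w | _] = \bigcup_i \bigcup_j [set w | [/\ p < qn R i, qn R i < qn R j,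
   qn R j < q & ties p (qn R i) (qn R j) q (sample (b w))]]); last first.
  apply/seteqP; split => w /=; first by move=> [i [j h]]; exists i => //; exists j.
  by move=> [i _ [j _ h]]; exists i, j.
apply: negligible_bigcup => i; apply: negligible_bigcup => j.
have [h|h] := pselect (p < qn R i /\ qn R i < qn R j /\ qn R j < q).
  apply: (@negligibleS _ _ _ P [set w | ties p (qn R i) (qn R j) q (sample (b w))]).
    by move=> w [].
  apply/negligibleP; first exact: (measurable_bv_event (measurable_ties _ _ _ _)).
  by case: h => ? [? ?]; exact: ties_null.
rewrite (_ : [set w | _] = set0); first exact: negligible_set0.
by apply/seteqP; split => w // [? ? ? _]; apply: h.
Qed.

Lemma minat_tied f p q s s' : continuous f -> p <= s -> s < s' -> s' <= q ->
  minat s p q f -> minat s' p q f -> tied p q (sample f).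
Proof.
move=> cf ps ss' s'q hs hs'.
have [i /andP[i1 i2]] := qn_dense ss'.
have [j /andP[j1 j2]] := qn_dense i2.
exists i, j; split=> //; [exact: le_lt_trans ps i1|exact: lt_le_trans j2 s'q|].
have fss' : f s = f s'.
  by apply/le_anti; rewrite hs ?hs'//; lra.
apply/(tiesP (s := s) (s' := s')) => //; try lra.
- by move=> x /andP[h1 h2]; apply: hs; lra.
- by move=> x /andP[h1 h2]; apply: hs'; lra.
Qed.

End version.

(** * Null sets in product spaces *)

Lemma measure0_sub d (T : measurableType d) (R : realType)
    (mu : {measure set T -> \bar R}) (A B : set T) :
  measurable A -> measurable B -> A `<=` B -> mu B = 0%E -> mu A = 0%E.
Proof.
move=> mA mB AB B0; apply/eqP; rewrite eq_le measure_ge0 andbT -B0.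
by apply: le_measure; rewrite ?inE.
Qed.

Lemma measure0_exists d (T : measurableType d) (R : realType)
    (mu : {measure set T -> \bar R}) (F : nat -> set T) :
  (forall n, measurable (F n)) -> (forall n, mu (F n) = 0%E) ->
  mu [set x | exists n, F n x] = 0%E.
Proof.
move=> mF F0; apply/negligibleP; first exact: measurable_set_exists.
rewrite (_ : [set _ | _] = \bigcup_n F n).
  by apply: negligible_bigcup => n; apply/(negligibleP mu (mF n)); exact: F0.
by apply/seteqP; split => x /=; [move=> [n h]; exists n|move=> [n _ h]; exists n].
Qed.

Lemma measure0_U d (T : measurableType d) (R : realType)
    (mu : {measure set T -> \bar R}) (A B : set T) :
  measurable A -> measurable B -> mu A = 0%E -> mu B = 0%E -> mu (A `|` B) = 0%E.
Proof.
move=> mA mB A0 B0; apply/eqP; rewrite eq_le measure_ge0 andbT.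
by rewrite -[leRHS]adde0 -{1}A0 -B0 measureU2.
Qed.

Lemma ge0_integral0_null d (T : measurableType d) (R : realType)
    (mu : {measure set T -> \bar R}) (f : T -> \bar R) : measurable_fun setT f ->
  (forall x, 0 <= f x)%E -> (\int[mu]_x f x = 0)%E ->
  measurable [set x | f x <> 0%E] /\ mu [set x | f x <> 0%E] = 0%E.
Proof.
move=> mf f0 If; have mN : measurable [set x | f x <> 0%E].
  apply: measurable_set_not; have := mf measurableT [set 0%E] (emeasurable_set1 0%E).
  by rewrite setTI.
split=> //; have : (\int[mu]_x `|f x| = 0)%E.
  by rewrite -[RHS]If; apply: eq_integral => x _; rewrite gee0_abs.
move=> /(ae_eq_integral_abs _ measurableT mf)[N [mN' N0 sN]].
apply: (measure0_sub mN mN') => // x /= fx; apply: sN => /=.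
by move=> /(_ I).
Qed.

Section product_null.
Context d1 d2 (S : measurableType d1) (U : measurableType d2) (R : realType)
  (m1 : probability S R) (m2 : probability U R) (A : set (S * U)).
Hypothesis mA : measurable A.

Lemma product_null_l N : measurable N -> m1 N = 0%E ->
  (forall x, ~ N x -> m2 [set y | A (x, y)] = 0%E) -> (m1 \x m2)%E A = 0%E.
Proof.
move=> mN N0 h; have mNT : measurable (N `*` [set: U]) by exact: measurableX.
have mD : measurable (A `\` N `*` [set: U]) by exact: measurableD.
apply: (@measure0_sub _ _ _ (m1 \x m2)%E A (N `*` [set: U] `|` (A `\` N `*` [set: U]))) => //.
- exact: measurableU.
- by move=> z Az; have [Nz|Nz] := pselect ((N `*` [set: U]) z); [left|right].
apply: measure0_U => //.
  transitivity (m1 N * m2 setT)%E; first exact: product_measure1E.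
  by rewrite N0 mul0e.
etransitivity; first exact: (product_measure_integral_l _ _ mD).
apply: integral0_eq => x _ /=.
have [Nx|Nx] := pselect (N x).
  rewrite (_ : [set y | _] = set0) ?measure0//.
  by apply/seteqP; split => y //= [_]; apply.
apply: (measure0_sub (B := [set y | A (x, y)])); [..|exact: h].
- exact: (measurable_section_l x mD).
- exact: measurable_section_l.
- by move=> y [].
Qed.

Lemma product_null_r N : measurable N -> m2 N = 0%E ->
  (forall y, ~ N y -> m1 [set x | A (x, y)] = 0%E) -> (m1 \x m2)%E A = 0%E.
Proof.
move=> mN N0 h; have mNT : measurable ([set: S] `*` N) by exact: measurableX.
have mD : measurable (A `\` [set: S] `*` N) by exact: measurableD.
apply: (@measure0_sub _ _ _ (m1 \x m2)%E A ([set: S] `*` N `|` (A `\` [set: S] `*` N))) => //.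
- exact: measurableU.
- by move=> z Az; have [Nz|Nz] := pselect (([set: S] `*` N) z); [left|right].
apply: measure0_U => //.
  transitivity (m1 setT * m2 N)%E; first exact: product_measure1E.
  by rewrite N0 mule0.
etransitivity; first exact: (product_measure_integral_r _ _ mD).
apply: integral0_eq => x _ /=.
have [Nx|Nx] := pselect (N x).
  rewrite (_ : [set y | _] = set0) ?measure0//.
  by apply/seteqP; split => y //= [_]; apply.
apply: (measure0_sub (B := [set y | A (y, x)])); [..|exact: h].
- exact: (measurable_section_r x mD).
- exact: measurable_section_r.
- by move=> y [].
Qed.

Lemma null_section_l : (m1 \x m2)%E A = 0%E ->
  measurable [set x | m2 [set y | A (x, y)] <> 0%E] /\
  m1 [set x | m2 [set y | A (x, y)] <> 0%E] = 0%E.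
Proof.
rewrite product_measure_integral_l// => h; apply: ge0_integral0_null => //.
rewrite (_ : (fun x => _) = m2 \o xsection A); first exact: measurable_fun_xsection.
apply/funext => x /=; congr (m2 _).
by apply/seteqP; split => y /=; rewrite /xsection/= inE.
Qed.

Lemma null_section_r : (m1 \x m2)%E A = 0%E ->
  measurable [set y | m1 [set x | A (x, y)] <> 0%E] /\
  m2 [set y | m1 [set x | A (x, y)] <> 0%E] = 0%E.
Proof.
rewrite product_measure_integral_r// => h; apply: ge0_integral0_null => //.
rewrite (_ : (fun x => _) = m1 \o ysection A); first exact: measurable_fun_ysection.
apply/funext => x /=; congr (m1 _).
by apply/seteqP; split => y /=; rewrite /ysection/= inE.
Qed.

End product_null.

Lemma probability_null_exists d (T : measurableType d) (R : realType)
    (P : probability T R) (N : set T) : measurable N -> P N = 0%E -> exists x, ~ N x.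
Proof.
move=> mN N0; apply: contrapT => h; have : P setT = 0%E.
  rewrite -N0; congr (P _); apply/seteqP; split => x // _.
  by apply: contrapT => Nx; apply: h; exists x.
by rewrite measure_probability_setT => /eqP; rewrite onee_eq0.
Qed.

(** * Almost every Brownian path is good *)

Section good_version.
Context (R : realType) d (T : measurableType d) (P : probability T R) (b : T -> R -> R).
Hypothesis hb : brownian_version P b.

Let cb w : continuous (b w). Proof. exact: (@bv_continuous _ _ _ _ _ hb w). Qed.

Let low t p q := [set w | lows t p q (sample (b w))].

Let mlow t p q : measurable (low t p q).
Proof.
apply: (measurable_bv_event hb (C := [set g | lows t p q g])).
by apply: measurable_lows; [exact: measurable_cst..|exact: measurable_id].
Qed.


Lemma low_shift c p q : 0 <= p -> p < q -> q <= 1 -> 0 <= c <= q - p ->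
  P (low (p + c) p q) = P (low c 0 (q - p)).
Proof.
move=> p0 pq q1 cpq; have e : p + (q - p) = q by lra.
have m1 : measurable [set g : seqsp R | lows (p + c) p q g].
  by apply: measurable_lows; [exact: measurable_cst..|exact: measurable_id].
have qp0 : 0 < q - p by lra.
rewrite [LHS](bv_resample_law hb p0 qp0 _ m1) ?e//.
transitivity ((P \x P)%E ([set: T] `*` low c 0 (q - p))); last first.
  by rewrite [LHS]product_measure1E// measure_probability_setT mul1e.
congr ((P \x P)%E _); apply/seteqP.
have eqv w w' : lows (p + c) p q (sample (resample p (q - p) (b w) (b w'))) <->
    lows c 0 (q - p) (sample (b w')).
  have cr : continuous (resample p (q - p) (b w) (b w')) by exact: continuous_resample.
  rewrite (lowsP _ cr pq) (lowsP _ (@cb w') qp0).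
  have mid x : p <= x <= q -> resample p (q - p) (b w) (b w') x =
      b w p + (b w' (x - p) - b w' 0).
    by move=> h; apply: resample_mid; rewrite e.
  split=> h x xpq.
    have := h (p + x) ltac:(lra); rewrite !mid; [|lra|lra].
    by rewrite !(addrC p) !addrK; lra.
  have := h (x - p) ltac:(lra); rewrite !mid; [|lra|lra].
  by rewrite (addrC p) addrK; lra.
by split => -[w w'] /=; [move=> /eqv|move=> [_] /eqv].
Qed.

(** A minimum at [t] over [[0, r]] is a minimum at the right end of [[0, t]] together with one at
    the left end of the remaining piece; resampling [[t, r]] shows that these are independent. *)
Lemma low_split t r : 0 < t -> t < r -> r <= 1 ->
  P (low t 0 r) = (P (low t 0 t) * P (low 0 0 (r - t)))%E.
Proof.
move=> t0 tr r1; have e : t + (r - t) = r by lra.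
have m1 : measurable [set g : seqsp R | lows t 0 r g].
  by apply: measurable_lows; [exact: measurable_cst..|exact: measurable_id].
have rt0 : 0 < r - t by lra.
have r0 : 0 < r by lra.
rewrite [LHS](bv_resample_law hb (ltW t0) rt0 _ m1) ?e//.
transitivity ((P \x P)%E (low t 0 t `*` low 0 0 (r - t))); last first.
  by rewrite [LHS]product_measure1E.
congr ((P \x P)%E _); apply/seteqP.
have eqv w w' : lows t 0 r (sample (resample t (r - t) (b w) (b w'))) <->
    lows t 0 t (sample (b w)) /\ lows 0 0 (r - t) (sample (b w')).
  have cr : continuous (resample t (r - t) (b w) (b w')) by exact: continuous_resample.
  rewrite (lowsP _ cr r0) (lowsP _ (@cb w) t0) (lowsP _ (@cb w') rt0).
  have mid x : t <= x <= r -> resample t (r - t) (b w) (b w') x =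
      b w t + (b w' (x - t) - b w' 0).
    by move=> h; apply: resample_mid; rewrite e.
  have left x : x <= t -> resample t (r - t) (b w) (b w') x = b w x.
    by move=> h; apply: resample_left => //; exact: ltW.
  split.
    move=> h; split=> x xpq; first by have := h x; rewrite !left//; [apply; lra|lra].
    have := h (t + x) ltac:(lra); rewrite left// mid; last by lra.
    by rewrite (addrC t) addrK; lra.
  move=> [h1 h2] x xpq; rewrite left//; have [xt|tx] := leP x t.
    by rewrite left//; apply: h1; lra.
  rewrite mid; last by lra.
  by have := h2 (x - t) ltac:(lra); lra.
by split => -[w w'] /= /eqv.
Qed.

Lemma low_reverse r : 0 < r -> r <= 1 -> P (low 0 0 r) = P (low r 0 r).
Proof.
move=> r0 r1.
have m1 : measurable [set g : seqsp R | lows 0 0 r g].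
  by apply: measurable_lows; [exact: measurable_cst..|exact: measurable_id].
have e : 1 - (1 - r) = r by lra.
have := @low_shift r (1 - r) 1; rewrite e subrK => <-; [|lra..].
rewrite [LHS](reversed_law (bv_measurable hb) (bv_start hb) (bv_clamp hb) (bv_gaussian hb) m1).
congr (P _).
have eqv w : lows 0 0 r (sample (fun t => b w (1 - clamp 1 t) - b w 1)) <->
    lows 1 (1 - r) 1 (sample (b w)).
  have cr : continuous (fun t => b w (1 - clamp 1 t) - b w 1).
    move=> t; apply: (@cvgB _ R^o); last exact: cvg_cst.
    apply: (@continuous_comp _ _ _ (fun t => 1 - clamp 1 t) (b w)); last exact: cb.
    apply: (@cvgB _ R^o); first exact: cvg_cst.
    exact: continuous_clampe.
  rewrite (lowsP _ cr r0) (lowsP _ (@cb w)); last by lra.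
  have rev x : 0 <= x <= 1 -> b w (1 - clamp 1 x) - b w 1 = b w (1 - x) - b w 1.
    by move=> h; rewrite clamp_id.
  split=> h x xpq.
    have := h (1 - x) ltac:(lra); rewrite !rev; [|lra|lra].
    by rewrite subr0 (_ : 1 - (1 - x) = x); lra.
  have := h (1 - x) ltac:(lra); rewrite !rev; [|lra|lra].
  by rewrite subr0; lra.
by apply/seteqP; split => w /= /eqv.
Qed.

Lemma low_mono t p q p' q' : p <= p' -> p' < q' -> q' <= q ->
  (P (low t p q) <= P (low t p' q'))%E.
Proof.
move=> pp pq qq; apply: le_measure; rewrite ?inE// => w /=.
rewrite /low/= !lowsP//; last by lra.
by move=> h x xpq; apply: h; lra.
Qed.

(** A path without ties has at most one minimizing time in [(0, r)], so a uniform independent time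
    is minimizing with probability 0; by Fubini some fixed time is. *)
Lemma some_low_null r : 0 < r -> r <= 1 -> exists t, [/\ 0 < t, t < r & P (low t 0 r) = 0%E].
Proof.
move=> r0 r1.
pose A : set (T * mI01 R) := [set z | lows (r * I01val z.2) 0 r (sample (b z.1))].
have mA : measurable A.
  apply: measurable_lows; [|exact: measurable_cst..|].
    apply: measurable_funM; first exact: measurable_cst.
    exact: (measurableT_comp (@measurable_I01val R) measurable_snd).
  exact: (measurableT_comp (measurable_bv_sample hb) measurable_fst).
have mN : measurable [set w | tied 0 r (sample (b w))].
  exact: (measurable_bv_event hb (measurable_tied _ _)).
have N0 := tied_null hb (lexx 0) r1.
have A0 : (P \x (@mes01 R))%E A = 0%E.
  apply: (product_null_l mA mN N0) => w Nw.
  have mAw : measurable [set y | A (w, y)] by exact: measurable_section_l.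
  have [[u0 Au0]|h] := pselect (exists u, A (w, u)); last first.
    rewrite (_ : [set y | _] = set0) ?measure0//.
    by apply/seteqP; split => u //= Au; apply: h; exists u.
  have m1 : measurable [set u0].
    rewrite (_ : [set u0] = [set u | u = u0]); last by apply/seteqP; split.
    by apply: measurable_set_eqI01; [exact: measurable_id|exact: measurable_cst].
  apply: (measure0_sub mAw m1) (mes01_set1 u0) => u /= Au; apply: I01val_inj.
  have [/andP[u1 u2] /andP[v1 v2]] := (I01val_itv u, I01val_itv u0).
  have ru v : 0 < v < 1 -> 0 < r * v < r.
    by move=> /andP[v0 vlt1]; rewrite mulr_gt0//= gtr_pMr.
  have /andP[a1 a2] := ru _ (I01val_itv u); have /andP[a3 a4] := ru _ (I01val_itv u0).
  apply: contrapT => uu0; apply: Nw.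
  move: Au Au0; rewrite /A/= !lowsP//= => Au Au0.
  have : r * I01val u != r * I01val u0.
    by apply/eqP => /(mulfI (lt0r_neq0 r0)).
  rewrite neq_lt => /orP[lt|lt].
    by apply: minat_tied lt _ Au Au0 => //; exact: ltW.
  by apply: minat_tied lt _ Au0 Au => //; exact: ltW.
have [mB B0] := null_section_r mA A0.
have [u] := probability_null_exists mB B0.
move=> /contrapT Au; exists (r * I01val u).
have /andP[u0 u1] := I01val_itv u.
by rewrite mulr_gt0// gtr_pMr.
Qed.

(** For the time [t] of [some_low_null], one of the two factors of [low_split] vanishes. Each of
    them bounds the probability in question from above, the first one after reversal, because a
    minimum at 0 over [[0, r]] is one over every shorter [[0, r']]. *)
Lemma low_null r : 0 < r -> r <= 1 -> P (low 0 0 r) = 0%E.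
Proof.
move=> r0 r1; have [t [t0 tr]] := some_low_null r0 r1.
rewrite low_split// => /eqP; rewrite mule_eq0 => /orP[|] /eqP h; apply/eqP;
  rewrite eq_le measure_ge0 andbT -h.
  by rewrite -low_reverse//; [apply: low_mono; lra|lra].
by apply: low_mono; lra.
Qed.

(** On a rational interval the leftmost minimizer fails to be strict and interior only if an end
    point is minimizing or there is a tie: countably many null events. *)
Lemma not_good_null : P [set w | ~ good_sample (sample (b w))] = 0%E.
Proof.
have low0 r : 0 < r -> r <= 1 -> P (low r 0 r) = 0%E.
  by move=> r0 r1; rewrite -low_reverse// low_null.
pose bad i j : set T := [set w | (0 <= qn R i /\ qn R i < qn R j /\ qn R j <= 1) /\
  (lows (qn R i) (qn R i) (qn R j) (sample (b w)) \/
   lows (qn R j) (qn R i) (qn R j) (sample (b w)) \/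
   tied (qn R i) (qn R j) (sample (b w)))].
have mtied p q : measurable [set w | tied p q (sample (b w))].
  exact: (measurable_bv_event hb (measurable_tied _ _)).
have mbad i j : measurable (bad i j).
  apply: measurable_set_and; first exact: measurable_set_const.
  exact: (measurableU _ _ (mlow _ _ _) (measurableU _ _ (mlow _ _ _) (mtied _ _))).
have bad0 i j : P (bad i j) = 0%E.
  have [h|h] := pselect (0 <= qn R i /\ qn R i < qn R j /\ qn R j <= 1); last first.
    by rewrite (_ : bad i j = set0) ?measure0//; apply/seteqP; split => w // [].
  have mU := measurableU _ _ (mlow (qn R j) (qn R i) (qn R j)) (mtied (qn R i) (qn R j)).
  apply: (measure0_sub (mbad i j) (measurableU _ _ (mlow (qn R i) (qn R i) (qn R j)) mU)).
    by move=> w [].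
  case: h => [p0 [pq q1]].
  have qp : qn R i + (qn R j - qn R i) = qn R j by lra.
  apply: measure0_U => //; last apply: measure0_U => //.
  - have h0 := @low_shift 0 _ _ p0 pq q1 ltac:(lra); rewrite addr0 in h0.
    by apply: etrans h0 _; apply: low_null; lra.
  - have h0 := @low_shift (qn R j - qn R i) _ _ p0 pq q1 ltac:(lra); rewrite qp in h0.
    by apply: etrans h0 _; apply: low0; lra.
  - exact: (tied_null hb p0 q1).
have mE : measurable [set w | exists i, exists j, bad i j w].
  by apply: measurable_set_exists => i; apply: measurable_set_exists.
apply: (measure0_sub _ mE).
- apply: measurable_set_not; apply: (measurable_bv_event hb); exact: measurable_good_sample.
- move=> w /= ng; apply: contrapT => h; apply: ng => i j i0 ij j1.
  have {}h : ~ (lows (qn R i) (qn R i) (qn R j) (sample (b w)) \/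
   lows (qn R j) (qn R i) (qn R j) (sample (b w)) \/
   tied (qn R i) (qn R j) (sample (b w))).
    by move=> h'; apply: h; exists i, j.
  apply/(sepminP (@cb w) ij).
  have [s [spq hs hs1]] := is_argmin_exists (@cb w) (ltW ij).
  have uniq s' : qn R i <= s' <= qn R j -> minat s' (qn R i) (qn R j) (b w) -> s' = s.
    move=> s'pq hs'; apply/eqP/negPn/negP; rewrite neq_lt => /orP[lt|lt];
      apply: h; right; right; apply: (minat_tied (@cb w) _ lt) => //; lra.
  exists s; split.
    have si : s != qn R i.
      by apply/eqP => e; apply: h; left; apply/lowsP => //; rewrite -{1}e.
    have sj : s != qn R j.
      by apply/eqP => e; apply: h; right; left; apply/lowsP => //; rewrite -{1}e.
    move/andP: spq => [h1 h2]; rewrite !lt_neqAle h1 h2 sj andbT/= andbT.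
    by rewrite eq_sym.
  move=> t tpq ts; rewrite lt_neqAle hs// andbT; apply/eqP => e.
  by move/eqP: ts; apply; apply: uniq => // x xpq; rewrite -e; exact: hs.
- apply: measure0_exists => i; first exact: measurable_set_exists.
  exact: (measure0_exists (F := bad i) (mbad i) (bad0 i)).
Qed.

End good_version.

Lemma good_version_exists (R : realType) d (T : measurableType d) (P : probability T R)
    (B : R -> T -> R) : Brownian_motion P B ->
  exists b, [/\ brownian_version P b, forall w, good (b w) & exists N, [/\ measurable N,
    P N = 0%E & forall w, ~ N w -> forall t, 0 <= t <= 1 -> b w t = B t w]].
Proof.
move=> /brownian_version_exists[b [hb [N [mN N0 hN]]]].
pose N' := [set w | ~ good_sample (sample (b w))].
have mN' : measurable N'.
  by apply: measurable_set_not; apply: (measurable_bv_event hb); exact: measurable_good_sample.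
have N'0 : P N' = 0%E := not_good_null hb.
have [w0 /contrapT gw0] := probability_null_exists mN' N'0.
have cb w : continuous (b w) by exact: (@bv_continuous _ _ _ _ _ hb w).
(* The remaining bad paths are replaced by one fixed good path, which exists since almost every path
   is good. *)
pose b' w := if `[< N' w >] then b w0 else b w.
have b'b w : ~ N' w -> b' w = b w by move=> h; rewrite /b' asboolF.
have mb' t : measurable_fun setT (b' ^~ t).
  refine (@measurable_fun_glue _ _ T R N' (fun=> b w0 t) (b ^~ t) (b' ^~ t) mN' _ _ _ _).
  - exact: measurable_cst.
  - exact: bv_measurable hb t.
  - by move=> w Nw; rewrite /b' asboolT.
  - by move=> w Nw; rewrite /b' asboolF.
exists b'; split.
- split=> //.
  + by move=> w; rewrite /b'; case: asboolP => _; exact: bv_start hb _.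
  + by move=> w t; rewrite /b'; case: asboolP => _; exact: bv_clamp hb _ _.
  + by move=> w; rewrite /b'; case: asboolP => _; exact: cb.
  + apply: (gaussian_increments_ae mN' N'0 _ _ _ (bv_gaussian hb)).
    * by move=> t _; exact: bv_measurable hb t.
    * by [].
    * by move=> w /b'b ->.
- move=> w; rewrite /b'; case: asboolP => h; apply/good_sampleP => //.
  exact: contrapT.
- exists (N `|` N'); split; [exact: measurableU|exact: measure0_U|].
  move=> w Nw t t01; have [h1 h2] : ~ N w /\ ~ N' w.
    by split=> h; apply: Nw; [left|right].
  by rewrite b'b// hN.
Qed.

(** * Comparison of product measures by sections *)

Section product_comparison.
Context d1 d2 (S : measurableType d1) (U : measurableType d2) (R : realType)
  (m1 : probability S R) (m2 : probability U R).

Lemma measurable_fun_section_l (A : set (S * U)) : measurable A ->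
  measurable_fun setT (fun x => m2 [set y | A (x, y)]).
Proof.
move=> mA; rewrite (_ : (fun x => _) = m2 \o xsection A); first exact: measurable_fun_xsection.
apply/funext => x /=; congr (m2 _).
by apply/seteqP; split => y /=; rewrite /xsection/= inE.
Qed.

Lemma measurable_fun_section_r (A : set (S * U)) : measurable A ->
  measurable_fun setT (fun y => m1 [set x | A (x, y)]).
Proof.
move=> mA; rewrite (_ : (fun x => _) = m1 \o ysection A); first exact: measurable_fun_ysection.
apply/funext => x /=; congr (m1 _).
by apply/seteqP; split => y /=; rewrite /ysection/= inE.
Qed.

Lemma product_le_l (A B : set (S * U)) : measurable A -> measurable B ->
  (forall x, m2 [set y | A (x, y)] <= m2 [set y | B (x, y)])%E ->
  ((m1 \x m2) A <= (m1 \x m2) B)%E.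
Proof.
move=> mA mB h.
rewrite [leLHS](product_measure_integral_l _ _ mA) [leRHS](product_measure_integral_l _ _ mB).
apply: ge0_le_integral => //; exact: measurable_fun_section_l.
Qed.

Lemma product_le_r (A B : set (S * U)) : measurable A -> measurable B ->
  (forall y, m1 [set x | A (x, y)] <= m1 [set x | B (x, y)])%E ->
  ((m1 \x m2) A <= (m1 \x m2) B)%E.
Proof.
move=> mA mB h.
rewrite [leLHS](product_measure_integral_r _ _ mA) [leRHS](product_measure_integral_r _ _ mB).
apply: ge0_le_integral => //; exact: measurable_fun_section_r.
Qed.

End product_comparison.

Lemma product_law_l d1 d2 d3 (S : measurableType d1) (U : measurableType d2)
    (V : measurableType d3) (R : realType) (m1 : probability S R)
    (m2 : probability U R) (m3 : probability V R) (F : S -> V) (A : set (V * U)) :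
  measurable_fun setT F -> (forall B, measurable B -> m3 B = m1 (F @^-1` B)) ->
  measurable A ->
  (m3 \x m2)%E A = (m1 \x m2)%E [set z | A (F z.1, z.2)].
Proof.
move=> mF hF mA.
have mA' : measurable [set z : S * U | A (F z.1, z.2)].
  apply: (measurable_preimageT (f := fun z : S * U => (F z.1, z.2))) => //.
  apply: measurable_fun_pair; last exact: measurable_snd.
  exact: (measurableT_comp mF measurable_fst).
rewrite [LHS](product_measure_integral_r _ _ mA) [RHS](product_measure_integral_r _ _ mA').
apply: eq_integral => y _; apply: etrans (hF _ _) _ => //.
exact: measurable_section_r.
Qed.

Lemma measurable_fun_setc d d' (E : measurableType d) (S : measurableType d') j
    (t : S -> E) (u : S -> seqsp E) : measurable_fun setT t -> measurable_fun setT u ->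
  measurable_fun setT (fun x => setc j (t x) (u x)).
Proof.
move=> mt mu; apply: measurable_fun_seqP => i; rewrite /setc; case: (i == j) => //.
exact: (measurableT_comp (@measurable_coord _ E i) mu).
Qed.

(** * Shifting one uniform coordinate *)

Section iid_translation.
Context (R : realType) (Q : probability (seqsp (mI01 R)) R).
Hypothesis hQ : forall n A, (forall i, measurable (A i)) ->
  Q (box n A) = (\prod_(i < n) (@mes01 R) (A i))%E.
Local Notation X := (seqsp (mI01 R)).

Lemma setc_setc j (s t : mI01 R) (u : X) : setc j s (setc j t u) = setc j s u.
Proof. by apply/funext => i; rewrite /setc; case: eqP. Qed.

Lemma setc_same j (t : mI01 R) (u : X) : setc j t u j = t.
Proof. by rewrite /setc eqxx. Qed.

(** With the other coordinates frozen, this is the shift of a single uniform point. The amount [a]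
    is constant here; it will be the minimizer of an independent path, frozen by Fubini. *)
Lemma iid_translate m (a e : R) (C : set X) : measurable C -> 0 <= a <= e ->
  (Q [set u | (I01val (u m) + e < 1)%R /\ C (setc m (to01 (I01val (u m) + a)%R) u)]
     <= Q C)%E.
Proof.
move=> mC ae.
have mum : measurable_fun setT (fun u : X => I01val (u m)).
  exact: (measurableT_comp (@measurable_I01val R) (@measurable_coord _ (mI01 R) m)).
have mset : measurable_fun setT (fun u : X => setc m (to01 (I01val (u m) + a)) u).
  apply: measurable_fun_setc; last exact: measurable_id.
  apply: (measurableT_comp (@measurable_to01 R)).
  by apply: measurable_funD => //; exact: measurable_cst.
have mL : measurable [set u : X | I01val (u m) + e < 1 /\
    C (setc m (to01 (I01val (u m) + a)) u)].
  apply: measurable_set_and; last exact: measurable_preimageT.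
  apply: measurable_set_lt; last exact: measurable_cst.
  by apply: measurable_funD => //; exact: measurable_cst.
rewrite (iid_setc hQ m mL) (iid_setc hQ m mC).
have msc := @measurable_setc _ (mI01 R) m.
apply: product_le_r.
- exact: (measurable_preimageT msc mL).
- exact: (measurable_preimageT msc mC).
- move=> u /=.
  rewrite (_ : [set x | _] = [set t : mI01 R | I01val t + e < 1 /\
      [set s | C (setc m s u)] (to01 (I01val t + a))]); last first.
    by apply/seteqP; split => t /=; rewrite setc_same setc_setc.
  apply: mes01_translate => //.
  exact: (measurable_section_r u (measurable_preimageT msc mC)).
Qed.

End iid_translation.

(** * Joint measurability in path and time *)

Section joint_measurability.
Context (R : realType) d (T : measurableType d) (P : probability T R) (b : T -> R -> R).
Hypothesis hb : brownian_version P b.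

(** The time is approximated from below by multiples of [1 / (n + 1)], which take countably many
    values; continuity of the path gives the limit. *)
Lemma measurable_bv_joint dS (S : measurableType dS) (om : S -> T) (th : S -> R) :
  measurable_fun setT om -> measurable_fun setT th ->
  measurable_fun setT (fun x => b (om x) (th x)).
Proof.
move=> mom mth.
have mcl : measurable_fun setT (fun x => clamp 1 (th x)).
  have mc : measurable_fun setT (clamp (1 : R)).
    exact: (continuous_measurable_fun (@continuous_clampe R 1)).
  exact: (measurableT_comp mc mth).
pose k n x := Num.truncn (clamp 1 (th x) * n.+1%:R).
have kitv n x : (k n x)%:R <= clamp 1 (th x) * n.+1%:R < (k n x).+1%:R.
  apply: truncn_itv; rewrite mulr_ge0//; by case/andP: (clamp01 (th x)).
apply: (@measurable_fun_cvg _ _ _ _ (fun n x => b (om x) ((k n x)%:R / n.+1%:R))).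
  move=> n; apply: (@measurable_fun_case_nat _ _ _ _
    (fun j => [set x | j%:R <= clamp 1 (th x) * n.+1%:R /\ clamp 1 (th x) * n.+1%:R < j.+1%:R])
    (fun j x => b (om x) (j%:R / n.+1%:R))).
  - move=> j; have mcn : measurable_fun setT (fun x => clamp 1 (th x) * n.+1%:R).
      by apply: measurable_funM => //; exact: measurable_cst.
    apply: measurable_set_and; first by apply: measurable_set_le => //; exact: measurable_cst.
    by apply: measurable_set_lt => //; exact: measurable_cst.
  - by move=> j; exact: (measurableT_comp (bv_measurable hb _) mom).
  - by move=> x; exists (k n x); have /andP[] := kitv n x.
  - move=> j x [h1 h2]; rewrite /k (@truncn_def _ _ j)//.
    by rewrite h1.
move=> x _; rewrite (bv_clamp hb (om x) (th x)).
apply: (@cvg_comp _ _ _ (fun n => (k n x)%:R / n.+1%:R : R) (b (om x))); last first.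
  exact: (@bv_continuous _ _ _ _ _ hb (om x) (clamp 1 (th x))).
apply/cvgrPdist_lt => e e0.
have := near_infty_natSinv_lt (PosNum e0); apply: filterS => n /=.
apply: le_lt_trans; have /andP[h1 h2] := kitv n x.
have n0 : 0 < n.+1%:R :> R by rewrite ltr0n.
rewrite ler_norml; apply/andP; split.
  rewrite lerBrDl -ler_pdivrMr// in h1 *.
  have : 0 <= n.+1%:R^-1 :> R by rewrite invr_ge0.
  by move: h1; move: ((k n x)%:R / n.+1%:R) => y; move: (n.+1%:R^-1) => v; lra.
rewrite lerBlDl -{2}[n.+1%:R^-1]mul1r -mulrDl ler_pdivlMr//.
by rewrite natr1 ltW.
Qed.

End joint_measurability.

(** * Resampling at a uniform point *)

Section resampling.
Context (R : realType) d (T : measurableType d) (P : probability T R) (b : T -> R -> R).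
Hypotheses (hb : brownian_version P b) (gb : forall w, good (b w)).
Context (Q : probability (seqsp (mI01 R)) R).
Hypothesis hQ : forall n A, (forall i, measurable (A i)) ->
  Q (box n A) = (\prod_(i < n) (@mes01 R) (A i))%E.
Local Notation X := (seqsp (mI01 R)).

Definition resampled m de (z : T * T) (u : X) : seqsp R :=
  sample (resample (I01val (u m)) de (b z.1) (b z.2)).

Lemma measurable_resampled m de :
  measurable_fun setT (fun x : (T * T) * X => resampled m de x.1 x.2).
Proof.
have mth : measurable_fun setT (fun x : (T * T) * X => I01val (x.2 m)).
  apply: (measurableT_comp (@measurable_I01val R)).
  exact: (measurableT_comp (@measurable_coord _ (mI01 R) m) measurable_snd).
have m1 : measurable_fun setT (fun x : (T * T) * X => x.1.1).
  exact: (measurableT_comp measurable_fst measurable_fst).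
have m2 : measurable_fun setT (fun x : (T * T) * X => x.1.2).
  exact: (measurableT_comp measurable_snd measurable_fst).
apply: measurable_fun_seqP => n; rewrite /resampled /sample /resample.
apply: measurable_funD; first apply: measurable_funD.
- apply: (measurable_bv_joint hb) => //.
  by apply: measurable_minr => //; exact: measurable_cst.
- have mc : measurable_fun setT (clamp de) by exact: (continuous_measurable_fun (@continuous_clampe R de)).
  apply: measurable_funB.
    apply: (measurable_bv_joint hb) => //; apply: (measurableT_comp mc).
    by apply: measurable_funB => //; exact: measurable_cst.
  by apply: (measurable_bv_joint hb (th := fun=> 0)) => //; exact: measurable_cst.
- have mde : measurable_fun setT (fun x : (T * T) * X => I01val (x.2 m) + de).
    by apply: measurable_funD => //; exact: measurable_cst.
  apply: measurable_funB; apply: (measurable_bv_joint hb) => //.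
  by apply: measurable_maxr => //; exact: measurable_cst.
Qed.

(** The event [K] has the same probability for the path as for the path resampled on
    [[u m, u m + de]]. Outside [N] the latter leads to [K'] for the first path and for [u] with
    [u m] shifted by the minimizer of the second path. This shift is independent of everything else
    and lies in [[0, de]], so undoing it does not decrease the probability. *)
Lemma resample_shift m de (K : set (seqsp R * X)) (K' : set (T * X))
    (N : set ((T * T) * X)) : 0 < de -> measurable K -> measurable K' -> measurable N ->
  (forall z u, I01val (u m) + de < 1 -> K (resampled m de z u, u) -> ~ N (z, u) ->
     K' (z.1, setc m (to01 (I01val (u m) + argmin 0 de (sample (b z.2)))) u)) ->
  ((P \x Q) [set x | (I01val (x.2 m) + de < 1)%R /\ K (sample (b x.1), x.2)] <=
   (P \x Q) K' + (P \x P \x Q) N)%E.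
Proof.
move=> de0 mK mK' mN h.
have mum d' (S : measurableType d') (F : S -> X) : measurable_fun setT F ->
    measurable [set x | I01val (F x m) + de < 1].
  move=> mF; apply: measurable_set_lt; last exact: measurable_cst.
  apply: measurable_funD; last exact: measurable_cst.
  apply: (measurableT_comp (@measurable_I01val R)).
  exact: (measurableT_comp (@measurable_coord _ (mI01 R) m) mF).
have mb : measurable_fun setT (fun x : T * X => (sample (b x.1), x.2)).
  apply: measurable_fun_pair; last exact: measurable_snd.
  exact: (measurableT_comp (measurable_bv_sample hb) measurable_fst).
pose L : set (T * X) := [set x | I01val (x.2 m) + de < 1 /\ K (sample (b x.1), x.2)].
have mL : measurable L.
  by apply: measurable_set_and; [exact: mum measurable_snd|exact: (measurable_preimageT mb mK)].
pose H : set ((T * T) * X) := [set x | I01val (x.2 m) + de < 1 /\ K (resampled m de x.1 x.2, x.2)].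
have mH : measurable H.
  apply: measurable_set_and; first exact: mum measurable_snd.
  apply: (measurable_preimageT (f := fun x : (T * T) * X => (resampled m de x.1 x.2, x.2))) => //.
  by apply: measurable_fun_pair; [exact: measurable_resampled|exact: measurable_snd].
(* For each fixed [u] the interval is deterministic, so the invariance of the law applies section by
   section; [I01val (u m) + de < 1] keeps the interval inside [[0, 1]]. *)
have LH : ((P \x Q) L = (P \x P \x Q) H)%E.
  rewrite [LHS](product_measure_integral_r _ _ mL) [RHS](product_measure_integral_r _ _ mH).
  apply: eq_integral => u _.
  have [c|c] := pselect (I01val (u m) + de < 1); last first.
    rewrite (_ : [set x | L (x, u)] = set0); last by apply/seteqP; split => x //= [].
    rewrite (_ : [set x | H (x, u)] = set0); last by apply/seteqP; split => x //= [].
    by rewrite !measure0.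
  have mKu : measurable [set g | K (g, u)] by exact: measurable_section_r.
  have /andP[u0 _] := I01val_itv (u m).
  have e1 := bv_resample_law hb (ltW u0) de0 (ltW c) mKu.
  rewrite (_ : [set x | L (x, u)] = [set w | [set g | K (g, u)] (sample (b w))]); last first.
    by apply/seteqP; split => x //= [].
  by apply: etrans e1 _; congr ((P \x P)%E _); apply/seteqP; split => x //= [].
pose a (w : T) := argmin 0 de (sample (b w)).
have ma : measurable_fun setT a.
  apply: measurable_argmin; [exact: measurable_cst..|exact: measurable_bv_sample hb|].
  by move=> _; exact: ltW.
have aP w : 0 <= a w <= de.
  by have [] := argminP (@bv_continuous _ _ _ _ _ hb w) de0.
pose sh (x : (T * T) * X) := setc m (to01 (I01val (x.2 m) + a x.1.2)) x.2.
have msh : measurable_fun setT sh.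
  apply: measurable_fun_setc; last exact: measurable_snd.
  apply: (measurableT_comp (@measurable_to01 R)); apply: measurable_funD.
    apply: (measurableT_comp (@measurable_I01val R)).
    exact: (measurableT_comp (@measurable_coord _ (mI01 R) m) measurable_snd).
  apply: (measurableT_comp ma).
  exact: (measurableT_comp measurable_snd measurable_fst).
have m11 : measurable_fun setT (fun x : (T * T) * X => x.1.1).
  exact: (measurableT_comp measurable_fst measurable_fst).
pose H' : set ((T * T) * X) := [set x | I01val (x.2 m) + de < 1 /\ K' (x.1.1, sh x)].
have mH' : measurable H'.
  apply: measurable_set_and; first exact: mum measurable_snd.
  apply: (measurable_preimageT (f := fun x : (T * T) * X => (x.1.1, sh x))) => //.
  exact: measurable_fun_pair.
have mV : measurable [set x : (T * T) * X | K' (x.1.1, x.2)].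
  apply: (measurable_preimageT (f := fun x : (T * T) * X => (x.1.1, x.2))) => //.
  by apply: measurable_fun_pair; [exact: m11|exact: measurable_snd].
change ((P \x Q) L <= (P \x Q) K' + (P \x P \x Q) N)%E.
rewrite LH; apply: (@le_trans _ _ ((P \x P \x Q) (H' `|` N))%E).
  apply: le_measure; rewrite ?inE//; first exact: measurableU.
  move=> -[z u] [c Ku]; have [Nz|Nz] := pselect (N (z, u)); [by right|left].
  by split=> //; exact: h.
apply: (le_trans (measureU2 _ mH' mN)); apply: leeD => //.
have -> : ((P \x Q) K' = (P \x P \x Q) [set x | K' (x.1.1, x.2)])%E.
  apply: (product_law_l Q (m1 := (P \x P)%E) (m3 := P) (F := fst)) => //.
  move=> B mB; rewrite (_ : fst @^-1` B = B `*` setT); last first.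
    by apply/seteqP; split => x //= [].
  apply/esym; transitivity (P B * P setT)%E; first exact: product_measure1E.
  by rewrite measure_probability_setT mule1.
apply: product_le_l => // -[z1 z2].
exact: (iid_translate hQ m (measurable_section_l z1 mK') (aP z2)).
Qed.

End resampling.

Lemma good_strictmin_inv (R : realType) (f : R -> R) n : good f ->
  exists s, strictmin 0 n.+1%:R^-1 f s.
Proof.
move=> [_ gf]; have [i i0] := qn_rat R 0%Q; have [j jn] := qn_rat R (n.+1%:R^-1).
have jE : qn R j = n.+1%:R^-1 by rewrite jn fmorphV rmorph_nat.
have iE : qn R i = 0 by rewrite i0 rmorph0.
rewrite -jE -iE; apply: gf; rewrite ?iE ?jE ?invr_gt0//.
by rewrite invf_le1// ler1n.
Qed.

Lemma strictmin_resample (R : realType) th de (f g : R -> R) s :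
  strictmin 0 de g s -> strictmin th (th + de) (resample th de f g) (th + s).
Proof.
move=> [/andP[s0 sd] hs]; split; first by lra.
move=> t tpq ts; rewrite !resample_mid; [|lra|lra].
have : g s < g (t - th).
  by apply: hs; [lra|apply: contra ts => /eqP <-; apply/eqP; lra].
by rewrite (addrC th) addrK; lra.
Qed.

(** * Sequences starting with minimizers avoid null sets *)

Section null_avoidance.
Context (R : realType) d (T : measurableType d) (P : probability T R) (b : T -> R -> R).
Hypotheses (hb : brownian_version P b) (gb : forall w, good (b w)).
Local Notation X := (seqsp (mI01 R)).

(** The times [1 - 2^-i] cut [[0, 1)] into infinitely many intervals; the increments of the path
    over them are independent, and each is made uniform by its distribution function. *)
Lemma uniform_sequence_exists : exists Q : probability X R,
  forall n A, (forall i, measurable (A i)) -> Q (box n A) = (\prod_(i < n) (@mes01 R) (A i))%E.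
Proof.
pose t i : R := 1 - 2^-1 ^+ i.
have h0 i : 0 < 2^-1 ^+ i :> R by rewrite exprn_gt0// invr_gt0.
have tS i : t i.+1 - t i = 2^-1 ^+ i.+1 by rewrite /t exprS; lra.
have sd0 i : Num.sqrt (t i.+1 - t i) != 0 by rewrite tS gt_eqF// sqrtr_gt0.
pose F i := sval (cid (normal_prob_to_uniform (sd0 i))).
have mF i : measurable_fun setT (F i) by rewrite /F; case: cid => ? [].
have hF i A : measurable A -> normal_prob 0 (Num.sqrt (t i.+1 - t i)) (F i @^-1` A) = mes01 A.
  by rewrite /F; case: cid => ? [_ /=]; apply.
pose Y (w : T) : X := fun i => F i (b w (t i.+1) - b w (t i)).
have mY : measurable_fun setT Y.
  apply: measurable_fun_seqP => i; apply: (measurableT_comp (mF i)).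
  by apply: measurable_funB; exact: bv_measurable hb _.
pose gY : {mfun T >-> X} := HB.pack Y (isMeasurableFun.Build _ _ _ _ _ mY).
exists (distribution P gY) => n A mA.
have gt : grid n t.
  split; rewrite /t; first by rewrite expr0 subrr.
    by have := h0 n; lra.
  by move=> i _; have := h0 i; rewrite exprS; lra.
have hE : forall x, x \in [::] -> exists2 i, (i <= n)%N & t i = x by [].
have mFA i : measurable (F i @^-1` A i) by rewrite -[X in measurable X]setTI; exact: mF.
apply: etrans (bv_gaussian hb gt hE mFA) _.
by apply: eq_bigr => i _; exact: hF.
Qed.

Context (Q : probability X R).
Hypothesis hQ : forall n A, (forall i, measurable (A i)) ->
  Q (box n A) = (\prod_(i < n) (@mes01 R) (A i))%E.

(** A code for finite tuples of minimizer indices, so that a statement about all tuples of distinct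
    minimizers is a countable conjunction. *)
Definition itvs (k : nat) : nat -> nat := nth 0%N (odflt [::] (unpickle k)).

Lemma itvs_surj (l : nat -> nat) m : exists k, forall i, (i < m)%N -> itvs k i = l i.
Proof. by exists (pickle (mkseq l m)) => i im; rewrite /itvs pickleK/= nth_mkseq. Qed.

Definition ptmix m (l : nat -> nat) (g : seqsp R) (u : X) : X :=
  fun i => if (i < m)%N then pt (l i) g else u i.

Definition distinct m (l : nat -> nat) (g : seqsp R) :=
  forall i j, (i < j)%N -> (j < m)%N -> pt (l i) g <> pt (l j) g.

Definition hits (N : set X) m (g : seqsp R) (u : X) :=
  exists k, distinct m (itvs k) g /\ N (ptmix m (itvs k) g u).

Let measurable_pt_fun dS (S : measurableType dS) l (g : S -> seqsp R) :
  measurable_fun setT g -> measurable_fun setT (fun x => pt l (g x)).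
Proof. exact: (measurableT_comp (measurable_pt l)). Qed.

Lemma measurable_ptmix dS (S : measurableType dS) m l (g : S -> seqsp R) (u : S -> X) :
  measurable_fun setT g -> measurable_fun setT u ->
  measurable_fun setT (fun x => ptmix m l (g x) (u x)).
Proof.
move=> mg mu; apply: measurable_fun_seqP => i; rewrite /ptmix; case: (i < m)%N.
  exact: measurable_pt_fun.
exact: (measurableT_comp (@measurable_coord _ (mI01 R) i) mu).
Qed.

Lemma measurable_distinct dS (S : measurableType dS) m l (g : S -> seqsp R) :
  measurable_fun setT g -> measurable [set x | distinct m l (g x)].
Proof.
move=> mg; apply: measurable_set_forall => i; apply: measurable_set_forall => j.
do 2! (apply: measurable_set_imp; first exact: measurable_set_const).
apply: measurable_set_not; apply: measurable_set_eqI01; exact: measurable_pt_fun.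
Qed.

Lemma measurable_hits dS (S : measurableType dS) N m (g : S -> seqsp R) (u : S -> X) :
  measurable N -> measurable_fun setT g -> measurable_fun setT u ->
  measurable [set x | hits N m (g x) (u x)].
Proof.
move=> mN mg mu; apply: measurable_set_exists => k.
apply: measurable_set_and; first exact: measurable_distinct.
by apply: measurable_preimageT => //; exact: measurable_ptmix.
Qed.

Let mb1 : measurable_fun setT (fun x : T * X => sample (b x.1)).
Proof. exact: (measurableT_comp (measurable_bv_sample hb) measurable_fst). Qed.

(** The event of the induction step: the minimizer of the interval of length [de] at [u m], put at
    place [m] after [m] distinct minimizers that lie outside this interval, produces a point of
    [N]. *)
Let trap (N : set X) m (de : R) (x : seqsp R * X) := good_sample x.1 /\
  exists k, distinct m (itvs k) x.1 /\
    ((forall i, (i < m)%N -> ~ (I01val (x.2 m) <= I01val (pt (itvs k i) x.1)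
                                <= I01val (x.2 m) + de)) /\
     N (setc m (to01 (argmin (I01val (x.2 m)) (I01val (x.2 m) + de) x.1))
         (ptmix m (itvs k) x.1 x.2))).

Let measurable_trap N m de : 0 < de -> measurable N -> measurable (trap N m de).
Proof.
move=> de0 mN.
have mc : measurable_fun setT (fun x : seqsp R * X => I01val (x.2 m)).
  apply: (measurableT_comp (@measurable_I01val R)).
  exact: (measurableT_comp (@measurable_coord _ (mI01 R) m) measurable_snd).
have mcd : measurable_fun setT (fun x : seqsp R * X => I01val (x.2 m) + de).
  by apply: measurable_funD => //; exact: measurable_cst.
apply: measurable_set_and.
  exact: (measurable_preimageT measurable_fst (@measurable_good_sample R)).
apply: measurable_set_exists => k; apply: measurable_set_and.
  exact: measurable_distinct measurable_fst.
apply: measurable_set_and.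
  apply: measurable_set_forall => i; apply: measurable_set_imp.
    exact: measurable_set_const.
  apply: measurable_set_not.
  have mp : measurable_fun setT (fun x : seqsp R * X => I01val (pt (itvs k i) x.1)).
    apply: (measurableT_comp (@measurable_I01val R)).
    exact: measurable_pt_fun measurable_fst.
  rewrite (_ : (fun x => _) = [set x : seqsp R * X | I01val (x.2 m) <= I01val (pt (itvs k i) x.1) /\
     I01val (pt (itvs k i) x.1) <= I01val (x.2 m) + de]).
    by apply: measurable_set_and; exact: measurable_set_le.
  by apply/seteqP; split => x /=; [move/andP|move=> [h1 h2]; rewrite h1 h2].
apply: (measurable_preimageT (f := fun x : seqsp R * X =>
  setc m (to01 (argmin (I01val (x.2 m)) (I01val (x.2 m) + de) x.1))
    (ptmix m (itvs k) x.1 x.2))) => //.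
apply: measurable_fun_setc.
  apply: (measurableT_comp (@measurable_to01 R)).
  by apply: (measurable_argmin mc mcd measurable_fst) => x; lra.
by apply: measurable_ptmix; [exact: measurable_fst|exact: measurable_snd].
Qed.

(** Minimizers of the resampled path outside the interval are minimizers of the first path too, and
    the minimizer inside is [u m] shifted by that of the second path. So the trap becomes a hit with
    [m] minimizers and a shifted [u m]. *)
Let trap_hits N m de z (u : X) : 0 < de -> trap N m de (resampled b m de z u, u) ->
  hits N m (sample (b z.1))
    (setc m (to01 (I01val (u m) + argmin 0 de (sample (b z.2)))) u).
Proof.
move=> de0 [/= gr [k [dk [ok Nk]]]].
have cr : continuous (resample (I01val (u m)) de (b z.1) (b z.2)).
  by apply: continuous_resample; [case: (gb z.1)|case: (gb z.2)].
have {}gr := (good_sampleP cr).1 gr.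
have h i : exists l, (i < m)%N -> pt l (sample (b z.1)) = pt (itvs k i) (resampled b m de z u).
  have [im|_] := boolP (i < m)%N; last by exists 0%N.
  have lmr := good_pt_local (itvs k i) gr.
  have out := ok i im.
  have lm : local_minimizers (b z.1) (I01val (pt (itvs k i) (resampled b m de z u))).
    apply: local_min_resample lmr; first exact: ltW.
    by case: (ltP (I01val (pt (itvs k i) (resampled b m de z u))) (I01val (u m))) => h1;
      [left|right; rewrite ltNge; apply/negP => h2; apply: out; rewrite h1].
  have [l hl] := good_pt_surj (gb z.1).1 lm.
  by exists l => _; exact: I01val_inj.
have [k' hk'] := itvs_surj (fun i => sval (cid (h i))) m.
have {h hk'} hk' i : (i < m)%N ->
    pt (itvs k' i) (sample (b z.1)) = pt (itvs k i) (resampled b m de z u).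
  by move=> im; rewrite hk'//; case: cid => l /=; apply.
exists k'; split.
  by move=> i j ij jm; rewrite !hk'//; [exact: dk|exact: ltn_trans ij jm].
rewrite (_ : ptmix _ _ _ _ = setc m (to01 (argmin (I01val (u m)) (I01val (u m) + de)
  (resampled b m de z u))) (ptmix m (itvs k) (resampled b m de z u) u))//.
rewrite /resampled (argmin_resample_mid _ (gb z.1).1 (gb z.2).1 de0).
apply/funext => i; rewrite /ptmix /setc; move: (to01 _) => t.
have [im|im] := ltnP i m; last by [].
by rewrite (ltn_eqF im) -/(resampled b m de z u) hk'.
Qed.

(** By induction, [resample_shift] and [trap_hits] make all traps null. If [m + 1] distinct
    minimizers gave a point of [N], then every position of [u m] slightly to the left of the last
    one would be a trap, and these positions have positive measure. *)
Lemma null_avoid N m : measurable N -> Q N = 0%E ->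
  (P \x Q)%E [set x | hits N m (sample (b x.1)) x.2] = 0%E.
Proof.
move=> mN N0.
have mh k : measurable [set x : T * X | hits N k (sample (b x.1)) x.2].
  by apply: measurable_hits => //; exact: measurable_snd.
elim: m => [|m ih].
  apply: (product_null_r (mh 0%N) mN N0) => u Nu.
  rewrite (_ : [set x | _] = set0) ?measure0//.
  by apply/seteqP; split => w //= [k [_]].
pose de n : R := n.+1%:R^-1.
have de0 n : 0 < de n by rewrite invr_gt0.
pose G (x : T * X) := exists n, I01val (x.2 m) + de n < 1 /\ trap N m (de n) (sample (b x.1), x.2).
have mGn n : measurable [set x : T * X | I01val (x.2 m) + de n < 1 /\
    trap N m (de n) (sample (b x.1), x.2)].
  apply: measurable_set_and.
    apply: measurable_set_lt; last exact: measurable_cst.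
    apply: measurable_funD; last exact: measurable_cst.
    apply: (measurableT_comp (@measurable_I01val R)).
    exact: (measurableT_comp (@measurable_coord _ (mI01 R) m) measurable_snd).
  apply: (measurable_preimageT (f := fun x : T * X => (sample (b x.1), x.2))); last first.
    exact: measurable_trap.
  by apply: measurable_fun_pair => //; exact: measurable_snd.
have mG : measurable G by exact: measurable_set_exists.
have G0 : (P \x Q)%E G = 0%E.
  apply: (measure0_exists mGn) => n; apply/eqP; rewrite eq_le measure_ge0 andbT.
  apply: (le_trans (resample_shift hb hQ (m := m) (N := set0) (de0 n)
    (measurable_trap m (de0 n) mN) (mh m) measurable0 _)).
    by move=> z u _ t _; exact: trap_hits.
  by rewrite ih measure0 adde0.
have [mS S0] := null_section_l mG G0.
apply: (product_null_l (mh m.+1) mS S0) => w /contrapT Gw.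
have mGw : measurable [set u | G (w, u)] by exact: measurable_section_l.
rewrite (iid_setc hQ m mGw) in Gw.
have mGw' : measurable [set z : mI01 R * X | [set u | G (w, u)] (setc m z.1 z.2)].
  exact: (measurable_preimageT (@measurable_setc _ (mI01 R) m) mGw).
have [mS' S'0] := null_section_r mGw' Gw.
apply: (measure0_sub (measurable_section_l w (mh m.+1)) mS') S'0 => u /=.
move=> [k [dk Nk]].
pose s := I01val (pt (itvs k m) (sample (b w))).
have lms : local_minimizers (b w) s := good_pt_local _ (gb w).
have [e e0 [[e1 e2] he]] := local_min_strict lms.
(* [n] is taken so large that every interval of length [de n] containing [s] has [s] as its strict
   minimizer and contains no other chosen minimizer. *)
have h1 : \forall n \near \oo, de n < e := near_infty_natSinv_lt (PosNum e0).
have h2 : \forall n \near \oo, forall i, (i < m)%N ->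
    de n < `|I01val (pt (itvs k i) (sample (b w))) - s|.
  apply: near_forall_lt => i im.
  have r0 : 0 < `|I01val (pt (itvs k i) (sample (b w))) - s|.
    rewrite normr_gt0 subr_eq0; apply/eqP => /I01val_inj; exact: dk.
  exact: (near_infty_natSinv_lt (PosNum r0)).
have [n [ne hn]] := filter_ex (filterI h1 h2).
have dn := de0 n.
move=> la0.
have mI : measurable [set t : mI01 R | s - de n < I01val t /\ I01val t < s].
  by apply: measurable_set_and; apply: measurable_set_lt;
    [exact: measurable_cst|exact: measurable_I01val|exact: measurable_I01val|exact: measurable_cst].
(* All these values of [u m] are traps and thus form a null set, although they fill an interval of
   length [de n]. *)
have : mes01 [set t : mI01 R | s - de n < I01val t /\ I01val t < s] = 0%E.
  apply: (measure0_sub mI (measurable_section_r u mGw')) la0 => t /= [t1 t2].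
  exists n => /=; rewrite setc_same; split; first by lra.
  split; first exact: ((good_sampleP (gb w).1).2 (gb w)).
  exists k; split; first by move=> i j ij jm; apply: dk => //; exact: ltnW.
  rewrite /= setc_same; split.
    move=> i im /andP[i1 i2]; have := hn i im; rewrite ltNge => /negP; apply.
    by clear -i1 i2 t1 t2; rewrite ler_norml; apply/andP; split; lra.
  rewrite (_ : argmin _ _ _ = s); last first.
    apply: argminE; [exact: (gb w).1|lra|].
    apply: is_argmin_strict; first by lra.
    move=> x xpq xs; apply: he => //; clear -xpq t1 t2 ne.
    by rewrite ltr_norml; apply/andP; split; lra.
  rewrite (_ : setc _ _ _ = ptmix m.+1 (itvs k) (sample (b w)) u)//.
  apply/funext => i; rewrite /setc /ptmix ltnS; case: (ltngtP i m) => // ->.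
  by rewrite /s I01valK.
rewrite /mes01 (_ : _ @` _ = `]s - de n, s[%classic).
  rewrite lebesgue_measure_itv/= lte_fin ifT; last by lra.
  by move/eqP; rewrite -EFinB eqe; apply/negP; rewrite gt_eqF//; lra.
apply/seteqP; split => x /=; first by move=> [t [t1 t2] <-]; rewrite in_itv/= t1.
rewrite in_itv/= => /andP[x1 x2].
by exists (to01 x); rewrite to01K//; clear -x1 x2 e1 e2 e0 ne; lra.
Qed.

Definition regular (f : R -> R) (u : X) := forall j,
  ~ local_minimizers f (I01val (u j)) /\
  forall n, I01val (u j) + n.+1%:R^-1 < 1 ->
    exists s, strictmin (I01val (u j)) (I01val (u j) + n.+1%:R^-1) f s.

(** No [u j] is a minimizer, since minimizers are countably many and the uniform law has no atoms.
    The minimum on an interval starting at [u j] is strict and interior because after resampling it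
    is the minimum of the second path over [[0, 1 / (n + 1)]]. *)
Lemma regular_ae : exists N : set (T * X), [/\ measurable N, (P \x Q)%E N = 0%E &
  forall w u, ~ N (w, u) -> regular (b w) u].
Proof.
have mc j : measurable_fun setT (fun x : T * X => I01val (x.2 j)).
  apply: (measurableT_comp (@measurable_I01val R)).
  exact: (measurableT_comp (@measurable_coord _ (mI01 R) j) measurable_snd).
pose N1 (x : T * X) := exists j, exists l, pt l (sample (b x.1)) = x.2 j.
pose N2 (x : T * X) := exists j, exists n, I01val (x.2 j) + n.+1%:R^-1 < 1 /\
  ~ sepmin (I01val (x.2 j)) (I01val (x.2 j) + n.+1%:R^-1) (sample (b x.1)).
have m1 j l : measurable [set x : T * X | pt l (sample (b x.1)) = x.2 j].
  apply: measurable_set_eqI01; first exact: measurable_pt_fun.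
  exact: (measurableT_comp (@measurable_coord _ (mI01 R) j) measurable_snd).
have msep j n : measurable [set x : seqsp R * X |
    ~ sepmin (I01val (x.2 j)) (I01val (x.2 j) + n.+1%:R^-1) x.1].
  have mc' : measurable_fun setT (fun x : seqsp R * X => I01val (x.2 j)).
    apply: (measurableT_comp (@measurable_I01val R)).
    exact: (measurableT_comp (@measurable_coord _ (mI01 R) j) measurable_snd).
  have mcd : measurable_fun setT (fun x : seqsp R * X => I01val (x.2 j) + n.+1%:R^-1).
    by apply: measurable_funD => //; exact: measurable_cst.
  exact: (measurable_set_not (measurable_sepmin mc' mcd measurable_fst)).
have m2 j n : measurable [set x : T * X | I01val (x.2 j) + n.+1%:R^-1 < 1 /\
    ~ sepmin (I01val (x.2 j)) (I01val (x.2 j) + n.+1%:R^-1) (sample (b x.1))].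
  apply: measurable_set_and.
    apply: measurable_set_lt; last exact: measurable_cst.
    by apply: measurable_funD => //; exact: measurable_cst.
  apply: (measurable_preimageT (f := fun x : T * X => (sample (b x.1), x.2)) _ (msep j n)).
  by apply: measurable_fun_pair => //; exact: measurable_snd.
have mN1 : measurable N1.
  by apply: measurable_set_exists => j; apply: measurable_set_exists => l; exact: m1.
have mN2 : measurable N2.
  by apply: measurable_set_exists => j; apply: measurable_set_exists => l; exact: m2.
have N10 : (P \x Q)%E N1 = 0%E.
  apply: measure0_exists => j; first by apply: measurable_set_exists => l; exact: m1.
  apply: (measure0_exists (m1 j)) => l.
  apply: (product_null_l (m1 j l) measurable0 (measure0 _)) => w _.
  have mC := measurable_section_l w (m1 j l).
  apply: etrans (iid_setc hQ j mC) _.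
  have mC' := measurable_preimageT (@measurable_setc _ (mI01 R) j) mC.
  apply: (product_null_r mC' measurable0 (measure0 _)) => u _ /=.
  rewrite (_ : [set x | _] = [set pt l (sample (b w))]) ?mes01_set1//.
  by apply/seteqP; split => t /=; rewrite setc_same.
have N20 : (P \x Q)%E N2 = 0%E.
  apply: measure0_exists => j; first by apply: measurable_set_exists => l; exact: m2.
  apply: (measure0_exists (m2 j)) => n; apply/eqP; rewrite eq_le measure_ge0 andbT.
  have de0 : 0 < n.+1%:R^-1 :> R by rewrite invr_gt0.
  (* The resampled path never violates the condition, so the target event [K'] can be empty. *)
  apply: (le_trans (resample_shift hb hQ (m := j) (K' := set0) (N := set0) de0 (msep j n)
     measurable0 measurable0 _)); last by rewrite !measure0 adde0.
  move=> z u _ /= ns _; apply: ns.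
  have [s hs] := good_strictmin_inv n (gb z.2).
  have cr : continuous (resample (I01val (u j)) n.+1%:R^-1 (b z.1) (b z.2)).
    by apply: continuous_resample; [case: (gb z.1)|case: (gb z.2)].
  apply/(sepminP cr); first by rewrite ltrDl.
  by exists (I01val (u j) + s); exact: strictmin_resample.
exists (N1 `|` N2); split; [exact: measurableU|exact: measure0_U|].
move=> w u hN j; split.
  move=> /(good_pt_surj (gb w).1)[l hl]; apply: hN; left; exists j, l.
  exact: I01val_inj.
move=> n c; apply: contrapT => h; apply: hN; right; exists j, n; split=> //=.
move=> sep; apply: h; apply/(sepminP (gb w).1) => //.
by rewrite ltrDl invr_gt0.
Qed.

End null_avoidance.

(** * Replacing independent points by minimizers *)

Section schemes.
Context (R : realType).
Local Notation X := (seqsp (mI01 R)).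
Local Notation PP := (seqsp R).
Implicit Types (f h : R -> R) (g : PP) (u y : X).

(* A scheme replaces the first [m] points of [u] by distinct minimizers of the path. It
   is unaffected by resampling the path in a short interval starting at a later [u j]. *)
Record scheme (m : nat) (Psi : PP -> X -> X) : Prop := {
  scheme_measurable : measurable_fun setT (fun x : PP * X => Psi x.1 x.2) ;
  scheme_tail : forall g u i, (m <= i)%N -> Psi g u i = u i ;
  scheme_head : forall g u u', (forall i, (i < m)%N -> u i = u' i) ->
    forall i, (i < m)%N -> Psi g u i = Psi g u' i ;
  scheme_pts : forall f u, good f -> forall i, (i < m)%N ->
    exists l, Psi (sample f) u i = pt l (sample f) ;
  scheme_inj : forall f u, good f -> forall i j, (i < j)%N -> (j < m)%N ->
    Psi (sample f) u i <> Psi (sample f) u j ;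
  scheme_stable : forall f h u j i, good f -> continuous h -> regular f u ->
    (m <= j)%N -> (i < m)%N ->
    \forall n \near \oo, Psi (sample (resample (I01val (u j)) n.+1%:R^-1 f h)) u i =
      Psi (sample f) u i }.

(** A rule for place [j], given the path and a sequence [y] whose coordinates below [j] are already
    replaced. It may still read the uniform [y j], hence [i <= j] in [selector_local]. In
    [selector_stable], [y_ n] stands for the sequence built from the resampled path. *)
Record selector (j : nat) (c : PP -> X -> mI01 R) : Prop := {
  selector_measurable : measurable_fun setT (fun x : PP * X => c x.1 x.2) ;
  selector_local : forall g y y', (forall i, (i <= j)%N -> y i = y' i) -> c g y = c g y' ;
  selector_pts : forall f y, good f -> exists l, c (sample f) y = pt l (sample f) ;
  selector_new : forall f y, good f -> forall i, (i < j)%N -> c (sample f) y <> y i ;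
  selector_stable : forall f h u y (y_ : nat -> X) j', good f -> continuous h ->
    regular f u -> (j < j')%N -> y j = u j -> (forall n, y_ n j = u j) ->
    (forall i, (i < j)%N -> \forall n \near \oo, y_ n i = y i) ->
    \forall n \near \oo, c (sample (resample (I01val (u j')) n.+1%:R^-1 f h)) (y_ n) =
      c (sample f) y }.

Definition extend j (c : PP -> X -> mI01 R) (Psi : PP -> X -> X) g u :=
  setc j (c g (Psi g u)) (Psi g u).

Lemma scheme_extend j c Psi : scheme j Psi -> selector j c -> scheme j.+1 (extend j c Psi).
Proof.
move=> sP sc.
have mP := scheme_measurable sP.
have tj g u : Psi g u j = u j by rewrite (scheme_tail sP).
split.
- apply: measurable_fun_setc => //.
  have mp : measurable_fun setT (fun x : PP * X => (x.1, Psi x.1 x.2)).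
    by apply: measurable_fun_pair => //; exact: measurable_fst.
  exact: (measurableT_comp (selector_measurable sc) mp).
- move=> g u i ji; rewrite /extend /setc gtn_eqF// (scheme_tail sP)//; exact: ltnW.
- move=> g u u' uu' i; rewrite ltnS => ij.
  have e k : (k <= j)%N -> Psi g u k = Psi g u' k.
    rewrite leq_eqVlt => /orP[/eqP ->|kj]; first by rewrite !tj uu'.
    by apply: (scheme_head sP) => // i' i'j; apply: uu'; exact: ltnW.
  rewrite /extend /setc; case: eqP => _; last exact: e.
  exact: selector_local sc _ _ _ e.
- move=> f u gf i; rewrite ltnS /extend /setc leq_eqVlt; case: eqP => [_ _|_ /= ij].
    exact: selector_pts sc _ _ gf.
  exact: scheme_pts sP _ _ gf _ ij.
- move=> f u gf i k ik; rewrite ltnS leq_eqVlt /extend /setc => /orP[/eqP kj|kj].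
    rewrite kj eqxx ltn_eqF -?kj//.
    by apply/nesym; apply: (selector_new sc) => //; rewrite -kj.
  rewrite !ltn_eqF//; last exact: ltn_trans ik kj.
  exact: scheme_inj sP _ _ gf _ _ ik kj.
- move=> f h u k i gf ch rf jk; rewrite ltnS leq_eqVlt => /orP[/eqP ->|ij].
    near=> n; rewrite /extend !setc_same; near: n.
    apply: (selector_stable sc gf ch rf) => // i' i'j.
    by apply: (scheme_stable sP) => //; exact: ltnW.
  near=> n; rewrite /extend /setc !ltn_eqF//; near: n.
  by apply: (scheme_stable sP) => //; exact: ltnW.
Unshelve. all: by end_near. Qed.

Lemma pt_stable f h th l : good f -> continuous h -> ~ local_minimizers f th ->
  \forall n \near \oo, pt l (sample (resample th n.+1%:R^-1 f h)) = pt l (sample f).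
Proof.
move=> gf ch nM; have [s hs ptE] := good_pt l gf.
have [l0 lh h1] := lo_hi R l.
have ths : th != s.
  by apply/eqP => e; apply: nM; rewrite e; exact: strictmin_local hs.
have [/andP[s0 s1] hs'] := hs.
have [dl dl0 hdl] := argmin_resample_stable gf.1 ch lh (s := s)
  ltac:(by rewrite !ltW) hs' ths.
have := near_infty_natSinv_lt (PosNum dl0); apply: filterS => n /= nd.
rewrite /pt hdl; last by rewrite nd andbT invr_ge0 ler0n.
by rewrite (strictmin_argmin gf.1 hs).
Qed.

Lemma next_pt_local m g y y' : (forall i, (i < m)%N -> y i = y' i) ->
  next_pt m g y = next_pt m g y'.
Proof.
move=> h; have e : fresh m g y = fresh m g y'.
  apply/funext => l; apply/propext; split=> fl i im; [rewrite -h//|rewrite h//]; exact: fl.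
by rewrite /next_pt e.
Qed.

Lemma selector_next_pt j : selector j (next_pt j).
Proof.
split.
- by apply: measurable_next_pt; [exact: measurable_fst|exact: measurable_snd].
- by move=> g y y' h; apply: next_pt_local => i ij; apply: h; exact: ltnW.
- move=> f y gf; have [l [_ _ ->]] := next_ptP (good_fresh j y gf).
  by exists l.
- by move=> f y gf i ij; have [_] := good_next_pt j y gf; apply.
- move=> f h u y y_ j' gf ch rf jj' _ _ hy; apply: next_pt_stable => //.
    by move=> l; apply: pt_stable => //; have [] := rf j'.
  exact: good_fresh.
Qed.

Definition near_pt n (t : mI01 R) g : mI01 R :=
  to01 (argmin (I01val t) (I01val t + n.+1%:R^-1) g).

(** The clause with [pt l] makes sure that the candidate is a genuine local minimizer rather than a
    minimum at an end point of the interval. *)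
Definition near_pt_ok n j g y := I01val (y j) + n.+1%:R^-1 < 1 /\
  ((exists l, pt l g = near_pt n (y j) g) /\ forall i, (i < j)%N -> near_pt n (y j) g <> y i).

(* [next_pt] is a fallback: a short interval after the uniform point [y j] has its minimum
   inside and away from the points chosen before with probability close to 1. *)
Definition close_pt n j g y :=
  if `[< near_pt_ok n j g y >] then near_pt n (y j) g else next_pt j g y.

Lemma measurable_near_pt n dS (S : measurableType dS) (t : S -> mI01 R) (g : S -> PP) :
  measurable_fun setT t -> measurable_fun setT g ->
  measurable_fun setT (fun x => near_pt n (t x) (g x)).
Proof.
move=> mt mg; apply: (measurableT_comp (@measurable_to01 R)).
have mi : measurable_fun setT (fun x => I01val (t x)).
  exact: (measurableT_comp (@measurable_I01val R) mt).
apply: measurable_argmin => //; first by apply: measurable_funD => //; exact: measurable_cst.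
by move=> x; rewrite lerDl invr_ge0.
Qed.

Lemma selector_close_pt n j : selector j (close_pt n j).
Proof.
have coord i : measurable_fun setT (fun x : PP * X => x.2 i).
  exact: (measurableT_comp (@measurable_coord _ (mI01 R) i) measurable_snd).
have mn : measurable_fun setT (fun x : PP * X => near_pt n (x.2 j) x.1).
  by apply: measurable_near_pt => //; exact: measurable_fst.
split.
- apply: (@measurable_fun_glue _ _ (PP * X)%type (mI01 R) [set x | near_pt_ok n j x.1 x.2]
    (fun x => near_pt n (x.2 j) x.1) (fun x => next_pt j x.1 x.2)).
  + apply: measurable_set_and.
      apply: measurable_set_lt; last exact: measurable_cst.
      apply: measurable_funD; last exact: measurable_cst.
      exact: (measurableT_comp (@measurable_I01val R) (coord j)).
    apply: measurable_set_and.
      apply: measurable_set_exists => l; apply: measurable_set_eqI01 => //.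
      exact: (measurableT_comp (measurable_pt l) measurable_fst).
    apply: measurable_set_forall => i; apply: measurable_set_imp.
      exact: measurable_set_const.
    by apply: measurable_set_not; exact: measurable_set_eqI01.
  + exact: mn.
  + by apply: measurable_next_pt; [exact: measurable_fst|exact: measurable_snd].
  + by move=> x ok; rewrite /close_pt asboolT.
  + by move=> x ok; rewrite /close_pt asboolF.
- move=> g y y' h; have e : near_pt_ok n j g y = near_pt_ok n j g y'.
    rewrite /near_pt_ok (h j)//; apply/propext; split=> -[? [? hi]]; split=> //;
      split=> // i ij; [rewrite -(h i (ltnW ij))|rewrite (h i (ltnW ij))]; exact: hi.
  rewrite /close_pt e (h j)//; case: asboolP => // _.
  by apply: next_pt_local => i ij; apply: h; exact: ltnW.
- move=> f y gf; rewrite /close_pt; case: asboolP => [[_ [[l <-] _]]|_]; first by exists l.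
  exact: selector_pts (selector_next_pt j) _ _ gf.
- move=> f y gf i ij; rewrite /close_pt; case: asboolP => [[_ [_]]|_]; first exact.
  exact: selector_new (selector_next_pt j) _ _ gf _ ij.
move=> f h u y y_ j' gf ch rf jj' yj y_j hy.
have nextst := selector_stable (selector_next_pt j) gf ch rf jj' yj y_j hy.
have hy' := near_forall_lt hy.
have [c|c] := pselect (I01val (u j) + n.+1%:R^-1 < 1); last first.
  apply: filterS nextst => k e; rewrite /close_pt !asboolF//.
    by move=> []; rewrite yj.
  by move=> []; rewrite y_j.
have [_ /(_ n c)[s hs]] := rf j.
have /andP[uj0 uj1] := I01val_itv (u j).
have n0 : 0 < n.+1%:R^-1 :> R by rewrite invr_gt0.
have lms : local_minimizers f s by apply: strictmin_local hs; rewrite ltW.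
have ths : I01val (u j') != s by apply/eqP => e; have [] := rf j'; rewrite e.
have [/andP[s0 s1] hs'] := hs.
have [dl dl0 hdl] := argmin_resample_stable gf.1 ch (p := I01val (u j))
  (q := I01val (u j) + n.+1%:R^-1) (s := s) ltac:(by rewrite ltrDl) ltac:(by rewrite !ltW) hs' ths.
have [l hl] := good_pt_surj gf.1 lms.
have ptl := pt_stable l gf ch (rf j').1.
have nE : near_pt n (u j) (sample f) = to01 s.
  by rewrite /near_pt (strictmin_argmin gf.1 hs).
have lE : pt l (sample f) = to01 s by rewrite -hl I01valK.
have nE' : \forall k \near \oo,
    near_pt n (u j) (sample (resample (I01val (u j')) k.+1%:R^-1 f h)) = to01 s.
  have := near_infty_natSinv_lt (PosNum dl0); apply: filterS => k /= kd.
  by rewrite /near_pt hdl// kd andbT invr_ge0 ler0n.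
near=> k.
have e1 : pt l (sample (resample (I01val (u j')) k.+1%:R^-1 f h)) = pt l (sample f) by near: k.
have e2 : near_pt n (u j) (sample (resample (I01val (u j')) k.+1%:R^-1 f h)) = to01 s by near: k.
have e3 : forall i, (i < j)%N -> y_ k i = y i by near: k.
have e4 : next_pt j (sample (resample (I01val (u j')) k.+1%:R^-1 f h)) (y_ k) =
  next_pt j (sample f) y by near: k.
(* Candidate and earlier points are all unchanged by a short enough resampling, so whether the
   candidate is new is decided in the same way for both paths. *)
have [new|old] := pselect (forall i, (i < j)%N -> to01 s <> y i).
  rewrite /close_pt !asboolT /near_pt_ok ?yj ?y_j ?nE ?e2//.
    by split=> //; split=> //; exists l.
  by split=> //; split; [exists l; rewrite e1|move=> i ij; rewrite e3//; exact: new].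
rewrite /close_pt !asboolF /near_pt_ok ?yj ?y_j ?nE ?e2//.
  by move=> [_ [_]].
by move=> [_ [_ new]]; apply: old => i ij; rewrite -e3//; exact: new.
Unshelve. all: by end_near. Qed.

(** * Moving the new point to a random place *)

Definition slot L (t : mI01 R) := Num.truncn (L%:R * I01val t).

Lemma slotP L t : (slot L t)%:R <= L%:R * I01val t < (slot L t).+1%:R.
Proof. by apply: truncn_itv; rewrite mulr_ge0//; case/andP: (I01val_itv t) => /ltW. Qed.

Lemma slotE L t j : j%:R <= L%:R * I01val t -> L%:R * I01val t < j.+1%:R -> slot L t = j.
Proof. by move=> h1 h2; apply: truncn_def; rewrite h1. Qed.

Lemma slot_lt L t : (0 < L)%N -> (slot L t < L)%N.
Proof.
move=> L0; rewrite -(ltr_nat R); have /andP[h _] := slotP L t.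
apply: (le_lt_trans h); rewrite gtr_pMr ?ltr0n//.
by have /andP[] := I01val_itv t.
Qed.

Lemma measurable_slot L j : measurable [set t : mI01 R | slot L t = j].
Proof.
rewrite (_ : [set t | _] = [set t : mI01 R | j%:R <= L%:R * I01val t /\ L%:R * I01val t < j.+1%:R]).
  have m : measurable_fun setT (fun t : mI01 R => L%:R * I01val t).
    by apply: measurable_funM; [exact: measurable_cst|exact: measurable_I01val].
  by apply: measurable_set_and; [apply: measurable_set_le|apply: measurable_set_lt] => //;
    exact: measurable_cst.
apply/seteqP; split => t /=; last by move=> [h1 h2]; exact: slotE.
by move=> <-; have /andP[] := slotP L t.
Qed.

Definition transp m j i := if i == m then (m + j)%N else if i == (m + j)%N then m else i.

Lemma transpK m j : involutive (transp m j).
Proof.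
move=> i; rewrite /transp; case: (eqVneq i m) => [->|im].
  by rewrite eqxx; case: eqP => // ->.
case: (eqVneq i (m + j)%N) => [->|imj]; first by rewrite eqxx.
by rewrite (negbTE im) (negbTE imj).
Qed.

Lemma transp_id m j i : (i < m)%N \/ (m + j < i)%N -> transp m j i = i.
Proof.
rewrite /transp => -[h|h].
  by rewrite !ltn_eqF// (leq_trans h)// leq_addr.
by rewrite !gtn_eqF// (leq_ltn_trans _ h)// leq_addr.
Qed.

Lemma transp_lt m j L i : (j < L)%N -> (i < m + L)%N -> (transp m j i < m + L)%N.
Proof.
move=> jL iL; rewrite /transp; case: eqP => _; first by rewrite ltn_add2l.
by case: eqP => // _; rewrite -[ltnLHS]addn0 ltn_add2l (leq_ltn_trans _ jL).
Qed.

(* The uniform variable [u m], whose place is taken by a minimizer, serves to choose the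
   place where that minimizer is inserted. *)
Definition shuffle m L (Psi : PP -> X -> X) g u := reidx (transp m (slot L (u m))) (Psi g u).

Lemma scheme_shuffle m L Psi : (0 < L)%N -> scheme (m + L) Psi ->
  scheme (m + L) (shuffle m L Psi).
Proof.
move=> L0 sP; have mmL : (m < m + L)%N by rewrite -[ltnLHS]addn0 ltn_add2l.
have lt u i : (i < m + L)%N -> (transp m (slot L (u m)) i < m + L)%N.
  by apply: transp_lt; exact: slot_lt.
split.
- apply: (@measurable_fun_case_nat _ _ _ _ (fun j => [set x : PP * X | slot L (x.2 m) = j])
    (fun j x => reidx (transp m j) (Psi x.1 x.2))).
  + move=> j; apply: (measurable_preimageT (f := fun x : PP * X => x.2 m) _ (measurable_slot L j)).
    exact: (measurableT_comp (@measurable_coord _ (mI01 R) m) measurable_snd).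
  + by move=> j; exact: (measurableT_comp (@measurable_reidx _ (mI01 R) _) (scheme_measurable sP)).
  + by move=> x; exists (slot L (x.2 m)).
  + by move=> j x /= <-.
- move=> g u i hi; rewrite /shuffle /reidx transp_id ?(scheme_tail sP)//.
  by right; apply: leq_trans hi; rewrite ltn_add2l slot_lt.
- move=> g u u' uu' i hi; rewrite /shuffle /reidx (uu' m)//.
  by apply: (scheme_head sP) => //; exact: lt.
- by move=> f u gf i hi; apply: (scheme_pts sP) => //; exact: lt.
- move=> f u gf i j ij jL; rewrite /shuffle /reidx.
  set p := transp m (slot L (u m)).
  have pij : p i != p j.
    by apply/eqP => /(inv_inj (@transpK m _)) e; rewrite e ltnn in ij.
  have [h1 h2] : (p i < m + L)%N /\ (p j < m + L)%N.
    by split; apply: lt => //; exact: ltn_trans ij jL.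
  move: pij; rewrite neq_ltn => /orP[h|h]; first exact: (scheme_inj sP).
  by apply/nesym; exact: (scheme_inj sP).
- move=> f h u j i gf ch rf hj hi; rewrite /shuffle /reidx.
  by apply: (scheme_stable sP) => //; exact: lt.
Qed.

Definition covered k m (Psi : PP -> X -> X) := forall f u, good f ->
  forall l, (l < k)%N -> ~ fresh m (sample f) (Psi (sample f) u) l.

Lemma covered_next_pt k m Psi : covered k m Psi -> covered k.+1 m.+1 (extend m (next_pt m) Psi).
Proof.
move=> cP f u gf; apply: (next_pt_covers gf (cP f u gf)).
  by exists m => //; rewrite /extend setc_same.
move=> i im; exists i; first exact: ltnW.
by rewrite /extend /setc ltn_eqF.
Qed.

Lemma covered_sub k m n (Psi Phi : PP -> X -> X) : covered k m Psi ->
  (forall g u i, (i < m)%N -> exists2 j, (j < n)%N & Phi g u j = Psi g u i) ->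
  covered k n Phi.
Proof.
move=> cP h f u gf l lk fl; apply: (cP f u gf l lk) => i im.
by have [j jn <-] := h (sample f) u i im; exact: fl.
Qed.

End schemes.

(** * Small events and associativity of products *)

Section measure_lemmas.
Context d (T : measurableType d) (R : realType).

(** The unions of [E n] over [n >= k] decrease to a null set as [k] grows, because almost every
    point eventually leaves [E n]. *)
Lemma near_null (mu : {measure set T -> \bar R}) (E : nat -> set T) N (e : R) :
  (mu setT < +oo)%E ->
  (forall n, measurable (E n)) -> measurable N -> mu N = 0%E ->
  (forall x, ~ N x -> \forall n \near \oo, ~ E n x) -> 0 < e ->
  \forall n \near \oo, (mu (E n) <= e%:E)%E.
Proof.
move=> muT mE mN N0 h e0.
have fin A : measurable A -> (mu A < +oo)%E.
  by move=> mA; apply: le_lt_trans muT; apply: le_measure; rewrite ?inE.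
pose F k := [set x | exists n, (k <= n)%N /\ E n x].
have mF k : measurable (F k).
  apply: measurable_set_exists => n; apply: measurable_set_and => //.
  exact: measurable_set_const.
have mI : measurable (\bigcap_k F k) by exact: bigcapT_measurable.
have I0 : mu (\bigcap_k F k) = 0%E.
  apply: (measure0_sub mI mN) => // x Fx; apply: contrapT => /h[k _ hk].
  by have [n [kn Enx]] := Fx k I; exact: hk Enx.
have Fd : {homo F : i j / (i <= j)%N >-> (j <= i)%O}.
  by move=> i j ij; apply/subsetPset => x [n [jn Enx]]; exists n; split=> //; exact: leq_trans jn.
have := nonincreasing_cvg_mu (fin _ (mF 0%N)) mF mI Fd.
rewrite I0 => /fine_cvg/cvgrPdist_lt/(_ e e0); apply: filterS => k /=.
rewrite sub0r normrN ger0_norm ?fine_ge0// => Fk.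
apply: (@le_trans _ _ (mu (F k))).
  by apply: le_measure; rewrite ?inE// => x Ex; exists k.
by rewrite -[leLHS]fineK ?ge0_fin_numE ?fin// lee_fin ltW.
Qed.

Lemma measure_le_cases (mu : {measure set T -> \bar R}) (F : nat -> set T) L :
  (forall j, measurable (F j)) ->
  (mu [set x | exists j, (j < L)%N /\ F j x] <= \sum_(j < L) mu (F j))%E.
Proof.
move=> mF; elim: L => [|L ih].
  by rewrite big_ord0 (_ : [set x | _] = set0) ?measure0//; apply/seteqP; split => x // [j []].
have mE : measurable [set x | exists j, (j < L)%N /\ F j x].
  apply: measurable_set_exists => j; apply: measurable_set_and => //.
  exact: measurable_set_const.
rewrite big_ord_recr/=; apply: le_trans (leeD ih (lexx _)).
apply: le_trans (measureU2 _ mE (mF L)).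
apply: le_measure; rewrite ?inE//.
- apply: measurable_set_exists => j; apply: measurable_set_and => //.
  exact: measurable_set_const.
- exact: measurableU.
- move=> x [j []]; rewrite ltnS leq_eqVlt => /orP[/eqP -> Fx|jL Fx]; first by right.
  by left; exists j.
Qed.

End measure_lemmas.

Lemma product_assoc d1 d2 d3 (S : measurableType d1) (U : measurableType d2)
    (V : measurableType d3) (R : realType) (m1 : probability S R)
    (m2 : probability U R) (m3 : probability V R) (A : set (S * U * V)) : measurable A ->
  (m1 \x m2 \x m3)%E A = (m1 \x (m2 \x m3))%E [set z | A (z.1, z.2.1, z.2.2)].
Proof.
move=> mA.
have mA' : measurable [set z : S * (U * V) | A (z.1, z.2.1, z.2.2)].
  apply: (measurable_preimageT (f := fun z : S * (U * V) => ((z.1, z.2.1), z.2.2))) => //.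
  apply: measurable_fun_pair; last exact: (measurableT_comp measurable_snd measurable_snd).
  apply: measurable_fun_pair; first exact: measurable_fst.
  exact: (measurableT_comp measurable_fst measurable_snd).
rewrite [LHS](product_measure_integral_r _ _ mA) [RHS](product_measure_integral_l _ _ mA').
pose f (z : S * V) := m2 [set y | A (z.1, y, z.2)].
have mf : measurable_fun setT f.
  apply: (@measurable_fun_section_l _ _ (S * V)%type U R m2 [set z | A (z.1.1, z.2, z.1.2)]).
  apply: (measurable_preimageT (f := fun z : S * V * U => ((z.1.1, z.2), z.1.2))) => //.
  apply: measurable_fun_pair; last exact: (measurableT_comp measurable_snd measurable_fst).
  apply: measurable_fun_pair; last exact: measurable_snd.
  exact: (measurableT_comp measurable_fst measurable_fst).
transitivity (\int[m3]_y \int[m1]_x f (x, y))%E.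
  apply: eq_integral => y _.
  exact: (product_measure_integral_l _ _ (measurable_section_r y mA)).
rewrite -(fubini_tonelli (m1 := m1) (m2 := m3) f mf)//.
apply: eq_integral => x _; apply/esym.
exact: (product_measure_integral_r _ _ (measurable_section_l x mA')).
Qed.

Lemma lee_add_half (R : realType) (x y k f : \bar R) (e : R) : (x <= k + f)%E ->
  (f <= (e / 2)%:E)%E -> (y <= (e / 2)%:E)%E -> (x + y <= k + e%:E)%E.
Proof.
move=> xkf fe ye; rewrite [e](_ : _ = e / 2 + e / 2); last by lra.
by rewrite EFinD addeA; apply: leeD => //; apply: (le_trans xkf); exact: leeD.
Qed.

Lemma le_trans_half (R : realType) (x y z : \bar R) (e : R) : (x <= y + (e / 2)%:E)%E ->
  (y <= z + (e / 2)%:E)%E -> (x <= z + e%:E)%E.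
Proof.
move=> xy yz; rewrite [e](_ : _ = e / 2 + e / 2); last by lra.
by rewrite EFinD addeA; apply: (le_trans xy); exact: leeD.
Qed.

(** * The law of a scheme, and its change by a close point *)

Section scheme_laws.
Context (R : realType) d (T : measurableType d) (P : probability T R) (b : T -> R -> R).
Hypotheses (hb : brownian_version P b) (gb : forall w, good (b w)).
Context (Q : probability (seqsp (mI01 R)) R).
Hypothesis hQ : forall n A, (forall i, measurable (A i)) ->
  Q (box n A) = (\prod_(i < n) (@mes01 R) (A i))%E.
Local Notation X := (seqsp (mI01 R)).
Local Notation PP := (seqsp R).

Lemma measurable_scheme m Psi : scheme m Psi ->
  measurable_fun setT (fun x : T * X => Psi (sample (b x.1)) x.2).
Proof.
move=> sP.
have mp : measurable_fun setT (fun x : T * X => (sample (b x.1), x.2)).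
  apply: measurable_fun_pair; last exact: measurable_snd.
  exact: (measurableT_comp (measurable_bv_sample hb) measurable_fst).
exact: (measurableT_comp (scheme_measurable sP) mp).
Qed.

Lemma scheme_hits m Psi (N : set X) w u : scheme m Psi ->
  N (Psi (sample (b w)) u) -> hits N m (sample (b w)) u.
Proof.
move=> sP NP.
have h i : exists l, (i < m)%N -> Psi (sample (b w)) u i = pt l (sample (b w)).
  have [im|_] := boolP (i < m)%N; last by exists 0%N.
  by have [l hl] := scheme_pts sP u (gb w) im; exists l.
have [k hk] := itvs_surj (fun i => sval (cid (h i))) m.
have {h}hk i : (i < m)%N -> pt (itvs k i) (sample (b w)) = Psi (sample (b w)) u i.
  by move=> im; rewrite hk//; case: cid => l /= ->.
exists k; split.
  move=> i j ij jm; rewrite !hk//; last exact: ltn_trans ij jm.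
  exact: (scheme_inj sP).
rewrite (_ : ptmix _ _ _ _ = Psi (sample (b w)) u)//.
apply/funext => i; rewrite /ptmix; case: ltnP => im; first exact: hk.
by rewrite (scheme_tail sP).
Qed.

(** A scheme yields distinct minimizers followed by the tail of [u], whatever the rule of choice; so
    it can enter [N] only within the event of [null_avoid]. *)
Lemma scheme_null m Psi (N : set X) : scheme m Psi -> measurable N -> Q N = 0%E ->
  (P \x Q)%E [set x | N (Psi (sample (b x.1)) x.2)] = 0%E.
Proof.
move=> sP mN N0; apply: (measure0_sub _ _ _ (null_avoid hb gb hQ m mN N0)).
- exact: (measurable_preimageT (measurable_scheme sP) mN).
- have mg : measurable_fun setT (fun x : T * X => sample (b x.1)).
    exact: (measurableT_comp (measurable_bv_sample hb) measurable_fst).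
  exact: (measurable_hits m mN mg measurable_snd).
- by move=> x /=; exact: scheme_hits.
Qed.

Let coord i : measurable_fun setT (fun x : T * X => x.2 i).
Proof. exact: (measurableT_comp (@measurable_coord _ (mI01 R) i) measurable_snd). Qed.

(** The harm that resampling on a short interval at [u m] can do: one of the first [m] points
    changes, or lies in that interval. *)
Let disturbed m (Psi : PP -> X -> X) (n : nat) : set ((T * T) * X) := [set x | 
  (exists k, (k < m)%N /\ (Psi (resampled b m n.+1%:R^-1 x.1 x.2) x.2 k <>
     Psi (sample (b x.1.1)) x.2 k \/
   (I01val (x.2 m) <= I01val (Psi (sample (b x.1.1)) x.2 k) /\
    I01val (Psi (sample (b x.1.1)) x.2 k) <= I01val (x.2 m) + n.+1%:R^-1))) ].

Let measurable_disturbed m Psi n : scheme m Psi -> measurable (disturbed m Psi n).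
Proof.
move=> sP.
have m11 : measurable_fun setT (fun x : (T * T) * X => sample (b x.1.1)).
  apply: (measurableT_comp (measurable_bv_sample hb)).
  exact: (measurableT_comp measurable_fst measurable_fst).
have mc : measurable_fun setT (fun x : (T * T) * X => I01val (x.2 m)).
  apply: (measurableT_comp (@measurable_I01val R)).
  exact: (measurableT_comp (@measurable_coord _ (mI01 R) m) measurable_snd).
have m1 k : measurable_fun setT (fun x : (T * T) * X => Psi (sample (b x.1.1)) x.2 k).
  have mp := measurable_fun_pair m11 (@measurable_snd _ _ (T * T)%type X).
  exact: (measurableT_comp (@measurable_coord _ (mI01 R) k)
    (measurableT_comp (scheme_measurable sP) mp)).
have m2 k : measurable_fun setT (fun x : (T * T) * X =>
    Psi (resampled b m n.+1%:R^-1 x.1 x.2) x.2 k).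
  have mp := measurable_fun_pair (measurable_resampled hb m n.+1%:R^-1)
    (@measurable_snd _ _ (T * T)%type X).
  exact: (measurableT_comp (@measurable_coord _ (mI01 R) k)
    (measurableT_comp (scheme_measurable sP) mp)).
have m1' k : measurable_fun setT (fun x : (T * T) * X => I01val (Psi (sample (b x.1.1)) x.2 k)).
  exact: (measurableT_comp (@measurable_I01val R) (m1 k)).
have mcd : measurable_fun setT (fun x : (T * T) * X => I01val (x.2 m) + n.+1%:R^-1).
  by apply: measurable_funD => //; exact: measurable_cst.
apply: measurable_set_exists => k; apply: measurable_set_and.
  exact: measurable_set_const.
apply: measurableU.
  exact: (measurable_set_not (measurable_set_eqI01 (m2 k) (m1 k))).
exact: (measurable_set_and (measurable_set_le mc (m1' k)) (measurable_set_le (m1' k) mcd)).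
Qed.

Let not_disturbed m Psi z u : scheme m Psi -> regular (b z.1) u ->
  \forall n \near \oo, ~ disturbed m Psi n (z, u).
Proof.
move=> sP ru; have [nM _] := ru m.
have h1 := near_forall_lt (fun i im => scheme_stable sP (gb z.1) (gb z.2).1 ru (leqnn m) im).
have h2 : \forall n \near \oo, forall i, (i < m)%N ->
    n.+1%:R^-1 < `|I01val (Psi (sample (b z.1)) u i) - I01val (u m)|.
  apply: near_forall_lt => i im.
  have r0 : 0 < `|I01val (Psi (sample (b z.1)) u i) - I01val (u m)|.
    rewrite normr_gt0 subr_eq0; apply/eqP => e; apply: nM; rewrite -e.
    by have [l ->] := scheme_pts sP u (gb z.1) im; exact: good_pt_local.
  exact: (near_infty_natSinv_lt (PosNum r0)).
near=> n.
have e1 : forall i, (i < m)%N -> Psi (sample (resample (I01val (u m)) n.+1%:R^-1 (b z.1) (b z.2))) u i =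
  Psi (sample (b z.1)) u i by near: n.
have e2 : forall i, (i < m)%N ->
    n.+1%:R^-1 < `|I01val (Psi (sample (b z.1)) u i) - I01val (u m)| by near: n.
move=> [k [km /= [ne|[h3 h4]]]]; first by apply: ne; exact: e1.
have := e2 k km; rewrite ger0_norm ?subr_ge0// ltNge => /negP; apply.
by rewrite lerBlDl.
Unshelve. all: by end_near. Qed.

(** Unless earlier points are disturbed, on the resampled path the rule picks [u i] plus the
    minimizer of the second path. The extended sequence is then [Psi] applied to the first path and
    to [u] with a shifted [u i], the situation of [resample_shift]. The original [u m] is carried
    along in [D] because it will select the place of insertion. *)
Lemma close_pt_law m i Psi (e : R) : scheme i Psi -> (m < i)%N -> 0 < e ->
  exists n, forall D : set (X * mI01 R), measurable D ->
  ((P \x Q) [set x | D (extend i (close_pt n i) Psi (sample (b x.1)) x.2, x.2 m)] <=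
   (P \x Q) [set x | D (Psi (sample (b x.1)) x.2, x.2 m)] + e%:E)%E.
Proof.
move=> sP mi e0; have e20 : 0 < e / 2 by lra.
have [Nr [mNr Nr0 hNr]] := regular_ae hb gb hQ.
pose N' : set ((T * T) * X) := [set x | Nr (x.1.1, x.2)].
have mN' : measurable N'.
  apply: (measurable_preimageT (f := fun x : (T * T) * X => (x.1.1, x.2))) => //.
  apply: measurable_fun_pair; last exact: measurable_snd.
  exact: (measurableT_comp measurable_fst measurable_fst).
have N'0 : (P \x P \x Q)%E N' = 0%E.
  rewrite -[RHS]Nr0; apply/esym.
  apply: (product_law_l Q (m1 := (P \x P)%E) (m3 := P) (F := fst)) => //.
  move=> B mB; rewrite (_ : fst @^-1` B = B `*` setT); last first.
    by apply/seteqP; split => x //= [].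
  apply/esym; transitivity (P B * P setT)%E; first exact: product_measure1E.
  by rewrite measure_probability_setT mule1.
have finT d' (S : measurableType d') (nu : probability S R) :
    ((nu : {measure set S -> \bar R}) setT < +oo)%E.
  by rewrite measure_probability_setT ltry.
have h1 : \forall n \near \oo, ((P \x P \x Q) (disturbed i Psi n) <= (e / 2)%:E)%E.
  apply: (near_null (finT _ _ (P \x P \x Q)%E) _ mN' N'0) => //.
    by move=> n; exact: measurable_disturbed.
  by move=> -[z u] Nx; apply: not_disturbed => //; exact: hNr Nx.
(* The interval at [u i] would leave (0,1); the probability of this tends to 0 with the length. *)
pose E n : set (T * X) := [set x | 1 <= I01val (x.2 i) + n.+1%:R^-1].
have mci n : measurable_fun setT (fun x : T * X => I01val (x.2 i) + n.+1%:R^-1).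
  apply: measurable_funD; last exact: measurable_cst.
  exact: (measurableT_comp (@measurable_I01val R) (coord i)).
have mE n : measurable (E n).
  by apply: measurable_set_le => //; exact: measurable_cst.
have h2 : \forall n \near \oo, ((P \x Q) (E n) <= (e / 2)%:E)%E.
  apply: (near_null (finT _ _ (P \x Q)%E) mE measurable0 (measure0 _)) => // -[w u] _.
  have /andP[_ u1] := I01val_itv (u i).
  have u0 : 0 < 1 - I01val (u i) by rewrite subr_gt0.
  have := near_infty_natSinv_lt (PosNum u0); apply: filterS => n /=.
  by rewrite /E/= ltrBrDl => h; apply/negP; rewrite -ltNge.
have [n [dn En]] := filter_ex (filterI h1 h2).
exists n => D mD; have n0 : 0 < n.+1%:R^-1 :> R by rewrite invr_gt0.
pose K : set (PP * X) := [set x | D (extend i (close_pt n i) Psi x.1 x.2, x.2 m)].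
have sE := scheme_extend sP (selector_close_pt R n i).
have mK : measurable K.
  apply: (measurable_preimageT (f := fun x : PP * X =>
    (extend i (close_pt n i) Psi x.1 x.2, x.2 m))) => //.
  apply: measurable_fun_pair; first exact: scheme_measurable sE.
  exact: (measurableT_comp (@measurable_coord _ (mI01 R) m) measurable_snd).
pose K' : set (T * X) := [set x | D (Psi (sample (b x.1)) x.2, x.2 m)].
have mK' : measurable K'.
  apply: (measurable_preimageT (f := fun x : T * X =>
    (Psi (sample (b x.1)) x.2, x.2 m))) => //.
  by apply: measurable_fun_pair => //; exact: measurable_scheme sP.
have key := resample_shift hb hQ (m := i) n0 mK mK' (measurable_disturbed n sP).
pose L : set (T * X) := [set x | I01val (x.2 i) + n.+1%:R^-1 < 1 /\ K (sample (b x.1), x.2)].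
have mL : measurable L.
  apply: measurable_set_and.
    by apply: measurable_set_lt => //; exact: measurable_cst.
  apply: (measurable_preimageT (f := fun x : T * X => (sample (b x.1), x.2)) _ mK).
  apply: measurable_fun_pair; last exact: measurable_snd.
  exact: (measurableT_comp (measurable_bv_sample hb) measurable_fst).
have mKb : measurable [set x : T * X | K (sample (b x.1), x.2)].
  apply: (measurable_preimageT (f := fun x : T * X => (sample (b x.1), x.2)) _ mK).
  apply: measurable_fun_pair; last exact: measurable_snd.
  exact: (measurableT_comp (measurable_bv_sample hb) measurable_fst).
apply: (@le_trans _ _ ((P \x Q) (L `|` E n))%E).
  apply: le_measure; rewrite ?inE//; first exact: measurableU.
  move=> x Kx; have [c|c] := ltP (I01val (x.2 i) + n.+1%:R^-1) 1; first by left.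
  by right.
apply: (le_trans (measureU2 _ mL (mE n))).
apply: (lee_add_half (key _) dn En).
move=> z u c Ku nd; set t := to01 _.
have new k : (k < i)%N ->
   Psi (resampled b i n.+1%:R^-1 z u) u k = Psi (sample (b z.1)) u k /\
   ~ (I01val (u i) <= I01val (Psi (sample (b z.1)) u k) <= I01val (u i) + n.+1%:R^-1).
  move=> ki; split.
    by apply: contrapT => h; apply: nd; exists k; split => //; left.
  by move=> /andP[h3 h4]; apply: nd; exists k; split => //; right.
have /andP[ui0 ui1] := I01val_itv (u i).
have [s hs] := good_strictmin_inv n (gb z.2).
have /andP[s0 s1] := hs.1.
have sE' : argmin 0 n.+1%:R^-1 (sample (b z.2)) = s := strictmin_argmin (gb z.2).1 hs.
have hr := strictmin_resample (I01val (u i)) (b z.1) hs.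
have cr : continuous (resample (I01val (u i)) n.+1%:R^-1 (b z.1) (b z.2)).
  by apply: continuous_resample; [case: (gb z.1)|case: (gb z.2)].
have tE : near_pt n (u i) (resampled b i n.+1%:R^-1 z u) = t.
  by rewrite /near_pt /resampled (strictmin_argmin cr hr) /t sE'.
have tV : I01val t = I01val (u i) + s.
  by rewrite /t sE' to01K// addr_gt0//= (lt_trans _ c)// ltrD2l.
have [l hl] : exists l, pt l (resampled b i n.+1%:R^-1 z u) = t.
  have lm := strictmin_local (ltW ui0) (ltW c) hr.
  have [l hl] := good_pt_surj cr lm.
  by exists l; apply: I01val_inj; rewrite tV.
have ok : near_pt_ok n i (resampled b i n.+1%:R^-1 z u)
    (Psi (resampled b i n.+1%:R^-1 z u) u).
  rewrite /near_pt_ok (scheme_tail sP)// tE; split=> //; split; first by exists l.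
  move=> k ki; have [-> out] := new k ki => e1; apply: out; rewrite -e1 tV.
  by rewrite lerDl lerD2l !ltW.
rewrite /K'/=; move: Ku; rewrite /K/=.
rewrite (_ : extend _ _ _ _ _ = Psi (sample (b z.1)) (setc i t u)).
  by rewrite /setc ltn_eqF.
apply/funext => k; rewrite /extend /close_pt asboolT// (scheme_tail sP)// tE.
rewrite /setc; case: ltngtP => [ki|ki|->].
- rewrite (new k ki).1; apply: (scheme_head sP) => // j ji.
  by rewrite ltn_eqF.
- rewrite (scheme_tail sP _ _ (ltnW ki)) (scheme_tail sP _ _ (ltnW ki)) (gtn_eqF ki).
  exact: erefl.
- by rewrite (scheme_tail sP _ _ (leqnn i)) eqxx.
Qed.

(** These points fill the remaining places of a block, so that a transposition within the block
    exchanges minimizers only. *)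
Lemma close_pts_law m k r Psi (e : R) : scheme k Psi -> (m < k)%N -> 0 < e ->
  exists Phi, [/\ scheme (k + r) Phi, forall g u i, (i < k)%N -> Phi g u i = Psi g u i &
  forall D : set (X * mI01 R), measurable D ->
  ((P \x Q) [set x | D (Phi (sample (b x.1)) x.2, x.2 m)] <=
   (P \x Q) [set x | D (Psi (sample (b x.1)) x.2, x.2 m)] + e%:E)%E].
Proof.
move=> sP mk; elim: r e => [|r ih] e e0.
  by exists Psi; rewrite addn0; split=> // D mD; rewrite leeDl// lee_fin ltW.
have e20 : 0 < e / 2 by lra.
have [Phi [sPhi hPhi lPhi]] := ih _ e20.
have [n hn] := close_pt_law sPhi (ltn_addr r mk) e20.
exists (extend (k + r) (close_pt n (k + r)) Phi); rewrite addnS; split.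
- exact: scheme_extend sPhi (selector_close_pt R n _).
- by move=> g u i ik; rewrite /extend /setc ltn_eqF ?hPhi// ltn_addr.
- move=> D mD; exact: (le_trans_half (hn D mD) (lPhi D mD)).
Qed.

End scheme_laws.

Section blocks.
Context (R : realType) d (T : measurableType d) (P : probability T R) (b : T -> R -> R).
Hypotheses (hb : brownian_version P b) (gb : forall w, good (b w)).
Context (Q : probability (seqsp (mI01 R)) R).
Hypothesis hQ : forall n A, (forall i, measurable (A i)) ->
  Q (box n A) = (\prod_(i < n) (@mes01 R) (A i))%E.
Local Notation X := (seqsp (mI01 R)).
Local Notation PP := (seqsp R).

Lemma slot_mes01 L j : (0 < L)%N ->
  (mes01 [set t : mI01 R | slot L t = j] <= (L%:R^-1)%:E)%E.
Proof.
move=> L0; have L0' : 0 < L%:R :> R by rewrite ltr0n.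
rewrite /mes01; apply: (@le_trans _ _ (lebesgue_measure `[j%:R / L%:R, j.+1%:R / L%:R]%classic)).
  apply: le_measure; rewrite ?inE//; first exact: measurable_I01_image (measurable_slot _ _ _).
  move=> _ [t /= <- <-]; rewrite in_itv/=; have /andP[h1 h2] := slotP L t.
  by rewrite ler_pdivrMr// ler_pdivlMr// (mulrC (I01val t)) h1 ltW.
rewrite lebesgue_measure_itv/= lte_fin ltr_pM2r ?invr_gt0// ltr_nat ltnSn.
by rewrite -EFinB lee_fin -mulrBl -natrB// subSnn mul1r.
Qed.

Lemma independent_coord m (A : set (mI01 R)) (S : set (T * X)) :
  measurable A -> measurable S ->
  (forall w t u, S (w, setc m t u) <-> S (w, u)) ->
  (P \x Q)%E [set x | A (x.2 m) /\ S x] = (mes01 A * (P \x Q) S)%E.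
Proof.
move=> mA mS h.
have mE : measurable [set x : T * X | A (x.2 m) /\ S x].
  apply: measurable_set_and => //.
  apply: (measurable_preimageT (f := fun x : T * X => x.2 m)) => //.
  exact: (measurableT_comp (@measurable_coord _ (mI01 R) m) measurable_snd).
rewrite [LHS](product_measure_integral_l _ _ mE).
rewrite [X in (_ * X)%E](product_measure_integral_l _ _ mS).
rewrite -ge0_integralZl//; last exact: measurable_fun_section_l.
apply: eq_integral => w _.
have mEw := measurable_section_l w mE.
have mSw := measurable_section_l w mS.
apply: etrans (iid_setc hQ m mEw) _.
transitivity (((@mes01 R) \x Q)%E (A `*` [set u | S (w, u)])).
  congr (((@mes01 R) \x Q)%E _); apply/seteqP; split => -[t u] /=; rewrite setc_same.
    by move=> [At /h Su].
  by move=> [At Su]; split=> //; apply/h.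
exact: product_measure1E.
Qed.

Section one_scheme.
Variables (m : nat) (Psi : PP -> X -> X).
Hypothesis sP : scheme m Psi.

Let psi (x : T * X) := Psi (sample (b x.1)) x.2.
Let new (x : T * X) := next_pt m (sample (b x.1)) (psi x).

Let mpsi : measurable_fun setT psi.
Proof. exact: (measurable_scheme hb sP). Qed.

Let mnew : measurable_fun setT new.
Proof.
apply: measurable_next_pt mpsi.
exact: (measurableT_comp (measurable_bv_sample hb) measurable_fst).
Qed.

Let psi_mix w x u : psi (w, mix m x u) = mix m (psi (w, x)) u.
Proof.
apply/funext => i; rewrite /psi /= {2}/mix; case: ltnP => im.
  by apply: (scheme_head sP) => // k km; rewrite /mix km.
by rewrite (scheme_tail sP)// /mix ltnNge im.
Qed.

Let new_head w u u' : (forall i, (i < m)%N -> u i = u' i) -> new (w, u) = new (w, u').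
Proof.
move=> uu'; apply: next_pt_local => i im; exact: (scheme_head sP).
Qed.

(** The quantities computed from a scheme read only the first [m] coordinates of [u], so the tail
    may be taken from an independent copy: this is [iid_mix] section by section. *)
Let place (V : X * mI01 R * X -> Prop) (F : T * X -> X * mI01 R) (H : T * X -> Prop) :
  measurable V -> measurable H -> measurable_fun setT F ->
  (forall w x u, V (F (w, x), u) <-> H (w, mix m x u)) ->
  (P \x Q \x Q)%E [set z | V (F z.1, z.2)] = (P \x Q)%E H.
Proof.
move=> mV mH mF VH.
have mA : measurable [set z : T * X * X | V (F z.1, z.2)].
  apply: (measurable_preimageT (f := fun z : T * X * X => (F z.1, z.2))) => //.
  apply: measurable_fun_pair; last exact: measurable_snd.
  exact: (measurableT_comp mF measurable_fst).
apply: etrans (product_assoc _ _ _ mA) _.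
have mA' : measurable [set z : T * (X * X) | [set z : T * X * X | V (F z.1, z.2)] (z.1, z.2.1, z.2.2)].
  apply: (measurable_preimageT (f := fun z : T * (X * X) => ((z.1, z.2.1), z.2.2)) _ mA).
  apply: measurable_fun_pair; last exact: (measurableT_comp measurable_snd measurable_snd).
  apply: measurable_fun_pair; first exact: measurable_fst.
  exact: (measurableT_comp measurable_fst measurable_snd).
rewrite [LHS](product_measure_integral_l _ _ mA') [RHS](product_measure_integral_l _ _ mH).
apply: eq_integral => w _; apply/esym.
apply: etrans (iid_mix hQ m (measurable_section_l w mH)) _.
by congr ((Q \x Q)%E _); apply/seteqP; split => z /=; move/VH.
Qed.

(** By [scheme_null] for the scheme extended by the new point, the joint law of the new point and
    the rest is absolutely continuous with respect to a product measure. So the new point has a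
    density given the rest, and [iid_insertion] applies. *)
Lemma scheme_insertion (e : R) : 0 < e -> exists L, (0 < L)%N /\
  forall C : set X, measurable C ->
  (\sum_(j < L) (P \x Q) [set x | C (setc (m + j)%N
     (next_pt m (sample (b x.1)) (Psi (sample (b x.1)) x.2)) (Psi (sample (b x.1)) x.2))] <=
   L%:R%:E * ((P \x Q) [set x | C (Psi (sample (b x.1)) x.2)] + e%:E))%E.
Proof.
move=> e0; pose c0 : mI01 R := point.
(* Coordinate [m] is masked by the constant [c0]: the extended sequence holds the new point at this
   place, so [scheme_null] says nothing about the new point jointly with the old [u m]. *)
pose V (x : T * X) : X * mI01 R := (setc m c0 (psi x), new x).
have mV : measurable_fun setT V.
  by apply: measurable_fun_pair => //; apply: measurable_fun_setc => //; exact: measurable_cst.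
have mk : measurable_fun setT (setc m c0).
  by apply: measurable_fun_setc; [exact: measurable_cst|exact: measurable_id].
pose gV : {mfun (T * X)%type >-> (X * mI01 R)%type} := HB.pack V (isMeasurableFun.Build _ _ _ _ _ mV).
pose gk : {mfun X >-> X} := HB.pack (setc m c0) (isMeasurableFun.Build _ _ _ _ _ mk).
pose ka := distribution Q gk.
pose mu := distribution (P \x Q)%E gV.
have muka N : measurable N -> (ka \x (@mes01 R))%E N = 0%E -> mu N = 0%E.
  move=> mN N0.
  (* [N] read off a single sequence, with the new point at place [m]; it is null under [Q] because
     coordinate [m] is uniform and independent of the others. *)
  pose N' : set X := [set y | N (setc m c0 y, y m)].
  have mN' : measurable N'.
    apply: (measurable_preimageT (f := fun y : X => (setc m c0 y, y m))) => //.
    by apply: measurable_fun_pair => //; exact: measurable_coord.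
  have N'0 : Q N' = 0%E.
    apply: etrans (iid_setc hQ m mN') _.
    have mN1 := measurable_preimageT (@measurable_setc _ (mI01 R) m) mN'.
    rewrite [LHS](product_measure_integral_l _ _ mN1).
    rewrite -N0 [RHS](product_measure_integral_r _ _ mN).
    apply: eq_integral => t _.
    change (Q [set y | N' (setc m t y)] = Q [set y | N (setc m c0 y, t)]).
    by congr (Q _); apply/seteqP; split => y /=; rewrite /N'/= setc_setc setc_same.
  have sE := scheme_extend sP (selector_next_pt R m).
  rewrite -[RHS](scheme_null hb gb hQ sE mN' N'0).
  change ((P \x Q)%E [set x | N (V x)] = (P \x Q)%E
    [set x | N' (extend m (next_pt m) Psi (sample (b x.1)) x.2)]).
  by congr ((P \x Q)%E _); apply/seteqP; split => x /=;
    rewrite /N'/= /extend setc_setc setc_same.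
have [L [L0 hL]] := iid_insertion hQ muka m e0.
exists L; split=> // C mC.
pose D : set (X * X) := [set z | C (mix m z.1 z.2)].
have mD : measurable D.
  exact: (measurable_preimageT (@measurable_mix _ (mI01 R) m) mC).
have law (A : set (X * mI01 R * X)) : measurable A ->
    (mu \x Q)%E A = (P \x Q \x Q)%E [set z | A (V z.1, z.2)].
  by move=> mA; apply: (product_law_l Q (m1 := (P \x Q)%E) (m3 := mu)).
have base : (mu \x Q)%E [set z | D (z.1.1, z.2)] = (P \x Q)%E [set x | C (psi x)].
  have mA : measurable [set z : X * mI01 R * X | D (z.1.1, z.2)].
    apply: (measurable_preimageT (f := fun z : X * mI01 R * X => (z.1.1, z.2))) => //.
    apply: measurable_fun_pair; last exact: measurable_snd.
    exact: (measurableT_comp measurable_fst measurable_fst).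
  apply: etrans (law _ mA) _; apply: place => //.
    exact: (measurable_preimageT mpsi mC).
  move=> w x u; rewrite /= /D /= psi_mix.
  rewrite (_ : mix m (setc m c0 _) u = mix m (psi (w, x)) u)//.
  by apply/funext => i; rewrite /mix /setc; case: ltnP => // im; rewrite ltn_eqF.
have ins j : (mu \x Q)%E [set z | D (z.1.1, setc (m + j)%N z.1.2 z.2)] =
    (P \x Q)%E [set x | C (setc (m + j)%N (new x) (psi x))].
  have mA : measurable [set z : X * mI01 R * X | D (z.1.1, setc (m + j)%N z.1.2 z.2)].
    apply: (measurable_preimageT (f := fun z : X * mI01 R * X =>
      (z.1.1, setc (m + j)%N z.1.2 z.2))) => //.
    apply: measurable_fun_pair; first exact: (measurableT_comp measurable_fst measurable_fst).
    apply: measurable_fun_setc; last exact: measurable_snd.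
    exact: (measurableT_comp measurable_snd measurable_fst).
  apply: etrans (law _ mA) _; apply: place => //.
    apply: (measurable_preimageT _ mC).
    exact: (measurable_fun_setc (m + j)%N mnew mpsi).
  move=> w x u; rewrite /= /D /= psi_mix.
  rewrite (@new_head w (mix m x u) x); last by move=> i im; rewrite /mix im.
  rewrite (_ : mix m (setc m c0 _) _ = setc (m + j)%N (new (w, x)) (mix m (psi (w, x)) u))//.
  apply/funext => i; rewrite /mix /setc; case: ltnP => // im.
  by rewrite !ltn_eqF// ltn_addr.
have := hL D mD; rewrite base.
by under eq_bigr do rewrite ins.
Qed.

(** Both sequences have the new point at place [m + j]; they differ in which of [u m] and
    [u (m + j)] remains at place [m]. The earlier points and the new one read neither coordinate, so
    exchanging the two preserves the law. *)
Lemma transp_law j (C : set X) : measurable C ->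
  (P \x Q)%E [set x | C (reidx (transp m j) (extend m (next_pt m) Psi (sample (b x.1)) x.2))] =
  (P \x Q)%E [set x | C (setc (m + j)%N
     (next_pt m (sample (b x.1)) (Psi (sample (b x.1)) x.2)) (Psi (sample (b x.1)) x.2))].
Proof.
move=> mC.
pose A1 : set (T * X) := [set x | C (reidx (transp m j) (setc m (new x) (psi x)))].
pose A2 : set (T * X) := [set x | C (setc (m + j)%N (new x) (psi x))].
have mA1 : measurable A1.
  apply: (measurable_preimageT (f := fun x : T * X => reidx (transp m j) (setc m (new x) (psi x)))) => //.
  exact: (measurableT_comp (@measurable_reidx _ (mI01 R) _) (measurable_fun_setc m mnew mpsi)).
have mA2 : measurable A2.
  apply: (measurable_preimageT _ mC).
  exact: (measurable_fun_setc (m + j)%N mnew mpsi).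
change ((P \x Q)%E A1 = (P \x Q)%E A2).
rewrite [LHS](product_measure_integral_l _ _ mA1) [RHS](product_measure_integral_l _ _ mA2).
apply: eq_integral => w _.
have pid i : (m + j < i)%N -> transp m j i = i by move=> h; apply: transp_id; right.
apply: etrans (iid_reidx hQ (transpK m j) pid (measurable_section_l w mA1)) _.
congr (Q _); apply/seteqP.
have e u : reidx (transp m j) (setc m (new (w, reidx (transp m j) u))
    (psi (w, reidx (transp m j) u))) = setc (m + j)%N (new (w, u)) (psi (w, u)).
  have uu i : (i < m)%N -> reidx (transp m j) u i = u i.
    by move=> im; rewrite /reidx transp_id//; left.
  rewrite (new_head w uu); apply/funext => i; rewrite /reidx /setc.
  have -> : (transp m j i == m) = (i == m + j)%N.
    have tm : transp m j (m + j)%N = m.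
      by rewrite /transp; case: eqP => [->|_] //; rewrite eqxx.
    by rewrite -[X in _ == X]tm (inj_eq (inv_inj (transpK m j))).
  case: eqP => // imj; rewrite /psi /=.
  have [im|mi] := ltnP i m.
    by rewrite transp_id; [apply: (scheme_head sP)|left].
  have mt : (m <= transp m j i)%N.
    by rewrite /transp; case: eqP => _; [rewrite leq_addr|case: eqP].
  by rewrite (scheme_tail sP _ _ mt) (scheme_tail sP _ _ mi) /reidx transpK.
by split => u; rewrite /A1 /A2 /= e.
Qed.

(** Place [m] of the extended sequence is overwritten, so this sequence is independent of [u m],
    whose slot takes each of [L] values with probability at most [1 / L]. Summing over the slot
    gives at most the mean of the [L] insertions. *)
Lemma shuffle_law L (C : set X) (e : R) : (0 < L)%N -> measurable C ->
  (\sum_(j < L) (P \x Q) [set x | C (setc (m + j)%N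
     (next_pt m (sample (b x.1)) (Psi (sample (b x.1)) x.2)) (Psi (sample (b x.1)) x.2))] <=
   L%:R%:E * ((P \x Q) [set x | C (Psi (sample (b x.1)) x.2)] + e%:E))%E ->
  ((P \x Q) [set x | C (reidx (transp m (slot L (x.2 m)))
      (extend m (next_pt m) Psi (sample (b x.1)) x.2))] <=
   (P \x Q) [set x | C (Psi (sample (b x.1)) x.2)] + e%:E)%E.
Proof.
move=> L0 mC h; have L0' : 0 < L%:R :> R by rewrite ltr0n.
pose A j : set (T * X) := [set x | C (reidx (transp m j) (setc m (new x) (psi x)))].
have mA j : measurable (A j).
  apply: (measurable_preimageT (f := fun x : T * X => reidx (transp m j) (setc m (new x) (psi x)))) => //.
  exact: (measurableT_comp (@measurable_reidx _ (mI01 R) _) (measurable_fun_setc m mnew mpsi)).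
pose F j : set (T * X) := [set x | [set t | slot L t = j] (x.2 m) /\ A j x].
have mF j : measurable (F j).
  apply: measurable_set_and => //.
  apply: (measurable_preimageT (f := fun x : T * X => x.2 m) _ (measurable_slot R L j)).
  exact: (measurableT_comp (@measurable_coord _ (mI01 R) m) measurable_snd).
have FE j : ((P \x Q) (F j) <= (L%:R^-1)%:E * (P \x Q) (A j))%E.
  rewrite [leLHS](independent_coord (m := m) (measurable_slot R L j) (mA j)).
    by apply: lee_wpmul2r => //; exact: slot_mes01.
  move=> w t u; rewrite /A /=.
  have uu i : (i < m)%N -> setc m t u i = u i by move=> im; rewrite /setc ltn_eqF.
  rewrite (new_head w uu) (_ : setc m _ (psi (w, setc m t u)) = setc m (new (w, u)) (psi (w, u)))//.
  apply/funext => i; rewrite /setc; case: eqP => // /eqP im; rewrite /psi /=.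
  have [lt|ge] := ltnP i m; first exact: (scheme_head sP).
  by rewrite (scheme_tail sP _ _ ge) (scheme_tail sP _ _ ge) /setc (negbTE im).
have mS : measurable [set x : T * X | exists j, (j < L)%N /\ F j x].
  apply: measurable_set_exists => j; apply: measurable_set_and => //.
  exact: measurable_set_const.
have mLHS : measurable [set x : T * X | C (reidx (transp m (slot L (x.2 m)))
    (extend m (next_pt m) Psi (sample (b x.1)) x.2))].
  rewrite (_ : [set x | _] = [set x : T * X | exists j, (j < L)%N /\ F j x])//.
  apply/seteqP; split => x /=.
    by move=> Cx; exists (slot L (x.2 m)); split; [exact: slot_lt|split].
  by move=> [j [_ [/= <-]]].
apply: (@le_trans _ _ ((P \x Q) [set x : T * X | exists j, (j < L)%N /\ F j x])%E).
  apply: le_measure; rewrite ?inE// => x /= Cx.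
  by exists (slot L (x.2 m)); split; [exact: slot_lt|split].
apply: (le_trans (measure_le_cases _ L mF)).
apply: (@le_trans _ _ (\sum_(j < L) (L%:R^-1)%:E * (P \x Q) (A j))%E).
  by apply: lee_sum => j _; exact: FE.
rewrite -ge0_sume_distrr; last by move=> j _; exact: measure_ge0.
rewrite (eq_bigr (fun j : 'I_L => (P \x Q)%E [set x | C (setc (m + j)%N
     (next_pt m (sample (b x.1)) (Psi (sample (b x.1)) x.2)) (Psi (sample (b x.1)) x.2))])); last first.
  by move=> j _; exact: transp_law.
apply: (@le_trans _ _ ((L%:R^-1)%:E * (L%:R%:E *
    ((P \x Q) [set x | C (Psi (sample (b x.1)) x.2)] + e%:E)))%E).
  by apply: lee_wpmul2l => //; rewrite lee_fin invr_ge0 ltW.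
by rewrite muleA -EFinM mulVf ?gt_eqF// mul1e.
Qed.

End one_scheme.

Lemma block m Psi (e : R) : scheme m Psi -> 0 < e -> exists M Phi,
  [/\ (m < M)%N, scheme M Phi, forall g u i, (i < m)%N -> Phi g u i = Psi g u i,
    forall k, covered k m Psi -> covered k.+1 M Phi &
    forall C : set X, measurable C ->
      ((P \x Q) [set x | C (Phi (sample (b x.1)) x.2)] <=
       (P \x Q) [set x | C (Psi (sample (b x.1)) x.2)] + e%:E)%E].
Proof.
move=> sP e0; have e20 : 0 < e / 2 by lra.
have [L [L0 hL]] := scheme_insertion sP e20.
have sE := scheme_extend sP (selector_next_pt R m).
have [Phi [sPhi hPhi lPhi]] := close_pts_law hb gb hQ L.-1 sE (ltnSn m) e20.
have mL : (m.+1 + L.-1 = m + L)%N by rewrite addSnnS prednK.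
rewrite mL in sPhi.
have mmL : (m < m + L)%N by rewrite -[ltnLHS]addn0 ltn_add2l.
have low g u i : (i < m)%N -> Phi g u i = Psi g u i.
  move=> im; rewrite (hPhi _ _ _ (leqW im)) /extend /setc (ltn_eqF im).
  exact: erefl.
exists (m + L)%N, (shuffle m L Phi); split=> //.
- exact: scheme_shuffle.
- by move=> g u i im; rewrite /shuffle /reidx transp_id ?low//; left.
- move=> k ck; apply: (covered_sub (covered_next_pt ck)) => g u i im.
  exists (transp m (slot L (u m)) i).
    by apply: transp_lt; [exact: slot_lt|exact: leq_trans im mmL].
  by rewrite /shuffle /reidx transpK hPhi.
- move=> C mC.
  (* The bound for the close points holds for events of the pair of sequence and [u m], hence for
     the sequence after the random transposition. This reduces the block to the single insertion
     handled by [shuffle_law]. *)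
  pose D : set (X * mI01 R) := [set z | C (reidx (transp m (slot L z.2)) z.1)].
  have mD : measurable D.
    rewrite (_ : D = [set z | exists j, slot L z.2 = j /\ C (reidx (transp m j) z.1)]); last first.
      by apply/seteqP; split => z /=; [move=> h; exists (slot L z.2)|move=> [j [<-]]].
    apply: measurable_set_exists => j; apply: measurable_set_and.
      exact: (measurable_preimageT (f := snd) measurable_snd (measurable_slot R L j)).
    apply: (measurable_preimageT (f := fun z : X * mI01 R => reidx (transp m j) z.1)) => //.
    exact: (measurableT_comp (@measurable_reidx _ (mI01 R) _) measurable_fst).
  apply: le_trans_half (lPhi D mD) _.
  exact: (shuffle_law sP L0 mC (hL C mC)).
Qed.

End blocks.

(** * The limiting enumeration and its absolute continuity *)

Section limit.
Context (R : realType) d (T : measurableType d) (P : probability T R) (b : T -> R -> R).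
Hypotheses (hb : brownian_version P b) (gb : forall w, good (b w)).
Context (Q : probability (seqsp (mI01 R)) R).
Hypothesis hQ : forall n A, (forall i, measurable (A i)) ->
  Q (box n A) = (\prod_(i < n) (@mes01 R) (A i))%E.
Local Notation X := (seqsp (mI01 R)).
Local Notation PP := (seqsp R).

Lemma scheme_id : scheme 0 (fun (g : PP) (u : X) => u).
Proof. by split => //; exact: measurable_snd. Qed.

Let law (Psi : PP -> X -> X) (C : set X) :=
  (P \x Q)%E [set x | C (Psi (sample (b x.1)) x.2)].

Lemma scheme_sequence : exists (m : nat -> nat) (Psi : nat -> PP -> X -> X),
  [/\ forall k, scheme (m k) (Psi k), forall k, (k <= m k)%N,
    forall k, covered k (m k) (Psi k),
    forall k j g u i, (k <= j)%N -> (i < m k)%N -> Psi j g u i = Psi k g u i &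
    forall k C, measurable C -> (law (Psi k.+1) C <= law (Psi k) C + (2^-1 ^+ k)%:E)%E].
Proof.
pose S := {s : nat * (PP -> X -> X) | scheme s.1 s.2}.
pose rel k (s s' : S) := [/\ ((sval s).1 < (sval s').1)%N,
  forall g u i, (i < (sval s).1)%N -> (sval s').2 g u i = (sval s).2 g u i,
  forall k, covered k (sval s).1 (sval s).2 -> covered k.+1 (sval s').1 (sval s').2 &
  forall C, measurable C -> (law (sval s').2 C <= law (sval s).2 C + (2^-1 ^+ k)%:E)%E].
have step k s : exists s', rel k s s'.
  have e0 : 0 < 2^-1 ^+ k :> R by rewrite exprn_gt0// invr_gt0.
  have [M [Phi [h1 h2 h3 h4 h5]]] := block hb gb hQ (svalP s) e0.
  by exists (exist _ (M, Phi) h2).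
pose next k s := sval (cid (step k s)).
have nextP k s : rel k s (next k s) by rewrite /next; case: cid.
pose s0 : S := exist _ (0%N, fun (g : PP) (u : X) => u) scheme_id.
pose s := fix s k := if k is k'.+1 then next k' (s k') else s0.
have sP k : rel k (s k) (s k.+1) := nextP k (s k).
exists (fun k => (sval (s k)).1), (fun k => (sval (s k)).2); split.
- by move=> k; exact: svalP (s k).
- elim=> // k ih; have [h _ _ _] := sP k; exact: leq_ltn_trans ih h.
- elim=> [|k ih]; first by move=> f u gf l; rewrite ltn0.
  by have [_ _ h _] := sP k; exact: h.
- move=> k j g u i; elim: j => [|j ih].
    by rewrite leqn0 => /eqP ->.
  rewrite leq_eqVlt => /orP[/eqP -> //|kj im].
  have [_ h _ _] := sP j; rewrite h; first exact: ih.
  apply: (leq_trans im); rewrite ltnS in kj.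
  elim: j kj {ih h} => [|j ih]; first by rewrite leqn0 => /eqP ->.
  rewrite leq_eqVlt => /orP[/eqP -> //|kj]; apply: (leq_trans (ih kj)).
  by have [h _ _ _] := sP j; exact: ltnW.
- by move=> k C mC; have [_ _ _ h] := sP k; exact: h.
Qed.

(* The coordinates stabilize, and the changes of the laws are summable. *)
Lemma enumeration_exists : exists Y : PP -> X -> X,
  [/\ measurable_fun setT (fun x : PP * X => Y x.1 x.2),
    forall f u, good f -> [/\ injective (Y (sample f) u),
      forall i, exists l, Y (sample f) u i = pt l (sample f) &
      forall l, exists i, Y (sample f) u i = pt l (sample f)] &
    forall N, measurable N -> Q N = 0%E ->
      (P \x Q)%E [set x | N (Y (sample (b x.1)) x.2)] = 0%E].
Proof.
have [m [Psi [hs hm hc hst hl]]] := scheme_sequence.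
(* Stage [i.+1] has already fixed coordinate [i], since [i < m i.+1]. *)
pose Y g u : X := fun i => Psi i.+1 g u i.
have YE k g u i : (i < m k)%N -> Psi k g u i = Y g u i.
  move=> im; rewrite -(hst k (maxn k i.+1) g u i) ?leq_maxl//.
  by rewrite (hst i.+1 (maxn k i.+1) g u i) ?leq_maxr.
have mY : measurable_fun setT (fun x : PP * X => Y x.1 x.2).
  apply: measurable_fun_seqP => i.
  exact: (measurableT_comp (@measurable_coord _ (mI01 R) i) (scheme_measurable (hs i.+1))).
exists Y; split=> //.
- move=> f u gf; split.
  + have inj i j : (i < j)%N -> Y (sample f) u i <> Y (sample f) u j.
      move=> ij; have jm : (j < m j.+1)%N := hm j.+1.
      rewrite -(YE j.+1 _ _ i) ?(ltn_trans ij)// -(YE j.+1 _ _ j)//.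
      exact: (scheme_inj (hs j.+1)).
    move=> i j e; case: (ltngtP i j) => [ij|ij|ij].
    * by case: (inj _ _ ij e).
    * by case: (inj _ _ ij (esym e)).
    * exact: ij.
  + by move=> i; apply: (scheme_pts (hs i.+1) u gf); exact: hm i.+1.
  + move=> l; apply: contrapT => h.
    apply: (hc l.+1 f u gf l (ltnSn l)) => i im e; apply: h; exists i.
    by rewrite -(YE l.+1)//; exact: esym.
move=> N mN N0.
have mb : measurable_fun setT (fun x : T * X => (sample (b x.1), x.2)).
  apply: measurable_fun_pair; last exact: measurable_snd.
  exact: (measurableT_comp (measurable_bv_sample hb) measurable_fst).
have mYb : measurable_fun setT (fun x : T * X => Y (sample (b x.1)) x.2).
  exact: (measurableT_comp mY mb).
(* The geometric sum of the errors; the exact remainder is kept to make the induction on [j] go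
   through. *)
have tail k j C : measurable C ->
    (law (Psi (k + j)%N) C <= law (Psi k) C + (2 * 2^-1 ^+ k)%:E)%E.
  move=> mC; apply: (@le_trans _ _ (law (Psi k) C +
      (2 * 2^-1 ^+ k - 2 * 2^-1 ^+ (k + j))%:E)%E); last first.
    rewrite leeD2l// lee_fin.
    have : 0 < 2^-1 ^+ (k + j) :> R by rewrite exprn_gt0// invr_gt0.
    by lra.
  elim: j => [|j ih]; first by rewrite addn0 subrr adde0.
  rewrite addnS; apply: (le_trans (hl _ _ mC)).
  apply: (le_trans (leeD ih (lexx _))); rewrite -addeA leeD2l// -EFinD lee_fin exprS.
  by lra.
(* A cylinder sees finitely many coordinates, on which the limit agrees with stage [k + n]. The
   bound does not involve [n], so [k] can be fixed before the cylinder is chosen. *)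
have cyl k n D : cylinder n D ->
    (law Y D <= law (Psi k) D + (2 * 2^-1 ^+ k)%:E)%E.
  move=> [mD hD]; rewrite (_ : law Y D = law (Psi (k + n)%N) D); first exact: tail.
  congr ((P \x Q)%E _); apply/seteqP; split => x /=; apply: hD => i iD;
    rewrite YE//; apply: leq_trans iD (leq_trans _ (hm _)); exact: leq_addl.
pose gY : {mfun (T * X)%type >-> X} := HB.pack (fun x : T * X => Y (sample (b x.1)) x.2)
  (isMeasurableFun.Build _ _ _ _ _ mYb).
apply/eqP; rewrite eq_le measure_ge0 andbT; apply/lee_addgt0Pr => e e0; rewrite add0e.
have e40 : 0 < e / 4 by lra.
have e34 : e / 4 + e / 4 + e / 4 <= e by lra.
have [k hk] : exists k, 2 * 2^-1 ^+ k < e / 4 :> R.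
  have e80 : 0 < e / 8 by lra.
  have h : (2^-1 : R) ^+ n @[n --> \oo] --> (0 : R).
    by apply: cvg_expr; rewrite ger0_norm ?invr_ge0// invf_lt1// ltr1n.
  move/cvgrPdist_lt : h => /(_ _ e80)/filter_ex[k].
  rewrite sub0r normrN ger0_norm ?exprn_ge0 ?invr_ge0// => hk.
  by exists k; lra.
pose gk : {mfun (T * X)%type >-> X} := HB.pack (fun x : T * X => Psi k (sample (b x.1)) x.2)
  (isMeasurableFun.Build _ _ _ _ _ (measurable_scheme hb (hs k))).
(* Approximation with respect to the sum of the two laws gives one cylinder that is close to [N] for
   both. *)
pose mu := measure_add (distribution (P \x Q)%E gY) (distribution (P \x Q)%E gk).
have muE C : mu C = (law Y C + law (Psi k) C)%E by exact: measure_addE.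
have muoo : (mu setT < +oo)%E.
  have one (F : PP -> X -> X) : law F setT = 1%E.
    by apply: etrans (measure_probability_setT (P \x Q)%E); congr ((P \x Q)%E _); apply/seteqP.
  by rewrite muE !one -EFinD ltry.
have [n [D [cD hD]]] := cylinder_approx muoo mN e40.
have mD := cD.1.
have mLY C : measurable C -> measurable [set x : T * X | C (Y (sample (b x.1)) x.2)].
  exact: measurable_preimageT mYb.
have mLk C : measurable C -> measurable [set x : T * X | C (Psi k (sample (b x.1)) x.2)].
  exact: measurable_preimageT (measurable_scheme hb (hs k)).
have mND : measurable ((N `\` D) `|` (D `\` N)).
  by apply: measurableU; exact: measurableD.
have hD' : (law Y ((N `\` D) `|` (D `\` N)) + law (Psi k) ((N `\` D) `|` (D `\` N)) <
    (e / 4)%:E)%E by rewrite -muE; exact: hD.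
have hY : (law Y ((N `\` D) `|` (D `\` N)) <= (e / 4)%:E)%E.
  by apply: (le_trans _ (ltW hD')); rewrite leeDl//; exact: measure_ge0.
have hk' : (law (Psi k) ((N `\` D) `|` (D `\` N)) <= (e / 4)%:E)%E.
  by apply: (le_trans _ (ltW hD')); rewrite leeDr//; exact: measure_ge0.
have sub (F : PP -> X -> X) (A A' : set X) :
    (forall C, measurable C -> measurable [set x : T * X | C (F (sample (b x.1)) x.2)]) ->
    measurable A -> measurable A' ->
    (law F A <= law F A' + law F ((A `\` A') `|` (A' `\` A)))%E.
  move=> mF mA mA'.
  have mAA : measurable ((A `\` A') `|` (A' `\` A)).
    by apply: measurableU; exact: measurableD.
  apply: le_trans (measureU2 _ (mF _ mA') (mF _ mAA)).
  apply: le_measure; rewrite ?inE; [exact: mF|apply: measurableU; exact: mF|].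
  move=> x /= Ax; have [A'x|A'x] := pselect (A' (F (sample (b x.1)) x.2)); first by left.
  by right; left.
have s1 := sub Y N D mLY mN mD.
have s2 := sub (Psi k) D N mLk mD mN.
rewrite (setUC (D `\` N)) in s2.
have z0 : law (Psi k) N = 0%E := scheme_null hb gb hQ (hs k) mN N0.
rewrite z0 add0e in s2.
apply: (le_trans s1); apply: (@le_trans _ _ (((e / 4)%:E + (e / 4)%:E) + (e / 4)%:E)%E); last first.
  by rewrite -!EFinD lee_fin.
apply: leeD => //; apply: (le_trans (cyl k n D cD)); apply: leeD.
  exact: le_trans s2 hk'.
by rewrite lee_fin ltW.
Qed.

End limit.

(** * Auxiliary bounds for the coupling *)

Lemma mes01_itv_le (R : realType) (x y c : R) : x <= y -> 0 < c ->
  (mes01 [set t : mI01 R | (x <= c * I01val t < y)%R] <= ((y - x) / c)%:E)%E.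
Proof.
move=> xy c0; set D := [set t | _].
have mD : measurable D.
  rewrite (_ : D = [set t | x <= c * I01val t /\ c * I01val t < y]).
    have m : measurable_fun setT (fun t : mI01 R => c * I01val t).
      by apply: measurable_funM; [exact: measurable_cst|exact: measurable_I01val].
    by apply: measurable_set_and; [apply: measurable_set_le|apply: measurable_set_lt] => //;
      exact: measurable_cst.
  by apply/seteqP; split => t /=; [move/andP|move=> [h1 h2]; rewrite /D/= h1 h2].
rewrite /mes01; apply: (@le_trans _ _ (lebesgue_measure `[x / c, y / c]%classic)).
  apply: le_measure; rewrite ?inE//; first exact: measurable_I01_image.
  move=> _ [t /= /andP[h1 h2] <-]; rewrite in_itv/=.
  by rewrite ler_pdivrMr// ler_pdivlMr// (mulrC (I01val t)) h1 ltW.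
rewrite lebesgue_measure_itv/= lte_fin; case: ifP => _.
  by rewrite -EFinB lee_fin -mulrBl.
by rewrite lee_fin divr_ge0 ?subr_ge0// ltW.
Qed.

Lemma measurable_fun_inv d (T : measurableType d) (R : realType) (f : T -> R) :
  measurable_fun setT f -> (forall x, 0 <= f x) -> measurable_fun setT (fun x => (f x)^-1).
Proof.
move=> mf f0; apply: measurable_fun_of_lt => r.
rewrite (_ : [set x | _] = [set x | (f x = 0 /\ 0 < r) \/ (0 < f x /\ 1 < r * f x)]).
  apply: measurableU; apply: measurable_set_and.
  - by apply: measurable_set_eq => //; exact: measurable_cst.
  - exact: measurable_set_const.
  - by apply: measurable_set_lt => //; exact: measurable_cst.
  - apply: measurable_set_lt; first exact: measurable_cst.
    by apply: measurable_funM => //; exact: measurable_cst.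
apply/seteqP; split => x /=; have [fx|fx] := eqVneq (f x) 0.
- by rewrite fx invr0 => r0; left.
- have fp : 0 < f x by rewrite lt_neqAle eq_sym fx f0.
  by move=> h; right; rewrite -ltr_pdivrMr// div1r.
- by rewrite fx invr0 ltxx => -[[]|[]].
- by move=> [[h]|[fp]]; [rewrite h eqxx in fx|rewrite -ltr_pdivrMr// div1r].
Qed.

(** * Coupling *)

Section coupling.
Context d (E : measurableType d) (R : realType) (la : probability E R)
  (Q : probability (seqsp E) R).
Hypothesis hQ : forall n A, (forall i, measurable (A i)) ->
  Q (box n A) = (\prod_(i < n) la (A i))%E.
Local Notation X := (seqsp E).
Local Notation I := (mI01 R).

Section randomized_swap.
Variables (nu : probability X R) (phi : X -> R) (a : nat -> X -> R).
Hypotheses (mphi : measurable_fun setT phi) (phi0 : forall x, 0 <= phi x)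
  (nuphi : forall f : X -> \bar R, measurable_fun setT f -> (forall x, (0 <= f x)%E) ->
      (\int[nu]_x f x = \int[Q]_x (f x * (phi x)%:E))%E)
  (nuQ : forall N, measurable N -> Q N = 0%E -> nu N = 0%E)
  (ma : forall n, measurable_fun setT (a n)) (a0 : forall n x, 0 <= a n x)
  (asum : {ae Q, forall x, (\sum_(0 <= n <oo) (a n x)%:E = (phi x)%:E)%E})
  (aswap : {ae Q, forall x,
    (\sum_(0 <= n <oo) (a n (reidx (blockswap n) x))%:E = 1)%E}).

Let A n x := \sum_(k < n) a k x.

Let mA n : measurable_fun setT (A n).
Proof. exact: measurable_sum. Qed.

Let AS n x : A n.+1 x = A n x + a n x.
Proof. by rewrite /A big_ord_recr. Qed.

(** For fixed [x] the interval from 0 to [phi x] is cut into consecutive pieces of lengths [a n x],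
    and a uniform [t] picks the piece containing [phi x * t]. So swap [n] is used with conditional
    probability [a n x / phi x]. *)
Let piece n : set (X * I) :=
  [set z | 0 < phi z.1 /\ A n z.1 <= phi z.1 * I01val z.2 < A n.+1 z.1].

Let mpiece n : measurable (piece n).
Proof.
have m1 (f : X -> R) : measurable_fun setT f -> measurable_fun setT (fun z : X * I => f z.1).
  by move=> mf; exact: (measurableT_comp mf measurable_fst).
have mt : measurable_fun setT (fun z : X * I => phi z.1 * I01val z.2).
  apply: measurable_funM; first exact: m1.
  exact: (measurableT_comp (@measurable_I01val R) measurable_snd).
apply: measurable_set_and.
  by apply: measurable_set_lt; [exact: measurable_cst|exact: m1].
rewrite (_ : (fun z => _) = [set z : X * I | A n z.1 <= phi z.1 * I01val z.2 /\
    phi z.1 * I01val z.2 < A n.+1 z.1]).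
  by apply: measurable_set_and; [apply: measurable_set_le|apply: measurable_set_lt] => //;
    exact: m1.
by apply/seteqP; split => t /=; [move/andP|move=> [h1 h2]; rewrite h1 h2].
Qed.

Definition swap_index (z : X * I) : nat :=
  if pselect (exists n, `[< piece n z >]) is left h then ex_minn h else 0%N.

Let swapped (z : X * I) : X := reidx (blockswap (swap_index z)) z.1.

Let swap_indexP z : (exists n, piece n z) -> piece (swap_index z) z.
Proof.
move=> [n hn]; rewrite /swap_index; case: pselect => [h|]; last first.
  by case; exists n; apply/asboolP.
by case: ex_minnP => k /asboolP.
Qed.

Let mswapped : measurable_fun setT swapped.
Proof.
pose D n := if n is k.+1 then [set z | piece k z /\ forall j, (j < k)%N -> ~ piece j z]
  else [set z | ~ exists k, piece k z].
pose F n (z : X * I) : X := if n is k.+1 then reidx (blockswap k) z.1 else reidx (blockswap 0) z.1.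
apply: (@measurable_fun_case_nat _ _ _ _ D F).
- case=> [|k] /=; first by apply: measurable_set_not; exact: measurable_set_exists.
  apply: measurable_set_and; first exact: mpiece.
  apply: measurable_set_forall => j; apply: measurable_set_imp; first exact: measurable_set_const.
  by apply: measurable_set_not; exact: mpiece.
- by case=> [|k]; exact: (measurableT_comp (@measurable_reidx _ E _) measurable_fst).
- move=> z; have [h|h] := pselect (exists k, piece k z); last by exists 0%N.
  have h' : exists n, `[< piece n z >] by case: h => n hn; exists n; apply/asboolP.
  case: (ex_minnP h') => k /asboolP hk kmin; exists k.+1; split=> // j jk /asboolP /kmin.
  by rewrite leqNgt jk.
- case=> [|k] z /=.
    move=> h; rewrite /swapped /swap_index; case: pselect => // h'.
    by exfalso; apply: h; case: h' => n /asboolP hn; exists n.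
  move=> [hk hj]; suff e : swap_index z = k by rewrite /swapped e.
  rewrite /swap_index; case: pselect => [h|]; last by case; exists k; apply/asboolP.
  case: ex_minnP => n /asboolP hn nmin; apply/eqP; rewrite eqn_leq nmin ?andTb; last exact/asboolP.
  by rewrite leqNgt; apply/negP => /hj.
Qed.

Let pieces_cover z : 0 < phi z.1 ->
  (\sum_(0 <= n <oo) (a n z.1)%:E = (phi z.1)%:E)%E -> exists n, piece n z.
Proof.
move=> p0 hsum; have /andP[t0 t1] := I01val_itv z.2.
have h : exists n, phi z.1 * I01val z.2 < A n z.1.
  apply: contrapT => h.
  have : ((phi z.1)%:E <= (phi z.1 * I01val z.2)%:E)%E.
    rewrite -hsum; apply: lime_le; first by apply: is_cvg_nneseries => n _; rewrite lee_fin.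
    apply: nearW => n; rewrite sumEFin lee_fin big_mkord leNgt; apply/negP => hn.
    by apply: h; exists n.
  by rewrite lee_fin leNgt gtr_pMr// t1.
case: (ex_minnP h) => -[|n]; first by rewrite /A big_ord0 ltNge mulr_ge0// ltW.
move=> hn nmin; exists n; split=> //; rewrite hn andbT leNgt; apply/negP => /nmin.
by rewrite ltnn.
Qed.

(** Integrating over [t] gives [a n x / phi x], and the density [phi] of [nu] cancels the
    denominator. The remaining integral over [Q] is transported by the swap. *)
Let piece_le n (C : set X) : measurable C ->
  ((nu \x (@mes01 R)) [set z | piece n z /\ C (reidx (blockswap n) z.1)] <=
   \int[Q]_x (\1_C x * a n (reidx (blockswap n) x))%:E)%E.
Proof.
move=> mC; have mr := @measurable_reidx _ E (blockswap n).
have mCr : measurable [set x : X | C (reidx (blockswap n) x)] by exact: (measurable_preimageT mr mC).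
have mV : measurable [set z : X * I | piece n z /\ C (reidx (blockswap n) z.1)].
  apply: measurable_set_and; first exact: mpiece.
  exact: (measurable_preimageT measurable_fst mCr).
rewrite [leLHS](product_measure_integral_l _ _ mV).
have m1C : measurable_fun setT (fun x : X => \1_C (reidx (blockswap n) x) : R).
  have m1 : measurable_fun setT (\1_C : X -> R) by exact: measurable_indic.
  exact: (measurableT_comp m1 mr).
pose f (x : X) : R := \1_C (reidx (blockswap n) x) * (a n x / phi x).
have f0 x : 0 <= f x by rewrite mulr_ge0// divr_ge0.
have mf : measurable_fun setT f.
  apply: measurable_funM => //; apply: measurable_funM => //.
  exact: measurable_fun_inv.
apply: (@le_trans _ _ (\int[nu]_x (f x)%:E)%E).
  apply: ge0_le_integral => //.
  - exact: measurable_fun_section_l.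
  - by apply/measurable_EFinP.
  - move=> x _ /=; rewrite /f indicE.
    have [Cx|Cx] := pselect (C (reidx (blockswap n) x)); last first.
      rewrite memNset// mul0r (_ : [set y | _] = set0) ?measure0//.
      by apply/seteqP; split => t //= [].
    rewrite mem_set// mul1r.
    have [px|px] := ltP 0 (phi x); last first.
      rewrite (_ : [set y | _] = set0) ?measure0 ?lee_fin ?divr_ge0//.
      by apply/seteqP; split => t //= [[/=]]; rewrite ltNge px.
    rewrite (_ : [set y | _] = [set t | A n x <= phi x * I01val t < A n.+1 x]); last first.
      by apply/seteqP; split => t /= => [[[]]|].
    have := @mes01_itv_le R (A n x) (A n.+1 x) (phi x); rewrite AS addrC addrK; apply => //.
    by rewrite lerDr.
rewrite nuphi//; last exact/measurable_EFinP.
apply: (@le_trans _ _ (\int[Q]_x (\1_C (reidx (blockswap n) x) * a n x)%:E)%E).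
  apply: ge0_le_integral => //.
  - by move=> x _; rewrite -EFinM lee_fin mulr_ge0.
  - by apply/measurable_EFinP; exact: measurable_funM.
  - by apply/measurable_EFinP; exact: measurable_funM.
  - move=> x _; rewrite -EFinM lee_fin /f -mulrA ler_wpM2l//.
    have [->|px] := eqVneq (phi x) 0; first by rewrite mulr0.
    by rewrite divfK.
rewrite [leRHS](@ge0_integral_law _ _ _ _ _ Q Q (reidx (blockswap n))) => //.
- apply: ge0_le_integral => //.
  + by move=> x _; rewrite lee_fin mulr_ge0.
  + by apply/measurable_EFinP; exact: measurable_funM.
  + apply/measurable_EFinP; apply: measurable_funM => //.
    exact: (measurableT_comp (measurableT_comp (ma n) mr) mr).
  + move=> x _; rewrite lee_fin (_ : reidx (blockswap n) (reidx (blockswap n) x) = x)//.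
    by apply/funext => i; rewrite /reidx blockswapK.
- move=> B mB; apply: (iid_reidx hQ (M := n + n)%N) => //; first exact: blockswapK.
  exact: blockswap_id.
- apply/measurable_EFinP; apply: measurable_funM; first exact: measurable_indic.
  exact: (measurableT_comp (ma n) mr).
- by move=> x; rewrite lee_fin mulr_ge0.
Qed.

(** Up to a null set the event is covered by the pieces, and the bounds of [piece_le] add up to the
    integral over [C] of the mass arriving at [x], which is 1. *)
Let swapped_le (C : set X) : measurable C ->
  ((nu \x (@mes01 R)) [set z | C (swapped z)] <= Q C)%E.
Proof.
move=> mC; have [B1 [mB1 B10 hB1]] := asum.
pose B0 : set X := [set x | phi x = 0].
have mB0 : measurable B0 by apply: measurable_set_eq => //; exact: measurable_cst.
have nuB0 : nu B0 = 0%E.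
  have := @nuphi (fun x => (\1_B0 x)%:E).
  rewrite integral_indic// setIT => ->; last 2 first.
  - by apply/measurable_EFinP; exact: measurable_indic.
  - by move=> x; rewrite lee_fin.
  apply: integral0_eq => x _; rewrite -EFinM indicE.
  have [xB|xB] := pselect (B0 x); last by rewrite memNset// mul0r.
  by rewrite (xB : phi x = 0) mulr0.
pose B : set (X * I) := (B0 `|` B1) `*` setT.
have mB : measurable B by apply: measurableX => //; exact: measurableU.
have nuB : (nu \x (@mes01 R))%E B = 0%E.
  transitivity (nu (B0 `|` B1) * (@mes01 R) setT)%E.
    by apply: product_measure1E => //; exact: measurableU.
  have -> : nu (B0 `|` B1) = 0%E by apply: measure0_U => //; exact: nuQ.
  by rewrite mul0e.
pose V n : set (X * I) := [set z | piece n z /\ C (reidx (blockswap n) z.1)].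
have mV n : measurable (V n).
  apply: measurable_set_and; first exact: mpiece.
  exact: (measurable_preimageT measurable_fst
    (measurable_preimageT (@measurable_reidx _ E (blockswap n)) mC)).
have mVU : measurable (\bigcup_n V n) by exact: bigcupT_measurable.
have mS : measurable [set z | C (swapped z)] by exact: measurable_preimageT mswapped mC.
apply: (@le_trans _ _ ((nu \x (@mes01 R)) ((\bigcup_n V n) `|` B))%E).
  apply: le_measure; rewrite ?inE//; first exact: measurableU.
  move=> z Cz; have [Bz|Bz] := pselect ((B0 `|` B1) z.1); [by right|left].
  exists (swap_index z) => //; split => //; apply: swap_indexP; apply: pieces_cover.
    by rewrite lt_neqAle phi0 andbT eq_sym; apply/eqP => h; apply: Bz; left.
  by apply: contrapT => h; apply: Bz; right; exact: hB1.
apply: (le_trans (measureU2 _ mVU mB)).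
have -> : ((nu \x (@mes01 R)) (\bigcup_n V n) + (nu \x (@mes01 R)) B =
    (nu \x (@mes01 R)) (\bigcup_n V n))%E by rewrite nuB adde0.
apply: (le_trans (measure_sigma_subadditive _ mV mVU _)) => //.
pose h n (x : X) : \bar R := (\1_C x * a n (reidx (blockswap n) x))%:E.
have h0 n x : (0 <= h n x)%E by rewrite lee_fin mulr_ge0.
have mh n : measurable_fun setT (h n).
  apply/measurable_EFinP; apply: measurable_funM; first exact: measurable_indic.
  exact: (measurableT_comp (ma n) (@measurable_reidx _ E _)).
apply: (@le_trans _ _ (\sum_(0 <= n <oo) \int[Q]_x h n x)%E).
  by apply: lee_nneseries => // n _; exact: piece_le.
rewrite -integral_nneseries//.
rewrite -[leRHS](_ : (\int[Q]_x (\1_C x)%:E = Q C)%E); last by rewrite integral_indic// setIT.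
have := aswap => -[N [mN N0 hN]].
rewrite (@ae_eq_integral _ _ _ Q setT (fun x => (\1_C x)%:E) (fun x => \sum_(0 <= n <oo) h n x)%E)//.
- apply: ge0_emeasurable_sum => //.
- by apply/measurable_EFinP; exact: measurable_indic.
exists N; split=> // x /= hx; apply: hN => /= hsum; apply: hx => _.
rewrite /h indicE; have [xC|xC] := boolP (x \in C).
  by under eq_eseriesr do rewrite mul1r; exact: hsum.
by under eq_eseriesr do rewrite mul0r; rewrite eseries0.
Qed.

Lemma measurable_swapped :
  measurable_fun setT (fun z : X * I => reidx (blockswap (swap_index z)) z.1).
Proof. exact: mswapped. Qed.

(** Both sides are probability measures, so the inequality for [C] and for its complement gives
    equality. *)
Lemma swapped_law (C : set X) : measurable C ->
  (nu \x (@mes01 R))%E [set z | C (reidx (blockswap (swap_index z)) z.1)] = Q C.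
Proof.
move=> mC; have mCc : measurable (~` C) by exact: measurableC.
have mS : measurable [set z | C (swapped z)] by exact: measurable_preimageT mswapped mC.
apply/eqP; rewrite eq_le; apply/andP; split; first exact: swapped_le.
have h := swapped_le mCc.
have e1 := probability_setC (nu \x (@mes01 R))%E mS.
have e2 := probability_setC Q mCc.
rewrite setCK in e2; rewrite [leLHS]e2.
have mSc : measurable (~` [set z | C (swapped z)]) by exact: measurableC.
have e3 := probability_setC (nu \x (@mes01 R))%E mSc.
rewrite setCK in e3; rewrite [leRHS]e3.
exact: leeB.
Qed.

End randomized_swap.

(** The i.i.d. sequence is obtained from [F] by a permutation of its coordinates, chosen with an
    independent uniform variable; the set enumerated by [F] is therefore unchanged. *)
Lemma iid_coupling dS (S : measurableType dS) (m : probability S R) (F : S -> X) :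
  measurable_fun setT F ->
  (forall N, measurable N -> Q N = 0%E -> m (F @^-1` N) = 0%E) ->
  exists k : X * I -> nat,
    measurable_fun setT (fun z : S * I => reidx (blockswap (k (F z.1, z.2))) (F z.1)) /\
    forall C, measurable C ->
     (m \x (@mes01 R))%E [set z | C (reidx (blockswap (k (F z.1, z.2))) (F z.1))] = Q C.
Proof.
move=> mF hF.
pose gF : {mfun S >-> X} := HB.pack F (isMeasurableFun.Build _ _ _ _ _ mF).
pose nu := distribution m gF.
have [phi [mphi phi0 nuphi]] := @density_exists _ X R nu Q hF.
have phi1 : (\int[Q]_x (phi x)%:E = 1)%E.
  transitivity (\int[nu]_x (cst 1%E x))%E; last first.
    by rewrite integral_cst// mul1e; exact: measure_probability_setT.
  by rewrite nuphi//; apply: eq_integral => x _; rewrite mul1e.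
have [a [ma a0 asum aswap]] := iid_transport hQ mphi phi0 phi1.
pose k := swap_index phi a.
have mk := measurable_swapped mphi ma.
exists k; split.
  have mFI : measurable_fun setT (fun z : S * I => (F z.1, z.2)).
    apply: measurable_fun_pair; last exact: measurable_snd.
    exact: (measurableT_comp mF measurable_fst).
  exact: (measurableT_comp mk mFI).
move=> C mC.
rewrite -[RHS](swapped_law mphi phi0 nuphi hF ma a0 asum aswap mC).
apply/esym; apply: (product_law_l (@mes01 R) (m1 := m) (m3 := nu)) => //.
exact: (measurable_preimageT mk mC).
Qed.

End coupling.

(** * The joining of the minimizers with an i.i.d. uniform sequence *)

Lemma local_minimizers_eq (R : realType) (f h : R -> R) :
  (forall t, 0 <= t <= 1 -> f t = h t) -> local_minimizers f `<=` local_minimizers h.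
Proof.
move=> fh s [s01 [e e0 he]]; split=> //.
exists (Num.min e (Num.min s (1 - s))); first by rewrite !lt_min e0; lra.
set r := Num.min _ _.
have [r1 [r2 r3]] : r <= e /\ r <= s /\ r <= 1 - s.
  by rewrite /r !ge_min !lexx !orbT.
move=> t ht; have t01 : 0 <= t <= 1.
  by case: ht => /=; rewrite in_itv/= => /andP[? ?]; lra.
rewrite -!fh//; last by lra.
by apply: he; case: ht => /=; rewrite in_itv/= => /andP[? ?]; [left|right];
  rewrite /= in_itv/=; lra.
Qed.

Theorem theorem4p7 (R : realType) (d : measure_display) (T : measurableType d)
    (P : probability T R) (B : R -> T -> R)
    (hP : standard_probability_space P) (hB : Brownian_motion P B) :
  let M := fun w : T => local_minimizers (fun t => B t w) in
  DCS_random_variable P M /\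
  exists J : probability (T * I01seq R)%type R,
    [/\ (forall A : set T, measurable A -> pushforward J fst A = P A),
        is_mes_infty (pushforward J snd)
      & {ae J, forall z : T * I01seq R, M z.1 = seq_set z.2}].
Proof.
move=> M; have [b [hb gb [N [mN N0 hN]]]] := good_version_exists hB.
have [Q hQ] := uniform_sequence_exists hb.
have [Y [mY hY lawY]] := enumeration_exists hb gb hQ.
have Mb w : ~ N w -> M w = local_minimizers (b w).
  move=> Nw; apply/seteqP; split; apply: local_minimizers_eq => t t01; first by rewrite hN.
  by rewrite hN.
have YM w u : local_minimizers (b w) = seq_set (Y (sample (b w)) u : I01seq R).
  have [_ hp hs] := hY (b w) u (gb w).
  apply/seteqP; split => [s /(good_pt_surj (gb w).1)[l <-]|_ [i _ <-]].
    by have [i hi] := hs l; exists i => //; rewrite hi.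
  by have [l ->] := hp i; exact: good_pt_local.
have msb := measurable_bv_sample hb.
split.
  (* The enumeration is complete and injective for every [u], so a constant [u] already gives a
     measurable enumeration on the given space. *)
  exists (fun w => Y (sample (b w)) point); split.
  - have mp : measurable_fun setT (fun w : T => (sample (b w), point : seqsp (mI01 R))).
      by apply: measurable_fun_pair => //; exact: measurable_cst.
    exact: (measurableT_comp mY mp).
  - move=> w; split; first by have [] := hY (b w) point (gb w).
    by rewrite -YM; exact: good_dense.
  - exists N; split=> // w /= h; apply: contrapT => Nw; apply: h.
    by rewrite Mb// (YM w point).
pose F (x : T * seqsp (mI01 R)) := Y (sample (b x.1)) x.2.
have mF : measurable_fun setT F.
  have mp : measurable_fun setT (fun x : T * seqsp (mI01 R) => (sample (b x.1), x.2)).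
    apply: measurable_fun_pair; last exact: measurable_snd.
    exact: (measurableT_comp msb measurable_fst).
  exact: (measurableT_comp mY mp).
have [k [mk lawk]] := iid_coupling hQ mF lawY.
(* Besides [w], the auxiliary space supplies the sequence [u] and the uniform variable of the swap;
   the joining is the law of [Z]. *)
pose Z (z : T * seqsp (mI01 R) * mI01 R) : T * I01seq R :=
  (z.1.1, reidx (blockswap (k (F z.1, z.2))) (F z.1)).
have mZ : measurable_fun setT Z.
  apply: measurable_fun_pair; last exact: mk.
  exact: (measurableT_comp measurable_fst measurable_fst).
pose gZ : {mfun (T * seqsp (mI01 R) * mI01 R)%type >-> (T * I01seq R)%type} :=
  HB.pack Z (isMeasurableFun.Build _ _ _ _ _ mZ).
have lawT A : measurable A -> (P \x Q \x (@mes01 R))%E [set z | A z.1.1] = P A.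
  move=> mA; rewrite (_ : [set z | _] = (A `*` setT) `*` setT); last first.
    by apply/seteqP; split => z //= [[]].
  transitivity ((P \x Q)%E (A `*` setT) * (@mes01 R) setT)%E.
    by apply: product_measure1E => //; exact: measurableX.
  rewrite measure_probability_setT mule1.
  transitivity (P A * Q setT)%E; first exact: product_measure1E.
  by rewrite measure_probability_setT mule1.
exists (distribution (P \x Q \x (@mes01 R))%E gZ); split.
- by move=> A mA; exact: lawT.
- move=> n A mA.
  pose A' i := if insub i is Some j then A j else setT.
  have A'E (i : 'I_n) : A' i = A i by rewrite /A' valK.
  have mA' i : measurable (A' i) by rewrite /A'; case: insub.
  rewrite (_ : [set u : I01seq R | _] = box n A'); last first.
    apply/seteqP; split => u /=.
      by move=> h i ilt; have := h (Ordinal ilt); rewrite -A'E.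
    by move=> h i; rewrite -A'E; exact: h.
  transitivity (Q (box n A')); first exact: (lawk (box n A') (measurable_box n mA')).
  by rewrite hQ//; apply: eq_bigr => i _; rewrite A'E.
(* A countable form of the event that the sequence enumerates exactly the local minimizers, which
   makes it measurable. *)
- pose G : set (T * I01seq R) := [set z |
    (forall i, exists l, pt l (sample (b z.1)) = z.2 i) /\
    (forall l, exists i, pt l (sample (b z.1)) = z.2 i)].
  have mE l i : measurable [set z : T * seqsp (mI01 R) | pt l (sample (b z.1)) = z.2 i].
    apply: measurable_set_eqI01.
      exact: (measurableT_comp (measurable_pt l) (measurableT_comp msb measurable_fst)).
    exact: (measurableT_comp (@measurable_coord _ (mI01 R) i) measurable_snd).
  have mG : measurable G.
    apply: measurable_set_and; apply: measurable_set_forall => i;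
      apply: measurable_set_exists => l; exact: mE.
  have mNT : measurable (N `*` [set: I01seq R]) by exact: measurableX.
  exists (~` G `|` N `*` setT); split.
  + by apply: measurableU => //; exact: measurableC.
  + apply: etrans N0; rewrite -(lawT _ mN).
    change ((P \x Q \x (@mes01 R))%E (Z @^-1` (~` G `|` N `*` setT)) =
      (P \x Q \x (@mes01 R))%E [set z | N z.1.1]).
    congr ((P \x Q \x (@mes01 R))%E _); apply/seteqP; split => z /=; last by right.
    move=> [nG|[]//]; exfalso; apply: nG.
    have [_ hp hs] := hY (b z.1.1) z.1.2 (gb z.1.1).
    split=> i /=; first by have [l hl] := hp (blockswap (k (F z.1, z.2)) i); exists l.
    have [j hj] := hs i; exists (blockswap (k (F z.1, z.2)) j).
    by rewrite /reidx blockswapK.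
  + move=> [w u] /= hz; apply: contrapT => /not_orP[/contrapT[/= h1 h2] Nw]; apply: hz.
    have {}Nw : ~ N w by move=> Nw'; exact: Nw.
    rewrite Mb//; apply/seteqP; split => [s /(good_pt_surj (gb w).1)[l <-]|_ [i _ <-]].
      by have [i ->] := h2 l; exists i.
    by have [l <-] := h1 i; exact: good_pt_local.
Qed.
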